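(* The bisimilarity problem for first-order grammars is Ackermann-hard. That is, the problem $\textsc{HP}_{\textsc{Ack}}$ is reducible, by a standard polynomial-time many-one reduction, to the bisimilarity problem for first-order grammars or to its complement.
   Context: Fix a countable set of variables $\{x_1,x_2,\dots\}$. Given a set $\mathcal N$ of function symbols, each with an arity in $\mathbb N$, the set $\mathcal T_{\mathcal N}$ of terms over $\mathcal N$ is defined inductively: every variable $x_i$ is a term, and if $A\in\mathcal N$ has arity $m$ and $U_1,\dots,U_m$ are terms then $A(U_1,\dots,U_m)$ is a term. A first-order grammar is a tuple $\mathcal G=(\mathcal N,\Sigma,\mathcal R)$ where $\mathcal N$ is a finite set of ranked nonterminals, $\Sigma$ is a finite set of actions, and $\mathcal R$ is a finite set of rules of the form $A(x_1,\dots,x_m)\xrightarrow{a}V$ with $A\in\mathcal N$ of arity $m$, $a\in\Sigma$, and $V\in\mathcal T_{\mathcal N}$ a term all of whose variables lie in $\{x_1,\dots,x_m\}$. The grammar defines a labelled transition system on $\mathcal T_{\mathcal N}$: each rule $A(x_1,\dots,x_m)\xrightarrow{a}V$ induces the transitions $A(x_1,\dots,x_m)\sigma\xrightarrow{a}V\sigma$ for all substitutions $\sigma$ mapping variables to terms. A relation $\mathcal B\subseteq\mathcal T_{\mathcal N}\times\mathcal T_{\mathcal N}$ is a bisimulation if it is symmetric and whenever $(T,U)\in\mathcal B$ and $T\xrightarrow{a}T'$ there is $U'$ with $U\xrightarrow{a}U'$ and $(T',U')\in\mathcal B$. Terms $T,U$ are bisimilar ($T\sim U$) if some bisimulation contains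 $(T,U)$. The bisimilarity problem for first-order grammars asks, given a grammar $\mathcal G$ and terms $T,U$, whether $T\sim U$. Define $f_0(n)=n+1$ and $f_{k+1}(n)=f_k^{\,n+1}(n)$ (i.e. $f_k$ applied $n+1$ times to $n$), and $f_A(n)=f_n(n)$. The problem $\textsc{HP}_{\textsc{Ack}}$ asks, given a Turing machine $M$, an input $w$, and $n\in\mathbb N$, whether $M$ halts on $w$ within $f_A(n)$ steps. A problem $\mathcal P$ is called Ackermann-hard if $\textsc{HP}_{\textsc{Ack}}$ is reducible to $\mathcal P$ or to its complement by a standard polynomial many-one reduction. *)

(* Defs.v *)
From mathcomp Require Import all_boot.
Set Implicit Arguments. Unset Strict Implicit. Unset Printing Implicit Defensive.

Definition unary_nat (k : nat) : seq bool := nseq k true ++ [:: false].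
Definition bits_of_nats (s : seq nat) : seq bool := flatten (map unary_nat s).

(* States and tape symbols are naturals; 0 is the start state and 0 is *)
(* the blank.  The transition table is a finite list of entries        *)
(* (q, a, q', b, d): in state q reading a, go to q', write b, move d;  *)
(* the first matching entry is used; the machine halts when no entry   *)
(* matches.  The tape is two-way infinite.  Input bits are written as  *)
(* symbols 1 (false) and 2 (true).                                     *)
Inductive move := MoveL | MoveR | Stay.

Record TM := MkTM { tm_delta : seq (nat * nat * nat * nat * move) }.

(* configuration: (state, left part reversed, scanned symbol, right part) *)
Definition config := (nat * seq nat * nat * seq nat)%type.

Fixpoint lookup_delta (l : seq (nat * nat * nat * nat * move)) (q a : nat)
  : option (nat * nat * move) :=
  match l with
  | [::] => None
  | (q0, a0, q1, b, d) :: l' =>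
      if (q0 == q) && (a0 == a) then Some (q1, b, d) else lookup_delta l' q a
  end.

Definition tm_step (M : TM) (c : config) : option config :=
  let '(q, L, a, R) := c in
  match lookup_delta (tm_delta M) q a with
  | None => None
  | Some (q', b, d) =>
      Some (match d with
            | MoveL => match L with
                       | [::] => (q', [::], 0, b :: R)
                       | x :: L' => (q', L', x, b :: R)
                       end
            | MoveR => match R with
                       | [::] => (q', b :: L, 0, [::])
                       | x :: R' => (q', b :: L, x, R')
                       end
            | Stay => (q', L, b, R)
            end)
  end.

Fixpoint tm_run (M : TM) (k : nat) (c : config) : option config :=
  match k with
  | 0 => Some c
  | k'.+1 => match tm_step M c with
             | None => None
             | Some c' => tm_run M k' c'
             end
  end.

Definition halts_after (M : TM) (c : config) (k : nat) : Prop :=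
  exists c', tm_run M k c = Some c' /\ tm_step M c' = None.

Definition sym_of_bit (b : bool) : nat := if b then 2 else 1.

Definition init_config (w : seq bool) : config :=
  match map sym_of_bit w with
  | [::] => (0, [::], 0, [::])
  | a :: r => (0, [::], a, r)
  end.

Definition tm_output (c : config) : seq bool :=
  let '(_, _, a, R) := c in
  let s := a :: R in
  map (fun t => t == 2) (take (find (fun t => (t != 1) && (t != 2)) s) s).

Fixpoint fgh (k : nat) (n : nat) : nat :=
  match k with
  | 0 => n.+1
  | k'.+1 => iter n.+1 (fgh k') n
  end.

Definition fA (n : nat) : nat := fgh n n.

Definition HP_Ack_holds (M : TM) (w : seq bool) (n : nat) : Prop :=
  exists k, k <= fA n /\ halts_after M (init_config w) k.

Definition enc_move (d : move) : nat :=
  match d with MoveL => 0 | MoveR => 1 | Stay => 2 end.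

Definition enc_TM (M : TM) : seq nat :=
  size (tm_delta M) ::
  flatten (map (fun e => let '(q, a, q', b, d) := e in [:: q; a; q'; b; enc_move d])
               (tm_delta M)).

Definition enc_HP (M : TM) (w : seq bool) (n : nat) : seq bool :=
  bits_of_nats (enc_TM M ++ [:: n; size w] ++ map nat_of_bool w).

Definition L_HP_Ack (x : seq bool) : Prop :=
  exists M w n, x = enc_HP M w n /\ HP_Ack_holds M w n.

(* Variables x_1, x_2, ... are Var 0, Var 1, ...; nonterminals are     *)
(* 0 .. size g_arity - 1 with arity nth 0 g_arity A; actions are nats. *)
Inductive term := Var of nat | App of nat & seq term.

Record grammar := MkGrammar {
  g_arity : seq nat;
  g_rules : seq (nat * nat * term)   (* (A, a, V) : A(x_1..x_m) -a-> V *)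
}.

Fixpoint wf_term (ar : seq nat) (vb : nat -> bool) (T : term) : bool :=
  match T with
  | Var i => vb i
  | App A Us => [&& A < size ar, size Us == nth 0 ar A & all (wf_term ar vb) Us]
  end.

Definition wf_grammar (G : grammar) : bool :=
  all (fun r => let '(A, a, V) := r in
                (A < size (g_arity G)) &&
                wf_term (g_arity G) (fun i => i < nth 0 (g_arity G) A) V)
      (g_rules G).

Fixpoint In_list {X : Type} (x : X) (l : seq X) : Prop :=
  match l with [::] => False | y :: l' => y = x \/ In_list x l' end.

Fixpoint subst (s : seq term) (V : term) : term :=
  match V with
  | Var i => nth (Var i) s i
  | App A Us => App A (map (subst s) Us)
  end.

Definition gstep (G : grammar) (T : term) (a : nat) (T' : term) : Prop :=
  match T with
  | Var _ => False
  | App A Us => exists V, In_list (A, a, V) (g_rules G) /\ T' = subst Us V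
  end.

Definition is_bisimulation (G : grammar) (B : term -> term -> Prop) : Prop :=
  (forall T U, B T U -> B U T) /\
  (forall T U, B T U -> forall a T', gstep G T a T' ->
      exists U', gstep G U a U' /\ B T' U').

Definition bisimilar (G : grammar) (T U : term) : Prop :=
  exists B, is_bisimulation G B /\ B T U.

Fixpoint enc_term (T : term) : seq nat :=
  match T with
  | Var i => [:: 0; i]
  | App A Us => [:: 1; A; size Us] ++ flatten (map enc_term Us)
  end.

Definition enc_grammar (G : grammar) : seq nat :=
  size (g_arity G) :: g_arity G ++
  size (g_rules G) :: flatten (map (fun r => let '(A, a, V) := r in
                                             [:: A; a] ++ enc_term V) (g_rules G)).

Definition enc_Bisim (G : grammar) (T U : term) : seq bool :=
  bits_of_nats (enc_grammar G ++ enc_term T ++ enc_term U).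

Definition L_Bisim (x : seq bool) : Prop :=
  exists G T U, x = enc_Bisim G T U /\ wf_grammar G /\
    wf_term (g_arity G) (fun _ => true) T /\
    wf_term (g_arity G) (fun _ => true) U /\ bisimilar G T U.

Definition computes_in_time (M : TM) (f : seq bool -> seq bool) (c d : nat) : Prop :=
  forall x, exists k, k <= c * (size x) ^ d + c /\
    exists cf, tm_run M k (init_config x) = Some cf /\ tm_step M cf = None /\
               tm_output cf = f x.

Definition poly_reduces (L1 L2 : seq bool -> Prop) : Prop :=
  exists (f : seq bool -> seq bool) (M : TM) (c d : nat),
    computes_in_time M f c d /\ forall x, L1 x <-> L2 (f x).

(* Main.v *)
(* The reduction is to non-bisimilarity.  Bisimilarity of two terms is a game in which
   Attacker chooses transitions and Defender answers.  Registers are the arguments of the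
   current nonterminal, holding numbers as chains [S^k Z]; they can be copied, reset and
   incremented.  Besides choices of Attacker there are choices of Defender, by the forcing
   gadget, and tests "this triple of registers is not in this finite set".

   Let [F = f_n(n) + l + 1], [l] the length of the input.  Attacker wins iff the machine,
   started on a blank tape and first writing its input, halts within [F] steps:
   - she builds a number [X <= F] by iterating the functions [f_j], using counters
     represented as differences of two registers, along which a potential bounded by
     [f_n(n)] does not increase;
   - she claims a halting configuration and justifies it backwards in time: a claim about
     the state and about the symbol in one cell at a given time is reduced to such claims
     one step earlier, Defender choosing which one is verified;
   - the backward run must spend at least [F] ticks, which is checked by iterating the [f_j]
     once more, with a potential that is now bounded from below.
   The bounds [X <= F] and [X >= F] pin the length of the simulation.

   The grammar is printed by a program with counters bounded by the length of the input and
   [for] loops; such a program runs on a one-tape machine in polynomial time. *)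

From Stdlib Require Import ZArith FunctionalExtensionality Classical.
Require Import Defs.
From mathcomp Require Import all_boot zify.
Set Implicit Arguments. Unset Strict Implicit. Unset Printing Implicit Defensive.

(** * A language of bounded counter programs *)

(** What shapes the game is how little Attacker can prove about registers: that two of them differ,
    or that a triple avoids a finite set. Registers cannot be decremented, and equality of unbounded
    registers cannot be tested. A counter is therefore a pair of registers, decremented by raising
    the smaller one after a test that the two differ.

    Equalities come from squeezing: an upper bound kept as an invariant meets a lower bound that
    Attacker has to prove. Time is treated so: with [T] ticks used, [T <= X <= F] is invariant and
    [T >= F] is proved at the end. That the observed cell is under the head, [L = R], is treated
    likewise: as [L + R + S = T], the number [S + (X - T) + 2 min(L, R)] equals [X - |L - R|], and
    it is at least [F] only if [X = F] and [L = R].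

    The exchanges between levels rest on [f_(j+1)(x) = f_j^(x+1)(x)]; an exchange made too early or
    with too small a number only loses.

    The blank tape makes the check at time 0 the same for every cell, although the distance of the
    observed cell from the head is unbounded. The summand [l + 1] of [F] pays for writing the input
    and stepping onto its first symbol. *)

Inductive cmd :=
| Skip
| Emit of bool
| Inc of nat
| Zero of nat
| IfBit of nat & cmd & cmd & cmd
| IfLt of nat & nat & cmd & cmd
| For of nat & cmd
| Seq of cmd & cmd.

Definition upd (e : nat -> nat) v k := fun u => if u == v then k else e u.
Definition state := ((nat -> nat) * seq bool)%type.

(** Values saturate at [size x], so a variable can be kept on the tape as a mark on one of the cells
    [0 .. size x]. The third branch of [IfBit] is taken beyond the end of the input. *)
Fixpoint exec (x : seq bool) (c : cmd) (s : state) : state :=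
  match c with
  | Skip => s
  | Emit b => (s.1, rcons s.2 b)
  | Inc v => (upd s.1 v (minn (s.1 v).+1 (size x)), s.2)
  | Zero v => (upd s.1 v 0, s.2)
  | IfBit v c1 c2 c3 =>
      if s.1 v < size x then
        if nth false x (s.1 v) then exec x c1 s else exec x c2 s
      else exec x c3 s
  | IfLt v u c1 c2 => if s.1 v < s.1 u then exec x c1 s else exec x c2 s
  | For v c1 =>
      let s' := foldl (fun s j => exec x c1 (upd s.1 v j, s.2)) s
                      (iota 0 (size x)) in
      (upd s'.1 v 0, s'.2)
  | Seq c1 c2 => exec x c2 (exec x c1 s)
  end.

Fixpoint writes (c : cmd) (w : nat) : bool :=
  match c with
  | Skip | Emit _ => false
  | Inc v | Zero v => v == w
  | IfBit _ c1 c2 c3 => [|| writes c1 w, writes c2 w | writes c3 w]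
  | IfLt _ _ c1 c2 | Seq c1 c2 => writes c1 w || writes c2 w
  | For v c1 => (v == w) || writes c1 w
  end.

(** A loop body may not write the loop variable: the compiled loop advances that variable by an
    increment after each round, whereas [exec] assigns it from the list of indices. *)
Fixpoint wfc (V : nat) (c : cmd) : bool :=
  match c with
  | Skip | Emit _ => true
  | Inc v | Zero v => v < V
  | IfBit v c1 c2 c3 => [&& v < V, wfc V c1, wfc V c2 & wfc V c3]
  | IfLt v u c1 c2 => [&& v < V, u < V, wfc V c1 & wfc V c2]
  | Seq c1 c2 => wfc V c1 && wfc V c2
  | For v c1 => [&& v < V, ~~ writes c1 v & wfc V c1]
  end.

(** Bounds both the number of sweeps over the tape and the number of bits printed. A round of [For]
    adds a test and an increment to its body, and the loop itself two resets and the final test. *)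
Fixpoint cost (N : nat) (c : cmd) : nat :=
  match c with
  | Skip | Emit _ | Inc _ | Zero _ => 1
  | IfBit v c1 c2 c3 => (cost N c1 + cost N c2 + cost N c3).+1
  | IfLt _ _ c1 c2 => (cost N c1 + cost N c2).+1
  | Seq c1 c2 => cost N c1 + cost N c2
  | For v c1 => N * (cost N c1 + 2) + 3
  end.

Definition bnd N (s : state) := forall v, s.1 v <= N.

Lemma upd_bnd N e o v k : bnd N (e, o) -> k <= N -> bnd N (upd e v k, o).
Proof. by move=> h hk u; rewrite /upd /=; case: eqP => // _; exact: h. Qed.

Lemma exec_bnd x c s : bnd (size x) s -> bnd (size x) (exec x c s).
Proof.
elim: c s => [|b|v|v|v c1 IH1 c2 IH2 c3 IH3|v u c1 IH1 c2 IH2|v c IH|c1 IH1 c2 IH2] [e o] hb //=.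
- by apply: upd_bnd => //; rewrite geq_minr.
- exact: upd_bnd.
- by do 2?[case: ifP => _]; [exact: IH1|exact: IH2|exact: IH3].
- by case: ifP => _; [exact: IH1|exact: IH2].
- apply: upd_bnd => //.
  have : forall r, all (fun j => j < size x) r -> forall s, bnd (size x) s ->
     bnd (size x) (foldl (fun s j => exec x c (upd s.1 v j, s.2)) s r).
    elim=> //= j r IHr /andP[hj hr] [e' o'] hs; apply: IHr => //.
    by apply: IH; apply: upd_bnd => //; rewrite ltnW.
  move=> /(_ (iota 0 (size x))) H; have {H}/H : all (fun j => j < size x) (iota 0 (size x)).
    by apply/allP => j; rewrite mem_iota.
  by move=> /(_ _ hb); case: (foldl _ _ _).
- by apply: IH2; apply: IH1.
Qed.

Lemma exec_nw x c s w : ~~ writes c w -> (exec x c s).1 w = s.1 w.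
Proof.
elim: c s => [|b|v|v|v c1 IH1 c2 IH2 c3 IH3|v u c1 IH1 c2 IH2|v c IH|c1 IH1 c2 IH2] [e o] //=.
- by rewrite /upd eq_sym => /negbTE ->.
- by rewrite /upd eq_sym => /negbTE ->.
- rewrite !negb_or => /and3P[h1 h2 h3].
  by do 2?[case: ifP => _]; [exact: IH1|exact: IH2|exact: IH3].
- by rewrite negb_or => /andP[h1 h2]; case: ifP => _; [exact: IH1|exact: IH2].
- rewrite negb_or eq_sym => /andP[hv hw]; rewrite {1}/upd (negbTE hv).
  have H r s : (foldl (fun s j => exec x c (upd s.1 v j, s.2)) s r).1 w = s.1 w.
    elim: r s => //= j r IHr s; rewrite IHr IH // /upd /=.
    by rewrite (negbTE hv).
  exact: H.
- by rewrite negb_or => /andP[h1 h2]; rewrite IH2 // IH1.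
Qed.

Lemma exec_size x c s : size (exec x c s).2 <= size s.2 + cost (size x) c.
Proof.
elim: c s => [|b|v|v|v c1 IH1 c2 IH2 c3 IH3|v u c1 IH1 c2 IH2|v c IH|c1 IH1 c2 IH2] [e o] //=;
  rewrite ?leq_addr //.
- by rewrite size_rcons addn1.
- by do 2?[case: ifP => _]; [have := IH1 (e, o)|have := IH2 (e, o)|have := IH3 (e, o)];
    rewrite /=; lia.
- by case: ifP => _; [have := IH1 (e, o)|have := IH2 (e, o)]; rewrite /=; lia.
- have H r s : size (foldl (fun s j => exec x c (upd s.1 v j, s.2)) s r).2 <=
     size s.2 + size r * (cost (size x) c).
    elim: r s => [|j r IHr] s; first by rewrite /= addn0.
    have := IHr (exec x c (upd s.1 v j, s.2)); have := IH (upd s.1 v j, s.2).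
    by move=> h2 h1; apply: leq_trans h1 _; rewrite mulSn addnA leq_add2r.
  by have := H (iota 0 (size x)) (e, o); rewrite size_iota /=; lia.
- by have := IH2 (exec x c1 (e, o)); have := IH1 (e, o); rewrite /=; lia.
Qed.

(** * Machines given state by state, and their moves on a tape area *)

Definition act := nat -> nat * nat * move.
Definition dact : act := fun a => (0, 0, Stay).

(** Each state below [size P] has an entry for each symbol below [A]; on such symbols the machine
    halts exactly by jumping to a state outside the program. *)
Definition table (A : nat) (P : seq act) :=
  flatten [seq [seq (q, a, (nth dact P q a).1.1, (nth dact P q a).1.2, (nth dact P q a).2)
               | a <- iota 0 A] | q <- iota 0 (size P)].
Definition tmof (A : nat) (P : seq act) := MkTM (table A P).

Lemma lookup_cat l1 l2 q a :
  lookup_delta (l1 ++ l2) q a =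
  if lookup_delta l1 q a is Some r then Some r else lookup_delta l2 q a.
Proof. by elim: l1 => //= -[[[[q0 a0] q1] b] d] l IH; case: ifP. Qed.

Lemma lookup_row (g : act) (q0 q a m A : nat) :
  lookup_delta [seq (q0, a, (g a).1.1, (g a).1.2, (g a).2) | a <- iota m A] q a =
  if (q0 == q) && (m <= a < m + A) then Some (g a) else None.
Proof.
elim: A m => [|A IH] m /=; first by case: ifP => //; lia.
rewrite IH; case: (q0 =P q) => //= _; case: (m =P a) => [->|hm] /=.
  by rewrite leqnn -addSnnS leq_addr /=; case: (g a) => -[].
by congr (if _ then _ else _); lia.
Qed.

Lemma lookup_table A P q a : a < A ->
  lookup_delta (table A P) q a = if q < size P then Some (nth dact P q a) else None.
Proof.
move=> ha; rewrite /table.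
have H m k : lookup_delta (flatten [seq [seq (q, a, (nth dact P q a).1.1, (nth dact P q a).1.2, (nth dact P q a).2)
               | a <- iota 0 A] | q <- iota m k]) q a = if m <= q < m + k then Some (nth dact P q a) else None.
  elim: k m => [|k IH] m /=; first by case: ifP => //; lia.
  rewrite lookup_cat lookup_row IH add0n ha /= andbT.
  case: (m =P q) => [->|hm]; first by rewrite leqnn -addSnnS leq_addr.
  by congr (if _ then _ else _); lia.
by rewrite H.
Qed.

Lemma tm_run_add M k1 k2 c c1 :
  tm_run M k1 c = Some c1 -> tm_run M (k1 + k2) c = tm_run M k2 c1.
Proof.
by elim: k1 c => [|k IH] c /=; [case=> ->|case: (tm_step M c) => // c'; exact: IH].
Qed.

Lemma tm_run1 M c c' : tm_step M c = Some c' -> tm_run M 1 c = Some c'.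
Proof. by move=> h; rewrite /tm_run h. Qed.

(* [H] is the code of the marker in the cell to the left of the tape area; all
   cells [c j] with [j >= 0] hold smaller codes. *)
Section Tape.
Variables (H : nat) (P : seq act).
Let M := tmof H.+1 P.
Implicit Types (c : nat -> nat).

Definition okc c := forall j, c j < H.
(** The left part is fixed as a list, since the marker has to be found at its end; the right part
    matters only up to trailing blanks. *)
Definition at_ c j q (cf : config) := exists R,
  cf = (q, rev [seq c i | i <- iota 0 j] ++ [:: H], c j, R) /\
  forall k, nth 0 R k = c (j + k.+1).
Definition athome c q (cf : config) := exists R,
  cf = (q, [::], H, R) /\ forall k, nth 0 R k = c k.

Definition mv B q j c q' j' c' := forall cf, at_ c j q cf -> exists k cf',
  [/\ k <= B, tm_run M k cf = Some cf' & at_ c' j' q' cf'].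

Lemma mv_trans B1 B2 q1 j1 c1 q2 j2 c2 q3 j3 c3 :
  mv B1 q1 j1 c1 q2 j2 c2 -> mv B2 q2 j2 c2 q3 j3 c3 ->
  mv (B1 + B2) q1 j1 c1 q3 j3 c3.
Proof.
move=> h1 h2 cf /h1[k1 [cf1 [hk1 r1 /h2[k2 [cf2 [hk2 r2 a2]]]]]].
by exists (k1 + k2), cf2; split; rewrite ?leq_add // (tm_run_add _ r1).
Qed.

Lemma mv_le B B' q1 j1 c1 q2 j2 c2 : B <= B' ->
  mv B q1 j1 c1 q2 j2 c2 -> mv B' q1 j1 c1 q2 j2 c2.
Proof.
move=> hB h1 cf /h1[k1 [cf1 [hk1 r1 a1]]]; exists k1, cf1; split=> //; lia.
Qed.

Lemma at_ext c c' j q cf : c =1 c' -> at_ c j q cf -> at_ c' j q cf.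
Proof.
move=> h [R [-> hR]]; exists R; split=> [|k]; last by rewrite hR h.
by rewrite h (eq_map h).
Qed.

Lemma mv_ext B q j c q' j' c' c'' : c' =1 c'' -> mv B q j c q' j' c' -> mv B q j c q' j' c''.
Proof.
move=> h h1 cf /h1[k1 [cf1 [hk1 r1 a1]]]; exists k1, cf1; split=> //; exact: at_ext a1.
Qed.

Lemma mv_refl B q j c : mv B q j c q j c.
Proof. by move=> cf h; exists 0, cf; split. Qed.

Lemma step_at c j q cf : okc c -> q < size P -> at_ c j q cf ->
  tm_step M cf = let '(q', b, d) := nth dact P q (c j) in
  let '(q, L, a, R) := cf in
              Some (match d with
            | MoveL => match L with
                       | [::] => (q', [::], 0, b :: R)
                       | x :: L' => (q', L', x, b :: R)
                       end
            | MoveR => match R with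
                       | [::] => (q', b :: L, 0, [::])
                       | x :: R' => (q', b :: L, x, R')
                       end
            | Stay => (q', L, b, R)
            end).
Proof.
by move=> ok hq [R [-> hR]]; rewrite /tm_step lookup_table ?hq ?ltnS 1?ltnW.
Qed.

Lemma mv_stay c j q q' b : okc c -> q < size P -> nth dact P q (c j) = (q', b, Stay) ->
  mv 1 q j c q' j (upd c j b).
Proof.
move=> ok hq e cf hcf; have := step_at ok hq hcf; rewrite e => hs.
case: hcf hs => R [-> hR] hs; exists 1; eexists; split=> //; first exact: tm_run1 hs.
exists R; split=> [|k]; last by rewrite hR /upd; case: eqP => //; lia.
rewrite /upd eqxx; congr (_, rev _ ++ _, _, _).
by apply/eq_in_map => i; rewrite mem_iota; case: eqP => //; lia.
Qed.

Lemma mv_right c j q q' b : okc c -> q < size P -> nth dact P q (c j) = (q', b, MoveR) ->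
  mv 1 q j c q' j.+1 (upd c j b).
Proof.
move=> ok hq e cf hcf; have := step_at ok hq hcf; rewrite e => hs.
case: hcf hs => R [-> hR] hs; exists 1; eexists; split=> //; first exact: tm_run1 hs.
have e1: b :: rev [seq c i | i <- iota 0 j] ++ [:: H] =
  rev [seq upd c j b i | i <- iota 0 j.+1] ++ [:: H].
  rewrite -addn1 iotaD map_cat rev_cat /= /upd add0n eqxx /=; congr (_ :: rev _ ++ _).
  by apply/eq_in_map => i; rewrite mem_iota; case: eqP => //; lia.
have e2 k : upd c j b (j.+1 + k) = c (j + k.+1).
  by rewrite /upd; case: eqP; rewrite ?addnS //; lia.
case: R hR {hs} => [|r R] hR; rewrite e1.
  exists [::]; split=> [|k]; last by rewrite e2 -hR !nth_nil.
  by congr (_, _, _, _); rewrite -[j.+1]addn0 e2 -(hR 0).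
exists R; split=> [|k]; last by rewrite e2 -hR.
by congr (_, _, _, _); rewrite -[j.+1]addn0 e2 -(hR 0).
Qed.

Lemma mv_left c j q q' b : okc c -> q < size P -> nth dact P q (c j.+1) = (q', b, MoveL) ->
  mv 1 q j.+1 c q' j (upd c j.+1 b).
Proof.
move=> ok hq e cf hcf; have := step_at ok hq hcf; rewrite e => hs.
case: hcf hs => R [-> hR] hs; exists 1; eexists; split=> //; first exact: tm_run1 hs.
rewrite -addn1 iotaD map_cat rev_cat /= add0n.
exists (b :: R); split=> [|[|k]]; rewrite /= ?hR /upd.
- rewrite ltn_eqF ?addn1 //; congr (_, rev _ ++ _, _, _).
  by apply/eq_in_map => i; rewrite mem_iota; case: eqP => //; lia.
- by rewrite addn1 eqxx.
- by rewrite addSnnS; case: eqP => //; lia.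
Qed.

Lemma home_step c q q' cf : okc c -> q < size P -> athome c q cf ->
  nth dact P q H = (q', H, MoveR) -> exists cf', tm_step M cf = Some cf' /\ at_ c 0 q' cf'.
Proof.
move=> ok hq [R [-> hR]] e; rewrite /tm_step lookup_table // hq e; eexists; split=> //.
case: R hR => [|r R] hR.
  by exists [::]; split=> [|k]; rewrite -?(hR 0) //= -hR nth_nil.
by exists R; split=> [|k]; rewrite -?(hR 0) //= -hR.
Qed.

Lemma left_home c q q' b cf : okc c -> q < size P -> at_ c 0 q cf ->
  nth dact P q (c 0) = (q', b, MoveL) ->
  exists cf', tm_step M cf = Some cf' /\ athome (upd c 0 b) q' cf'.
Proof.
move=> ok hq hcf e; have := step_at ok hq hcf; rewrite e.
case: hcf => R [-> hR] hs; eexists; split; first by rewrite hs.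
exists (b :: R); split=> // -[|k] //=; by rewrite hR /upd.
Qed.

Definition homeact s ex : act :=
  fun a => if a == H then (ex, H, MoveR) else (s, a, MoveL).

Lemma upd_id (e : nat -> nat) j : upd e j (e j) =1 e.
Proof. by move=> u; rewrite /upd; case: eqP => // ->. Qed.

Lemma mv_home s ex c j : okc c -> s < size P -> nth dact P s = homeact s ex ->
  mv (j + 2) s j c ex 0 c.
Proof.
move=> ok hs e; elim: j => [|j IH].
  move=> cf hcf.
  have [|cf1 [r1 h1]] := left_home ok hs hcf (q' := s) (b := c 0).
    by rewrite e /homeact ltn_eqF.
  have {}h1 : athome c s cf1.
    by case: h1 => R [-> hR]; exists R; split=> // k; rewrite hR upd_id.
  have [|cf2 [r2 h2]] := home_step ok hs h1 (q' := ex); first by rewrite e /homeact eqxx.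
  by exists 2, cf2; split=> //; rewrite (tm_run_add 1 (tm_run1 r1)) (tm_run1 r2).
rewrite addSn -add1n; apply: mv_trans IH; apply: mv_ext (@upd_id _ j.+1) _.
by apply: mv_left => //; rewrite e /homeact ltn_eqF.
Qed.

Definition scanact s (p : pred nat) (stop : act) : act :=
  fun a => if p a then stop a else (s, a, MoveR).

Lemma mv_scan s p stop c j m : okc c -> s < size P -> nth dact P s = scanact s p stop ->
  (forall i, j <= i < j + m -> ~~ p (c i)) -> mv m s j c s (j + m) c.
Proof.
move=> ok hs e; elim: m j => [|m IH] j hp; first by rewrite addn0; exact: mv_refl.
rewrite addnS -addSn -{1}add1n; apply: mv_trans (IH _ _); last by move=> i hi; apply: hp; lia.
apply: mv_ext (@upd_id _ j) _; apply: mv_right => //.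
by rewrite e /scanact (negbTE (hp _ _)) //; lia.
Qed.

End Tape.

(** * Packing bits and counter values into tape cells *)

Fixpoint marks V (e : nat -> nat) j :=
  if V is V'.+1 then marks V' e j + (e V' == j) * 2 ^ V' else 0.

Lemma marks_lt V e j : marks V e j < 2 ^ V.
Proof. by elim: V => //= V IH; rewrite expnS; case: eqP => _; lia. Qed.

Lemma marks_odd V e j v : v < V -> odd (marks V e j %/ 2 ^ v) = (e v == j).
Proof.
elim: V => //= V IH; rewrite ltnS leq_eqVlt => /orP[/eqP ->|hv].
  rewrite divnDr ?dvdn_mull // divn_small ?marks_lt // mulnK ?expn_gt0 //.
  by case: eqP.
have -> : 2 ^ V = 2 ^ (V - v.+1) * 2 * 2 ^ v by rewrite -mulnA -expnS -expnD subnK.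
by rewrite addnC !mulnA divnMDl ?expn_gt0 // oddD oddM andbF IH.
Qed.

Lemma marks_ge V e j v : v < V -> (e v == j) * 2 ^ v <= marks V e j.
Proof.
elim: V => //= V IH; rewrite ltnS leq_eqVlt => /orP[/eqP ->|hv]; first exact: leq_addl.
by apply: leq_trans (IH hv) _; exact: leq_addr.
Qed.

Lemma marks_upd V e j v k : v < V ->
  marks V (upd e v k) j = marks V e j - (e v == j) * 2 ^ v + (k == j) * 2 ^ v.
Proof.
have eqm W w : (forall u, u < W -> w u = e u) -> marks W w j = marks W e j.
  elim: W => //= W IH h; rewrite IH ?h // => u hu; apply: h; lia.
elim: V => //= V IH; rewrite ltnS leq_eqVlt => /orP[/eqP ->|hv].
  rewrite addnK eqm /upd ?eqxx // => u hu; case: eqP => //; lia.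
rewrite IH // [upd e v k V]/upd (gtn_eqF hv).
by rewrite -addnBAC ?marks_ge // addnAC.
Qed.

(** The digits agree with [sym_of_bit], with 0 for a missing bit, so neither the raw input nor the
    final output has to be recoded. *)
Definition itrit (s : seq bool) j := if j < size s then (nth false s j).+1 else 0.

Lemma itrit_lt s j : itrit s j < 3.
Proof. by rewrite /itrit; case: ifP => // _; case: nth. Qed.

Definition inp a := a %% 3.
Definition outt a := a %/ 3 %% 3.
Definition mk v a := odd (a %/ 9 %/ 2 ^ v).

Definition code_at (P : seq act) base l :=
  forall i, i < size l -> base + i < size P /\ nth dact P (base + i) = nth dact l i.

Lemma code_at_cat P base l1 l2 : code_at P base (l1 ++ l2) ->
  code_at P base l1 /\ code_at P (base + size l1) l2.
Proof.
move=> h; split=> i hi.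
  by case: (h i); rewrite ?size_cat ?nth_cat ?hi //; lia.
case: (h (size l1 + i)); rewrite ?size_cat ?ltn_add2l // nth_cat addnA => ? ->.
by split=> //; rewrite ltnNge leq_addr /= addKn.
Qed.

Lemma code_at0 P base a l : code_at P base (a :: l) -> base < size P /\ nth dact P base = a.
Proof. by move=> /(_ 0 isT); rewrite addn0. Qed.

Lemma code_at1 P base a l : code_at P base (a :: l) -> code_at P base.+1 l.
Proof. by move=> h i hi; have := h i.+1 hi; rewrite addnS addSn. Qed.

Section Compile.
Variables (V : nat) (x : seq bool).
Let H := 9 * 2 ^ V.
Let N := size x.

(* Cell [j] packs the [j]-th input bit, the [j]-th output bit and the set of the variables
   of value [j]. *)
Definition cell (s : state) j := itrit x j + 3 * itrit s.2 j + 9 * marks V s.1 j.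

Lemma inp_cell s j : inp (cell s j) = itrit x j.
Proof. by rewrite /inp /cell; have := itrit_lt x j; lia. Qed.
Lemma outt_cell s j : outt (cell s j) = itrit s.2 j.
Proof. by rewrite /outt /cell; have := itrit_lt x j; have := itrit_lt s.2 j; lia. Qed.
Lemma cell_div9 s j : cell s j %/ 9 = marks V s.1 j.
Proof. by rewrite /cell; have := itrit_lt x j; have := itrit_lt s.2 j; lia. Qed.
Lemma mk_cell s j v : v < V -> mk v (cell s j) = (s.1 v == j).
Proof. by move=> hv; rewrite /mk cell_div9 marks_odd. Qed.
Lemma okc_cell s : okc H (cell s).
Proof.
move=> j; rewrite /H /cell; have := itrit_lt x j; have := itrit_lt s.2 j.
by have := marks_lt V s.1 j; lia.
Qed.

Definition unmark v (s : state) := upd (cell s) (s.1 v) (cell s (s.1 v) - 9 * 2 ^ v).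

Lemma unmarkE v s j : v < V ->
  unmark v s j = itrit x j + 3 * itrit s.2 j + 9 * (marks V s.1 j - (s.1 v == j) * 2 ^ v).
Proof.
move=> hv; rewrite /unmark /upd; case: eqP => [->|/eqP h].
  by rewrite /cell eqxx; have := marks_ge s.1 (s.1 v) hv; rewrite eqxx; lia.
by rewrite eq_sym (negbTE h) mul0n subn0.
Qed.

Lemma okc_unmark v s : okc H (unmark v s).
Proof.
move=> j; rewrite /unmark /upd; have := @okc_cell s j; have := @okc_cell s (s.1 v).
by case: ifP => _; lia.
Qed.

Lemma remark v s k : v < V ->
  upd (unmark v s) k (unmark v s k + 9 * 2 ^ v) =1 cell (upd s.1 v k, s.2).
Proof.
move=> hv j; rewrite {1}/upd; case: eqP => [->|/eqP h].
  by rewrite unmarkE // /cell /= marks_upd // eqxx; lia.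
by rewrite unmarkE // /cell /= marks_upd // [k == j]eq_sym (negbTE h) mul0n addn0.
Qed.

Definition home := homeact H.

Definition emitc (b : bool) base ex : seq act :=
  [:: scanact base (fun a => outt a == 0) (fun a => (base.+1, a + 3 * b.+1, Stay));
      home base.+1 ex].
(** A mark found on a cell without input digit is on cell [size x]; it is left there, which realizes
    the saturation. *)
Definition incc v base ex : seq act :=
  [:: scanact base (mk v) (fun a => if inp a == 0 then (base.+2, a, Stay)
                                    else (base.+1, a - 9 * 2 ^ v, MoveR));
      (fun a => (base.+2, a + 9 * 2 ^ v, Stay)); home base.+2 ex].
Definition zeroc v base ex : seq act :=
  [:: scanact base (mk v) (fun a => (base.+1, a - 9 * 2 ^ v, Stay));
      home base.+1 base.+2; (fun a => (ex, a + 9 * 2 ^ v, Stay))].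
Definition bitc v base e1 e2 e3 : seq act :=
  [:: scanact base (mk v) (fun a => (base.+1 + inp a, a, Stay));
      home base.+1 e3; home base.+2 e2; home base.+3 e1].
(** The scan stops at the first of the two marks. Meeting that of [u], alone or together with that
    of [v], refutes [v < u]. *)
Definition ltc v u base e1 e2 : seq act :=
  [:: scanact base (fun a => mk v a || mk u a)
        (fun a => (if mk u a then base.+2 else base.+1, a, Stay));
      home base.+1 e1; home base.+2 e2].

Fixpoint clen (c : cmd) : nat :=
  match c with
  | Skip => 1
  | Emit _ => 2
  | Inc _ | Zero _ => 3
  | IfBit _ c1 c2 c3 => 4 + (clen c1 + (clen c2 + clen c3))
  | IfLt _ _ c1 c2 => 3 + (clen c1 + clen c2)
  | For _ c => 3 + (4 + (3 + (3 + clen c)))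
  | Seq c1 c2 => clen c1 + clen c2
  end.

(** Code starts in state [base] and leaves to state [ex], both with the head on cell 0. A loop is a
    test for an input digit under the mark of its variable; it is left when the variable has reached
    [size x]. *)
Fixpoint compile (c : cmd) (base ex : nat) : seq act :=
  match c with
  | Skip => [:: fun a => (ex, a, Stay)]
  | Emit b => emitc b base ex
  | Inc v => incc v base ex
  | Zero v => zeroc v base ex
  | IfBit v c1 c2 c3 =>
      let b1 := base + 4 in let b2 := b1 + clen c1 in let b3 := b2 + clen c2 in
      bitc v base b1 b2 b3 ++ (compile c1 b1 ex ++ (compile c2 b2 ex ++ compile c3 b3 ex))
  | IfLt v u c1 c2 =>
      let b1 := base + 3 in let b2 := b1 + clen c1 in
      ltc v u base b1 b2 ++ (compile c1 b1 ex ++ compile c2 b2 ex)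
  | For v c =>
      let b1 := base + 3 in let b2 := b1 + 4 in let b3 := b2 + 3 in let b4 := b3 + 3 in
      zeroc v base b1 ++ (bitc v b1 b4 b4 b2 ++ (zeroc v b2 ex ++
       (incc v b3 b1 ++ compile c b4 b3)))
  | Seq c1 c2 => compile c1 base (base + clen c1) ++ compile c2 (base + clen c1) ex
  end.

Lemma size_comp c base ex : size (compile c base ex) = clen c.
Proof.
elim: c base ex => //= [v c1 IH1 c2 IH2 c3 IH3|v u c1 IH1 c2 IH2|v c IH|c1 IH1 c2 IH2] base ex;
 by rewrite ?size_cat ?IH ?IH1 ?IH2 ?IH3.
Qed.

Variable P : seq act.
Notation mv := (mv H P).
Notation code_at := (code_at P).

Lemma nth_scan s p stop c j : okc H c -> nth dact P s = scanact s p stop ->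
  p (c j) -> nth dact P s (c j) = stop (c j).
Proof. by move=> _ ->; rewrite /scanact => ->. Qed.

Lemma mv_find s p stop c j l : okc H c -> code_at s (scanact s p stop :: l) ->
  (forall i, i < j -> ~~ p (c i)) -> mv j s 0 c s j c.
Proof.
move=> ok /code_at0[h1 h2] hp; rewrite -[in X in mv _ _ _ _ _ X _](add0n j).
by apply: mv_scan ok h1 h2 _ => i hi; apply: hp.
Qed.

Lemma emit_ok b base ex s B : code_at base (emitc b base ex) -> size s.2 <= B ->
  mv (2 * B + 8) base 0 (cell s) ex 0 (cell (s.1, rcons s.2 b)).
Proof.
move=> hc hB; have ok := okc_cell s; set j := size s.2.
have h1 : mv j base 0 (cell s) base j (cell s).
  apply: mv_find ok hc _ => i hi; rewrite outt_cell /itrit hi; by case: nth.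
have h2 : mv 1 base j (cell s) base.+1 j (cell (s.1, rcons s.2 b)).
  have [h2 h3] := code_at0 hc.
  apply: mv_ext (mv_stay (b := cell s j + 3 * b.+1) ok h2 _); last first.
    by rewrite h3 /scanact outt_cell /itrit ltnn.
  move=> i; rewrite /upd; case: eqP => [->|hi]; rewrite /cell /=.
    by rewrite /itrit size_rcons leqnn ltnn nth_rcons ltnn eqxx; lia.
  rewrite /itrit size_rcons nth_rcons; rewrite -/j ltnS; case: (ltngtP i j) => hij //=; lia.
have [h3 h4] := code_at0 (code_at1 hc).
have h5 := mv_home (j := j) (@okc_cell (s.1, rcons s.2 b)) h3 h4.
by apply: mv_le (mv_trans h1 (mv_trans h2 h5)); lia.
Qed.

Lemma find_mark v base stop l s : v < V -> code_at base (scanact base (mk v) stop :: l) ->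
  mv (s.1 v) base 0 (cell s) base (s.1 v) (cell s) /\
  nth dact P base (cell s (s.1 v)) = stop (cell s (s.1 v)).
Proof.
move=> hv hc; have ok := okc_cell s; split.
  by apply: mv_find ok hc _ => i hi; rewrite mk_cell // gtn_eqF.
have [_ h3] := code_at0 hc; apply: nth_scan h3 _ => //.
by rewrite mk_cell.
Qed.

Lemma inc_ok v base ex s B : code_at base (incc v base ex) -> v < V -> bnd N s -> N <= B ->
  mv (2 * B + 8) base 0 (cell s) ex 0 (cell (upd s.1 v (minn (s.1 v).+1 N), s.2)).
Proof.
move=> hc hv hs hB; have ok := okc_cell s; have [h1 h1'] := find_mark s hv hc.
have hj := hs v; have [p1 _] := code_at0 hc.
have [p3 n3] := code_at0 (code_at1 (code_at1 hc)).
rewrite inp_cell /itrit -/N in h1'; case: ltnP h1' => hN h1'.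
  have h2 := mv_right ok p1 h1'; rewrite -/(unmark v s) in h2.
  have [p2 n2] := code_at0 (code_at1 hc).
  have h3 := mv_stay (b := unmark v s (s.1 v).+1 + 9 * 2 ^ v) (j := (s.1 v).+1) (q' := base.+2)
               (okc_unmark v s) p2.
  rewrite n2 in h3; move/(_ erefl)/(mv_ext (remark s _ hv)): h3 => h3.
  have h4 := mv_home (j := (s.1 v).+1) (okc_cell (upd s.1 v (s.1 v).+1, s.2)) p3 n3.
  rewrite (minn_idPl hN).
  by apply: mv_le (mv_trans h1 (mv_trans h2 (mv_trans h3 h4))); lia.
have h2 := mv_ext (@upd_id _ _) (mv_stay ok p1 h1').
have h4 := mv_home (j := s.1 v) ok p3 n3.
rewrite (minn_idPr _); last lia.
have eN : N = s.1 v by lia.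
apply: mv_ext (mv_le _ (mv_trans h1 (mv_trans h2 h4))); last lia.
move=> j; rewrite /cell /= marks_upd // eN.
by have := marks_ge s.1 j hv; lia.
Qed.

Lemma zero_ok v base ex s B : code_at base (zeroc v base ex) -> v < V -> bnd N s -> N <= B ->
  mv (2 * B + 8) base 0 (cell s) ex 0 (cell (upd s.1 v 0, s.2)).
Proof.
move=> hc hv hs hB; have ok := okc_cell s; have [h1 h1'] := find_mark s hv hc.
have hj := hs v; have [p1 _] := code_at0 hc.
have [p2 n2] := code_at0 (code_at1 hc).
have [p3 n3] := code_at0 (code_at1 (code_at1 hc)).
have h2 := mv_stay ok p1 h1'; rewrite -/(unmark v s) in h2.
have h3 := mv_home (j := s.1 v) (okc_unmark v s) p2 n2.
have h4 := mv_stay (b := unmark v s 0 + 9 * 2 ^ v) (j := 0) (q' := ex) (okc_unmark v s) p3.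
rewrite n3 in h4; move/(_ erefl)/(mv_ext (remark s _ hv)): h4 => h4.
by apply: mv_le (mv_trans h1 (mv_trans h2 (mv_trans h3 h4))); lia.
Qed.

Lemma bit_ok v base e1 e2 e3 s B : code_at base (bitc v base e1 e2 e3) -> v < V ->
  bnd N s -> N <= B ->
  mv (2 * B + 8) base 0 (cell s)
    (if s.1 v < N then if nth false x (s.1 v) then e1 else e2 else e3) 0 (cell s).
Proof.
move=> hc hv hs hB; have ok := okc_cell s; have [h1 h1'] := find_mark s hv hc.
have hj := hs v; have [p1 _] := code_at0 hc.
have [p2 n2] := code_at0 (code_at1 hc).
have [p3 n3] := code_at0 (code_at1 (code_at1 hc)).
have [p4 n4] := code_at0 (code_at1 (code_at1 (code_at1 hc))).
have h2 := mv_ext (@upd_id _ _) (mv_stay ok p1 h1').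
have {}h2 := mv_trans h1 h2.
rewrite inp_cell /itrit -/N in h2; move: h2; case: ifP => _; last first.
  rewrite addn0 => h2; have h3 := mv_home (j := s.1 v) ok p2 n2.
  by apply: mv_le (mv_trans h2 h3); lia.
case: nth; rewrite ?addn2 ?addn1 => h2.
  have h3 := mv_home (j := s.1 v) ok p4 n4.
  by apply: mv_le (mv_trans h2 h3); lia.
have h3 := mv_home (j := s.1 v) ok p3 n3.
by apply: mv_le (mv_trans h2 h3); lia.
Qed.

Lemma lt_ok v u base e1 e2 s B : code_at base (ltc v u base e1 e2) -> v < V -> u < V ->
  bnd N s -> N <= B ->
  mv (2 * B + 8) base 0 (cell s) (if s.1 v < s.1 u then e1 else e2) 0 (cell s).
Proof.
move=> hc hv hu hs hB; have ok := okc_cell s; set j := minn (s.1 v) (s.1 u).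
have h1 : mv j base 0 (cell s) base j (cell s).
  apply: mv_find ok hc _ => i hi; rewrite !mk_cell // !gtn_eqF //; lia.
have hj := hs v; have [p1 n1] := code_at0 hc.
have hn : nth dact P base (cell s j) = (if s.1 u == j then base.+2 else base.+1, cell s j, Stay).
  rewrite (nth_scan ok n1) !mk_cell //; rewrite /j; lia.
have [p2 n2] := code_at0 (code_at1 hc).
have [p3 n3] := code_at0 (code_at1 (code_at1 hc)).
have h2 := mv_ext (@upd_id _ _) (mv_stay ok p1 hn).
have {h1} h2 := mv_trans h1 h2.
have -> : (s.1 v < s.1 u) = (s.1 u != j) by rewrite /j; lia.
case: eqP h2 => _ h2.
  have h3 := mv_home (j := j) ok p3 n3.
  by apply: mv_le (mv_trans h2 h3); lia.
have h3 := mv_home (j := j) ok p2 n2.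
by apply: mv_le (mv_trans h2 h3); lia.
Qed.

(** [B] bounds the distance of everything that is searched for: marks stay within [N], and the first
    free output cell within the bits already printed plus the cost still to come. Hence each unit of
    cost is one round trip of at most [2 * B + 8] steps. *)
Lemma comp_ok c base ex s B : wfc V c -> code_at base (compile c base ex) -> bnd N s ->
  N <= B -> size s.2 + cost N c <= B ->
  mv (cost N c * (2 * B + 8)) base 0 (cell s) ex 0 (cell (exec x c s)).
Proof.
elim: c base ex s => [|b|v|v|v c1 IH1 c2 IH2 c3 IH3|v u c1 IH1 c2 IH2|v c IH|c1 IH1 c2 IH2] base ex s.
- move=> _ hc hs hN hB; have [h1 h2] := code_at0 hc.
  apply: mv_le (mv_ext (@upd_id _ _) (mv_stay (q' := ex) (okc_cell s) h1 _)); first by rewrite /=; lia.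
  by rewrite h2.
- move=> _ hc hs hN hB; rewrite mul1n; apply: emit_ok => //; move: hB; rewrite /=; lia.
- move=> hv hc hs hN hB; rewrite mul1n; exact: inc_ok.
- move=> hv hc hs hN hB; rewrite mul1n; exact: zero_ok.
- move=> /and4P[hv w1 w2 w3] /code_at_cat[hc /code_at_cat[hc1 /code_at_cat[hc2 hc3]]] hs hN; rewrite [cost _ _]/= => hB; rewrite [exec _ _ _]/=.
  rewrite !size_comp in hc1 hc2 hc3.
  have h0 := bit_ok hc hv hs hN; rewrite -/N.
  move: h0; case: ifP => _; first case: nth => h0.
  - by apply: mv_le (mv_trans h0 (IH1 _ _ _ w1 hc1 hs hN _)); lia.
  - by apply: mv_le (mv_trans h0 (IH2 _ _ _ w2 hc2 hs hN _)); lia.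
  - by move=> h0; apply: mv_le (mv_trans h0 (IH3 _ _ _ w3 hc3 hs hN _)); lia.
- move=> /and4P[hv hu w1 w2] /code_at_cat[hc /code_at_cat[hc1 hc2]] hs hN; rewrite [cost _ _]/= => hB; rewrite [exec _ _ _]/=.
  rewrite !size_comp in hc1 hc2.
  have h0 := lt_ok hc hv hu hs hN.
  move: h0; case: ifP => _ h0.
  - by apply: mv_le (mv_trans h0 (IH1 _ _ _ w1 hc1 hs hN _)); lia.
  - by apply: mv_le (mv_trans h0 (IH2 _ _ _ w2 hc2 hs hN _)); lia.
- move=> /and3P[hv nw w] /code_at_cat[hz /code_at_cat[ht /code_at_cat[hz2 /code_at_cat[hi hc]]]] hs hN; rewrite [cost _ _]/= => hB; rewrite [exec _ _ _]/=.
  have h0 := zero_ok hz hv hs hN; rewrite -/N.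
  set D := 2 * B + 8 in h0 *; set K := cost N c in hB *.
  (* With [r] rounds left, the tape holds [s1] with [v] overwritten by [j], which is what [exec]
     does at the start of each round. *)
  have loop r j s1 : bnd N s1 -> j + r = N -> size s1.2 + r * K <= B ->
    mv ((r * (K + 2) + 2) * D) (base + 3) 0 (cell (upd s1.1 v j, s1.2)) ex 0
      (let s' := foldl (fun s j => exec x c (upd s.1 v j, s.2)) s1 (iota j r) in
       cell (upd s'.1 v 0, s'.2)).
    elim: r j s1 => [|r IHr] j s1 hs1 ej hsz; have e1 : (upd s1.1 v j, s1.2).1 v = j by rewrite /= /upd eqxx.
      have hs2 : bnd N (upd s1.1 v j, s1.2) by apply: upd_bnd => //; lia.
      have h1 := bit_ok ht hv hs2 hN; rewrite e1 in h1.
      rewrite -ej addn0 ltnn in h1.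
      have h2 := zero_ok hz2 hv hs2 hN.
      apply: mv_ext (mv_le _ (mv_trans h1 h2)); last by rewrite /D; lia.
      by move=> i; rewrite /cell /= !marks_upd // /upd eqxx; have := marks_ge s1.1 i hv; lia.
    have hs2 : bnd N (upd s1.1 v j, s1.2) by apply: upd_bnd => //; lia.
    have h1 := bit_ok ht hv hs2 hN; rewrite e1 in h1.
    have hjN : j < N by lia.
    rewrite hjN if_same in h1.
    have h2 := IH _ _ _ w hc hs2 hN; rewrite -/K in h2.
    have {}h2 : mv (K * D) (base + 3 + 4 + 3 + 3) 0 (cell (upd s1.1 v j, s1.2))
       (base + 3 + 4 + 3) 0 (cell (exec x c (upd s1.1 v j, s1.2))).
      by apply: h2; rewrite /=; lia.
    have hs3 := exec_bnd c hs2.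
    have h3 := inc_ok hi hv hs3 hN.
    rewrite exec_nw // e1 (minn_idPl hjN) in h3.
    have h4 := IHr j.+1 _ hs3; rewrite addSnnS in h4.
    have {}h4 := h4 ej; rewrite [foldl _ _ _]/=.
    apply: mv_le (mv_trans h1 (mv_trans h2 (mv_trans h3 (h4 _)))).
      by rewrite /D; lia.
    have := exec_size x c (upd s1.1 v j, s1.2); rewrite -/N -/K /= => hsz2.
    by apply: leq_trans (leq_add hsz2 (leqnn _)) _; move: hsz; rewrite mulSn; lia.
  have := loop N 0 s hs erefl; rewrite /= => h1.
  apply: mv_le (mv_trans h0 (h1 _)); first by rewrite /D; lia.
  by move: hB; lia.
- move=> /andP[w1 w2] /code_at_cat[hc1 hc2] hs hN; rewrite [cost _ _]/= => hB; rewrite [exec _ _ _]/=.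
  rewrite size_comp in hc2.
  have h1 := IH1 _ _ _ w1 hc1 hs hN; have h2 := IH2 _ _ _ w2 hc2 (exec_bnd c1 hs) hN.
  rewrite mulnDl; apply: mv_trans (h1 _) (h2 _); first lia.
  by have := exec_size x c1 s; rewrite -/N; lia.
Qed.

End Compile.

(** * The complete machine and its polynomial running time *)

Lemma cost_poly c : exists k d, forall N, cost N c <= k * N.+1 ^ d.
Proof.
have le_pow k d k' d' N : k <= k' -> d <= d' -> k * N.+1 ^ d <= k' * N.+1 ^ d'.
  by move=> hk hd; apply: leq_mul => //; apply: leq_pexp2l.
have one k d N : k <= k * N.+1 ^ d by rewrite leq_pmulr // expn_gt0.
elim: c => [|b|v|v|v c1 [k1 [d1 h1]] c2 [k2 [d2 h2]] c3 [k3 [d3 h3]]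
  |v u c1 [k1 [d1 h1]] c2 [k2 [d2 h2]]|v c [k [d h]]|c1 [k1 [d1 h1]] c2 [k2 [d2 h2]]].
1-4: by exists 1, 0.
- exists (k1 + k2 + k3 + 1), (d1 + d2 + d3) => N /=.
  rewrite !mulnDl -addn1; apply: leq_add; last exact: one.
  by apply: leq_add; [apply: leq_add|]; [apply: leq_trans (h1 N) _|apply: leq_trans (h2 N) _|
    apply: leq_trans (h3 N) _]; apply: le_pow => //; lia.
- exists (k1 + k2 + 1), (d1 + d2) => N /=.
  rewrite !mulnDl -addn1; apply: leq_add; last exact: one.
  by apply: leq_add; [apply: leq_trans (h1 N) _|apply: leq_trans (h2 N) _]; apply: le_pow => //; lia.
- exists (k + 5), d.+1 => N /=; have := h N; rewrite expnS => hN.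
  have p : 0 < N.+1 ^ d by rewrite expn_gt0.
  move: (N.+1 ^ d) p hN => M p hN; nia.
- exists (k1 + k2), (d1 + d2) => N /=.
  rewrite !mulnDl; apply: leq_add; [apply: leq_trans (h1 N) _|apply: leq_trans (h2 N) _];
  apply: le_pow => //; lia.
Qed.

Section Final.
Variables (V : nat) (c : cmd).
Hypothesis wf : wfc V c.
Let H := 9 * 2 ^ V.
Let F := 2 + clen c.

Definition cleanact : act :=
  fun a => if a == 0 then (F.+1, 0, Stay) else (F, outt a, MoveR).

(** The two initial states put the marks of all variables, of total weight [2 ^ V - 1], on cell 0
    and the marker on the cell to its left. *)
Definition prog : seq act :=
  [:: (fun a => (1, a + 9 * (2 ^ V).-1, MoveL)); (fun a => (2, H, MoveR))] ++
  (compile V c 2 F ++ [:: cleanact; home V F.+1 F.+2]).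

Definition st0 : state := (fun _ => 0, [::]).

Lemma size_prog : size prog = F.+2.
Proof. by rewrite /prog size_cat size_cat size_comp /=; lia. Qed.

Lemma marks0 W j : marks W (fun _ => 0) j = if j == 0 then (2 ^ W).-1 else 0.
Proof.
elim: W => [|W IH] /=; first by case: eqP.
by rewrite IH eq_sym; case: eqP => // _; rewrite expnS; have := expn_gt0 2 W; lia.
Qed.

Lemma marks_far W e j : (forall v, e v < j) -> marks W e j = 0.
Proof. by move=> h; elim: W => //= W ->; rewrite ltn_eqF. Qed.

Lemma init_run w : exists cf,
  tm_run (tmof H.+1 prog) 2 (init_config w) = Some cf /\ at_ H (cell V w st0) 0 2 cf.
Proof.
have hp0 q : q < 2 -> q < size prog by rewrite size_prog /F; lia.
have lk q a : q < 2 -> a < H.+1 -> lookup_delta (table H.+1 prog) q a = Some (nth dact prog q a).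
  by move=> hq ha; rewrite lookup_table // hp0.
have hH : 8 < H by rewrite /H; have := expn_gt0 2 V; lia.
have [a [R [-> ha hR]]] : exists a R, [/\ init_config w = (0, [::], a, R), a = itrit w 0 &
    forall k, nth 0 R k = itrit w k.+1].
  rewrite /init_config; case: w => [|b w].
    by exists 0, [::]; split=> // k; rewrite nth_nil.
  exists (sym_of_bit b), (map sym_of_bit w); split=> // [|k]; first by case: b.
  rewrite /itrit /= ltnS; case: ltnP => hk; last by rewrite nth_default // size_map.
  by rewrite (nth_map false) //; case: nth.
exists (2, [:: H], a + 9 * (2 ^ V).-1, R); split.
  have s1 : tm_step (tmof H.+1 prog) (0, [::], a, R) = Some (1, [::], 0, a + 9 * (2 ^ V).-1 :: R).
    by rewrite /tm_step /tmof /tm_delta lk // ha; have := itrit_lt w 0; lia.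
  rewrite -[2]/(1 + 1) (tm_run_add 1 (tm_run1 s1)); apply: tm_run1.
  by rewrite /tm_step /tmof /tm_delta lk.
exists R; split.
  by congr (_, _, _, _); rewrite /cell ha marks0 [itrit [::] 0]/itrit /= muln0 addn0.
move=> k; rewrite hR /cell marks0 /= /itrit /= add0n; lia.
Qed.

Lemma prog_code : code_at prog 2 (compile V c 2 F).
Proof.
have h : code_at prog 0 prog by move=> i hi; rewrite add0n.
by rewrite {2}/prog in h; case/code_at_cat: h => _ /code_at_cat[].
Qed.

Lemma prog_clean : code_at prog F [:: cleanact; home V F.+1 F.+2].
Proof.
have h : code_at prog 0 prog by move=> i hi; rewrite add0n.
by have [_ /code_at_cat[_]] := code_at_cat h; rewrite size_comp.
Qed.

(** One sweep up to the first zero cell is enough: input and output digits are contiguous from cell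
    0, and an empty input digit at [m] gives [size x <= m], beyond which there are no marks. *)
Lemma clean_ok x s m : cell V x s m = 0 -> (forall i, i < m -> cell V x s i != 0) ->
  bnd (size x) s -> mv H prog (m + (1 + (m + 2))) F 0 (cell V x s) F.+2 0 (itrit s.2).
Proof.
move=> hm0 hm hs.
have [p1 n1] := code_at0 prog_clean; have [p2 n2] := code_at0 (code_at1 prog_clean).
pose t j := fun i => if i < j then itrit s.2 i else cell V x s i.
have okt j : okc H (t j).
  move=> i; rewrite /t; case: ifP => _; last exact: okc_cell.
  by have := itrit_lt s.2 i; rewrite /H; have := expn_gt0 2 V; lia.
have h1 r j : j + r = m -> mv H prog r F j (t j) F m (t m).
  elim: r j => [|r IH] j e; first by rewrite -e addn0; exact: mv_refl.
  have {}IH := IH j.+1; rewrite addSnnS in IH; move/(_ e): IH => IH.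
  rewrite -add1n; apply: mv_trans IH.
  apply: mv_ext (mv_right (b := outt (t j j)) (okt j) p1 _); last first.
    by rewrite n1 /cleanact /t ltnn (negbTE (hm _ _)) //; lia.
  move=> i; rewrite /upd /t ltnn outt_cell ltnS.
  by case: (ltngtP i j) => // ->.
have h2 : mv H prog 1 F m (t m) F.+1 m (itrit s.2).
  apply: mv_ext (mv_stay (b := 0) (okt m) p1 _); last first.
    by rewrite n1 /cleanact /t ltnn hm0.
  have z : itrit s.2 m = 0 by move: hm0; rewrite /cell; lia.
  have zx : itrit x m = 0 by move: hm0; rewrite /cell; lia.
  move=> i; rewrite /upd /t; case: eqP => [->|hi]; first by rewrite z.
  case: ltnP => // hi2; have {hi2} hi : m < i by lia.
  have sz y : itrit y m = 0 -> size y <= m by rewrite /itrit; case: ltnP.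
  have zi y : itrit y m = 0 -> itrit y i = 0.
    by move/sz => h; rewrite /itrit ltnNge ltnW // (leq_ltn_trans h).
  rewrite /cell !zi // !add0n.
  rewrite marks_far // => W; apply: leq_ltn_trans (hs W) _; exact: leq_ltn_trans (sz _ zx) hi.
have oki : okc H (itrit s.2).
  by move=> i; have := itrit_lt s.2 i; rewrite /H; have := expn_gt0 2 V; lia.
apply: mv_trans (mv_trans h2 (mv_home (j := m) oki p2 n2)).
by have := h1 m 0 erefl.
Qed.

Lemma find_out (s : seq bool) (a : nat) R : a = itrit s 0 ->
  (forall k, nth 0 R k = itrit s k.+1) ->
  tm_output (0, [::], a, R) = s.
Proof.
move=> ha hR; rewrite /tm_output.
have hn k : nth 0 (a :: R) k = itrit s k by case: k => //=.
move: (a :: R) hn => {ha hR R} l hn.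
elim: s l hn => [|b s IH] [|t l] hn //=.
- by have := hn 0; rewrite /= /itrit /= => ->.
- by have := hn 0; rewrite /itrit.
have := hn 0; rewrite /itrit /= => et.
have {IH} := IH l; rewrite /tm_output => IH.
have -> : (t != 1) && (t != 2) = false by rewrite et; case: (b).
rewrite /= IH; first by rewrite et; case: (b).
by move=> k; have := hn k.+1.
Qed.

Theorem lang_poly :
  exists a d, computes_in_time (tmof H.+1 prog) (fun x => (exec x c st0).2) a d.
Proof.
have [k [d hk]] := cost_poly c.
have [a [d' ha]] : exists a d', forall N, 2 + cost N c * (2 * (N + cost N c) + 8) +
    (2 * (N + cost N c) + 7) <= a * N ^ d' + a.
  (* With [M = N.+1 ^ d] the cost is at most [k * M], and each summand is a multiple of
     [N.+1 * (M * M)]; [K] adds up the coefficients. *)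
  pose K := (k * (2 * k + 10) + 2 * k + 11); exists (K * 2 ^ (d + d).+1), (d + d).+1 => N.
  have h1 : 2 + cost N c * (2 * (N + cost N c) + 8) + (2 * (N + cost N c) + 7) <= K * N.+1 ^ (d + d).+1.
    have := hk N; rewrite expnS expnD; have p : 0 < N.+1 ^ d by rewrite expn_gt0.
    move: (N.+1 ^ d) p (cost N c) => M p C hC.
    have e1 : C * (2 * (N + C) + 8) <= k * M * (2 * (N + k * M) + 8).
      by apply: leq_mul => //; lia.
    have e2 : k * M * (2 * (N + k * M) + 8) <= k * (2 * k + 10) * (N.+1 * (M * M)) by nia.
    have e3 : M <= N.+1 * (M * M) by nia.
    have e4 : N.+1 <= N.+1 * (M * M) by nia.
    have e5 : 2 + (2 * (N + C) + 7) <= (2 * k + 11) * (N.+1 * (M * M)) by nia.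
    have -> : K = k * (2 * k + 10) + (2 * k + 11) by rewrite /K; lia.
    rewrite mulnDl addnAC [_ + C * _]addnC; apply: leq_add e5.
    exact: leq_trans e1 e2.
  apply: leq_trans h1 _; rewrite -mulnA -mulnDr leq_mul2l; apply/orP; right.
  (* The bound is wanted in powers of the length itself. A positive length is at least half its
     successor, whence the power of 2 in the constant; length 0 is covered by the additive
     constant. *)
  case: N => [|N]; first by rewrite exp1n addn_gt0 expn_gt0 orbT.
  apply: leq_trans (leq_addr _ _); rewrite -expnMn leq_exp2r //; lia.
exists a, d' => x.
have [cf0 [r0 a0]] := init_run x.
have hb : bnd (size x) st0 by move=> v.
have h1 := comp_ok (B := size x + cost (size x) c) wf prog_code hb (leq_addr _ _).
have [|k1 [cf1 [hk1 r1 a1]]] := h1 _ cf0 a0; first exact: leq_addl.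
have hs1 := exec_bnd c hb.
set s1 := exec x c st0 in hs1 a1 *.
have hz : exists m, cell V x s1 m == 0.
  exists (size x + size s1.2).+1; rewrite /cell /itrit !ltnNge !leqW ?leq_addr ?leq_addl //=.
  rewrite muln0 !add0n marks_far // => W.
  by apply: leq_ltn_trans (hs1 W) _; rewrite ltnS leq_addr.
case: (ex_minnP hz) => m /eqP hm0 hmin.
have hm i : i < m -> cell V x s1 i != 0.
  by move=> hi; apply/negP => /hmin; rewrite leqNgt hi.
have mle : m <= (size x + cost (size x) c).+1.
  rewrite leqNgt; apply/negP => /hm /negP; apply.
  have := exec_size x c st0; rewrite -/s1 /= add0n => hsz.
  rewrite /cell /itrit !ltnNge !leqW ?leq_addr ?leq_addl //=; last first.
    by rewrite (leq_trans hsz) ?leq_addl.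
  rewrite muln0 !add0n marks_far // => W.
  by apply: leq_ltn_trans (hs1 W) _; rewrite ltnS leq_addr.
have [k2 [cf2 [hk2 r2 a2]]] := clean_ok hm0 hm hs1 a1.
exists (2 + (k1 + k2)); split.
  by apply: leq_trans (ha (size x)); lia.
exists cf2; split; last split.
- by rewrite (tm_run_add _ r0) (tm_run_add _ r1).
- case: a2 => R [-> _]; rewrite /tm_step lookup_table ?size_prog ?ltnn //.
  by have := itrit_lt s1.2 0; rewrite /H; have := expn_gt0 2 V; lia.
- by case: a2 => R [-> hR]; rewrite -[RHS](@find_out _ _ R erefl hR).
Qed.

End Final.

(** * Bisimulation games on unary registers *)

Inductive arg := AV of nat & nat | AK of nat.
Notation target := (nat * seq arg)%type.
(** [IOpt] is a choice of Attacker under its own action, [IDef] a choice of Defender. At a test node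
    [IMemS s] is the triple tested and each [IMemT t] contributes one member to the finite set that
    [s] has to avoid. *)
Inductive item :=
| IOpt of nat & target
| IDef of target & target
| IMemS of seq arg
| IMemT of seq arg
| IWin.
Notation spec := (seq (nat * item)).

Definition ev (rho : seq nat) (a : arg) : nat :=
  match a with AV i c => nth 0 rho i + c | AK c => c end.

Definition succt (t : term) := App 0 [:: t].
Definition chain k := iter k succt (App 1 [::]).
Definition argt (a : arg) : term :=
  match a with AV i c => iter c succt (Var i) | AK c => chain c end.
(* Nonterminals [0], [1], [2] build chains and triples.  Node [A] owns five nonterminals:
   the two sides of its positions and three more for Defender's forcing gadget. *)
Definition nt A k := 3 + 5 * A + k.
Definition ttgt k (t : target) := App (nt t.1 k) (map argt t.2).
Definition idargs D := [seq AV i 0 | i <- iota 0 D].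

(** In the gadget for [IDef], side 0 can move to sides 2, 3, 4 and side 1 only to 3, 4, so Attacker
    has to enter side 2 and Defender picks 3 or 4. Against 3 only action 0 leads on, to the pair for
    [t1]; against 4 only action 1, to the pair for [t2]; the other action yields equal terms. In a
    test, side 1 offers the members only, so Attacker plays [s] and Defender has to answer with a
    member equal to it. *)
Definition rules_of D (p : nat * item) : seq (nat * nat * term) :=
  let A := p.1 in
  let I := (A, idargs D) in
  match p.2 with
  | IOpt a t => [:: (nt A 0, a, ttgt 0 t); (nt A 1, a, ttgt 1 t)]
  | IDef t1 t2 =>
      [:: (nt A 0, 0, ttgt 2 I); (nt A 0, 0, ttgt 3 I); (nt A 0, 0, ttgt 4 I);
          (nt A 1, 0, ttgt 3 I); (nt A 1, 0, ttgt 4 I);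
          (nt A 2, 0, ttgt 0 t1); (nt A 2, 1, ttgt 0 t2);
          (nt A 3, 0, ttgt 1 t1); (nt A 3, 1, ttgt 0 t2);
          (nt A 4, 0, ttgt 0 t1); (nt A 4, 1, ttgt 1 t2)]
  | IMemS s => [:: (nt A 0, 0, App 2 (map argt s))]
  | IMemT s => [:: (nt A 0, 0, App 2 (map argt s)); (nt A 1, 0, App 2 (map argt s))]
  | IWin => [:: (nt A 0, 0, App 1 [::])]
  end.

(** A chain of length [k] performs exactly [k] actions, and a triple exposes its components under
    three different actions; so bisimilarity of chains and of triples is equality. *)
Definition base_rules : seq (nat * nat * term) :=
  [:: (0, 0, Var 0); (2, 0, Var 0); (2, 1, Var 1); (2, 2, Var 2)].

Definition game_grammar D NN (sp : spec) : grammar :=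
  MkGrammar ([:: 1; 0; 3] ++ nseq (5 * NN) D)
            (base_rules ++ flatten (map (rules_of D) sp)).

Definition pos k A (rho : seq nat) := App (nt A k) (map chain rho).

(** A least fixed point, because infinite plays are won by Defender. *)
Inductive awin (sp : spec) : nat -> seq nat -> Prop :=
| awin_opt A rho a t : In_list (A, IOpt a t) sp ->
    awin sp t.1 (map (ev rho) t.2) -> awin sp A rho
| awin_def A rho t1 t2 : In_list (A, IDef t1 t2) sp ->
    awin sp t1.1 (map (ev rho) t1.2) -> awin sp t2.1 (map (ev rho) t2.2) -> awin sp A rho
| awin_mem A rho s : In_list (A, IMemS s) sp ->
    (forall t, In_list (A, IMemT t) sp -> map (ev rho) s <> map (ev rho) t) -> awin sp A rho
| awin_win A rho : In_list (A, IWin) sp -> awin sp A rho.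

Inductive kind := KOpt | KDef | KMem | KWin.
Definition kind_of (it : item) :=
  match it with
  | IOpt _ _ => KOpt | IDef _ _ => KDef | IMemS _ | IMemT _ => KMem | IWin => KWin
  end.

Definition wf_arg D (a : arg) := if a is AV i _ then i < D else true.
Definition wf_tgt D NN (t : target) := [&& t.1 < NN, size t.2 == D & all (wf_arg D) t.2].
Definition wf_item D NN (it : item) :=
  match it with
  | IOpt _ t => wf_tgt D NN t
  | IDef t1 t2 => wf_tgt D NN t1 && wf_tgt D NN t2
  | IMemS s | IMemT s => (size s == 3) && all (wf_arg D) s
  | IWin => true
  end.

(** With items of different kinds at one node, or two options under one action, Defender could
    answer by a rule that belongs to another item. *)
Record good_spec D NN (kd : nat -> kind) (sp : spec) : Prop := GoodSpec {
  gs_wf : forall A it, In_list (A, it) sp -> A < NN /\ wf_item D NN it;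
  gs_kind : forall A it, In_list (A, it) sp -> kind_of it = kd A;
  gs_opt : forall A a t t', In_list (A, IOpt a t) sp -> In_list (A, IOpt a t') sp -> t = t';
  gs_def : forall A t1 t2 t1' t2', In_list (A, IDef t1 t2) sp ->
     In_list (A, IDef t1' t2') sp -> t1 = t1' /\ t2 = t2';
  gs_mem : forall A s s', In_list (A, IMemS s) sp -> In_list (A, IMemS s') sp -> s = s' }.

Lemma In_list_cat (T : Type) (x : T) l1 l2 :
  In_list x (l1 ++ l2) <-> In_list x l1 \/ In_list x l2.
Proof. by elim: l1 => /= [|y l IH]; tauto. Qed.

Lemma In_flatten (S T : Type) (x : T) (f : S -> seq T) l :
  In_list x (flatten (map f l)) <-> exists2 y, In_list y l & In_list x (f y).
Proof.
elim: l => /= [|y l IH]; first by split=> // -[].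
rewrite In_list_cat IH; split.
  by case=> [h|[z h1 h2]]; [exists y; auto|exists z; auto].
by case=> z [<-|h1] h2; [left|right; exists z].
Qed.

Lemma bisim_sym G T U : bisimilar G T U -> bisimilar G U T.
Proof. by case=> B [[h1 h2] h]; exists B; split=> //; apply: h1. Qed.

Lemma bisim_step G T U a T' : bisimilar G T U -> gstep G T a T' ->
  exists2 U', gstep G U a U' & bisimilar G T' U'.
Proof.
case=> B [[h1 h2] h] hs; case: (h2 _ _ h _ _ hs) => U' [h3 h4].
by exists U' => //; exists B.
Qed.

Lemma pair3 (S T U : Type) (a a' : S) (b b' : T) (c c' : U) (P : Prop) :
  (a = a' -> b = b' -> c = c' -> P) -> (a, b, c) = (a', b', c') -> P.
Proof. by move=> h [h1 h2 h3]; apply: h. Qed.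

Section Game.
Variables (D NN : nat) (kd : nat -> kind) (sp : spec).
Hypothesis gs : good_spec D NN kd sp.
Let G := game_grammar D NN sp.

Lemma subst_argt rho a : wf_arg (size rho) a -> subst (map chain rho) (argt a) = chain (ev rho a).
Proof.
case: a => [i c|c] /= h.
  elim: c => [|c IH]; last by rewrite /= IH addnS.
  by rewrite /= (nth_map 0) // addn0.
by elim: c {h} => [|c IH] //=; rewrite IH.
Qed.

Lemma map_argt rho s : all (wf_arg (size rho)) s ->
  map (subst (map chain rho)) (map argt s) = map chain (map (ev rho) s).
Proof. by elim: s => //= a s IH /andP[h1 h2]; rewrite subst_argt // IH. Qed.

Lemma subst_ttgt k rho t : size rho = D -> wf_tgt D NN t ->
  subst (map chain rho) (ttgt k t) = pos k t.1 (map (ev rho) t.2).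
Proof. by move=> h /and3P[_ _ h2]; rewrite /pos /ttgt /= map_argt ?h. Qed.

Lemma subst_id k A rho : size rho = D ->
  subst (map chain rho) (ttgt k (A, idargs D)) = pos k A rho.
Proof.
move=> h; rewrite /ttgt [subst _ _]/=; congr App; rewrite map_argt /idargs.
  congr (map chain _); rewrite -map_comp -h -[RHS](mkseq_nth 0) /mkseq.
  by apply: eq_map => i; rewrite /= addn0.
by rewrite all_map; apply/allP => i; rewrite mem_iota h.
Qed.

Arguments subst : simpl never.

Lemma substE r B Us : subst r (App B Us) = App B (map (subst r) Us).
Proof. by []. Qed.

Lemma step_inv A k a T rho : k < 5 -> gstep G (pos k A rho) a T ->
  exists it V, [/\ In_list (A, it) sp, In_list (nt A k, a, V) (rules_of D (A, it))
    & T = subst (map chain rho) V].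
Proof.
move=> hk [V [hV ->]]; move: hV; rewrite [g_rules _]/= [In_list _ _]/=.
case; first by apply: pair3; rewrite /nt; lia.
do 3?[case; first by apply: pair3; rewrite /nt; lia].
move/In_flatten => [[A' it] h1 h2]; exists it, V.
suff e : A = A' by rewrite e in h2 * .
have : exists2 k', nt A' k' = nt A k & k' < 5; last by rewrite /nt; case=> k'; lia.
case: it {h1} h2 => [b t|t1 t2|s|s|] /=;
  repeat (case; [apply: pair3 => <- _ _|]; first by [exists 0|exists 1|exists 2|exists 3|exists 4]); by [].
Qed.

Lemma step_intro A it V k a rho : In_list (A, it) sp ->
  In_list (nt A k, a, V) (rules_of D (A, it)) ->
  gstep G (pos k A rho) a (subst (map chain rho) V).
Proof.
move=> h1 h2; exists V; split=> //.
by apply/In_list_cat; right; apply/In_flatten; exists (A, it).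
Qed.

Lemma chain_step k a T : gstep G (chain k) a T <-> [/\ a = 0 & exists2 j, k = j.+1 & T = chain j].
Proof.
split.
  case: k => [|k] [V []] /=.
    do 4?[case=> // ]; move/In_flatten => [[A it] _].
    by case: it => [b t|t1 t2|s|s|] /=; repeat (case; first by apply: pair3; rewrite /nt; lia).
  case=> [[<- <-] -> |]; first by split=> //; exists k.
  do 3?[case=> // ]; move/In_flatten => [[A it] _].
  by case: it => [b t|t1 t2|s|s|] /=; repeat (case; first by apply: pair3; rewrite /nt; lia).
by case=> -> [j -> ->]; exists (Var 0); split=> //; left.
Qed.

Lemma triple_step s a T : gstep G (App 2 (map chain s)) a T -> size s = 3 ->
  a < 3 /\ T = chain (nth 0 s a).
Proof.
case: s => [|s0 [|s1 [|s2 []]]] // [V []] /=.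
case; first by [].
do 3?[case; first by apply: pair3 => _ <- <- ->].
move/In_flatten => [[A it] _].
by case: it => [b t|t1 t2|s|s|] /=; repeat (case; first by apply: pair3; rewrite /nt; lia).
Qed.

Lemma triple_step' s a : size s = 3 -> a < 3 ->
  gstep G (App 2 (map chain s)) a (chain (nth 0 s a)).
Proof.
case: s => [|s0 [|s1 [|s2 []]]] //= _.
case: a => [|[|[|]]] // _; [exists (Var 0)|exists (Var 1)|exists (Var 2)]; split=> //=; tauto.
Qed.

Lemma chain_inj j k : bisimilar G (chain j) (chain k) -> j = k.
Proof.
elim: j k => [|j IH] [|k] // h.
- have /(bisim_step (bisim_sym h))[U] : gstep G (chain k.+1) 0 (chain k).
    by apply/chain_step; split=> //; exists k.
  by case/chain_step => _ [].
- have /(bisim_step h)[U] : gstep G (chain j.+1) 0 (chain j).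
    by apply/chain_step; split=> //; exists j.
  by case/chain_step => _ [].
have /(bisim_step h)[U] : gstep G (chain j.+1) 0 (chain j).
  by apply/chain_step; split=> //; exists j.
by case/chain_step => _ [i [->] ->] /IH ->.
Qed.

Lemma triple_inj s s' : size s = 3 -> size s' = 3 ->
  bisimilar G (App 2 (map chain s)) (App 2 (map chain s')) -> s = s'.
Proof.
move=> h h' hb; apply: (@eq_from_nth _ 0); first by rewrite h.
rewrite h => i hi.
have [U /triple_step[] // _ ->] := bisim_step hb (triple_step' h hi).
exact: chain_inj.
Qed.

(** Attacker always moves on side 0. The items at the node leave Defender only the intended answers,
    each of which leads to a pair excluded by the induction hypothesis or to different triples. *)
Lemma awin_sound A rho : awin sp A rho -> size rho = D ->
  ~ bisimilar G (pos 0 A rho) (pos 1 A rho).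
Proof.
have sz t rho' : wf_tgt D NN t -> size (map (ev rho') t.2) = D.
  by case/and3P => _ /eqP; rewrite size_map.
move=> hw; elim: hw => {A rho} [A rho a t h _ IH|A rho t1 t2 h _ IH1 _ IH2|A rho s h hm|A rho h] hs hb.
- have [_ w] := gs_wf gs h; have k := gs_kind gs h.
  have h0 : In_list (nt A 0, a, ttgt 0 t) (rules_of D (A, IOpt a t)) by left.
  have [U] := bisim_step hb (step_intro rho h h0).
  case/(step_inv (k := 1) isT) => it [V [h1 h2 ->]].
  have := gs_kind gs h1; rewrite -k; case: it h1 h2 => //= a' t' h1 + _.
  case; first by apply: pair3; rewrite /nt; lia.
  case=> //; apply: pair3 => _ ea <-; rewrite ea in h1; have {h1} <- := gs_opt gs h h1.
  by rewrite !subst_ttgt //; apply: IH; apply: sz.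
- have [_ /andP[w1 w2]] := gs_wf gs h; have k := gs_kind gs h.
  have h0 : In_list (nt A 0, 0, ttgt 2 (A, idargs D)) (rules_of D (A, IDef t1 t2)) by left.
  have [U] := bisim_step hb (step_intro rho h h0).
  case/(step_inv (k := 1) isT) => it [V [h1 h2 ->]].
  have := gs_kind gs h1; rewrite -k; case: it h1 h2 => //= t1' t2' h1 + _.
  have {h1} [<- <-] := gs_def gs h h1.
  have r1 : In_list (nt A 2, 0, ttgt 0 t1) (rules_of D (A, IDef t1 t2)) by rewrite /=; tauto.
  have r2 : In_list (nt A 2, 1, ttgt 0 t2) (rules_of D (A, IDef t1 t2)) by rewrite /=; tauto.
  have s1 := step_intro rho h r1; have s2 := step_intro rho h r2.
  have side kk a W : kk < 5 -> forall P : term -> Prop,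
     (forall V, In_list (nt A kk, a, V) (rules_of D (A, IDef t1 t2)) -> P (subst (map chain rho) V)) ->
     gstep G (pos kk A rho) a W -> P W.
    move=> hk P hP /(step_inv hk)[it [V' [g1 g2 ->]]].
    have := gs_kind gs g1; rewrite -k; case: it g1 g2 => //= u1 u2 g1 g2 _.
    by have [e1 e2] := gs_def gs h g1; apply: hP; rewrite /= e1 e2.
  do 3?[case; first by apply: pair3; rewrite /nt; lia].
  case; [apply: pair3 => _ _ <-|].
    rewrite !subst_id // => hb2; have [W sW] := bisim_step hb2 s1; move: W sW.
    have X W : gstep G (pos 3 A rho) 0 W -> W = pos 1 t1.1 (map (ev rho) t1.2).
      apply: (side 3 0 W isT (fun W => W = _)) => V' /=; repeat (case; first by apply: pair3; rewrite /nt; lia).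
      case; [apply: pair3 => _ _ <-|]; first by rewrite subst_ttgt.
      by repeat (case; first by apply: pair3; rewrite /nt; lia).
    move=> W /X ->; rewrite subst_ttgt //; apply: IH1; exact: sz.
  case; [apply: pair3 => _ _ <-|].
    rewrite !subst_id // => hb2; have [W sW] := bisim_step hb2 s2; move: W sW.
    have X W : gstep G (pos 4 A rho) 1 W -> W = pos 1 t2.1 (map (ev rho) t2.2).
      apply: (side 4 1 W isT (fun W => W = _)) => V' /=; repeat (case; first by apply: pair3; rewrite /nt; lia).
      by case=> //; apply: pair3 => _ _ <-; rewrite subst_ttgt.
    move=> W /X ->; rewrite subst_ttgt //; apply: IH2; exact: sz.
  by repeat (case; first by apply: pair3; rewrite /nt; lia).
- have [_ /andP[/eqP z w]] := gs_wf gs h; have k := gs_kind gs h.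
  have h0 : In_list (nt A 0, 0, App 2 (map argt s)) (rules_of D (A, IMemS s)) by left.
  have [U] := bisim_step hb (step_intro rho h h0).
  case/(step_inv (k := 1) isT) => it [V [h1 h2 ->]].
  have := gs_kind gs h1; rewrite -k; case: it h1 h2 => //= s' h1; first by case=> //; apply: pair3; rewrite /nt; lia.
  case; first by apply: pair3; rewrite /nt; lia.
  case=> //; apply: pair3 => _ _ <- _; have [_ /andP[/eqP z' w']] := gs_wf gs h1.
  rewrite !substE !map_argt ?hs // => /triple_inj; rewrite !size_map => /(_ z z').
  exact: hm.
- have k := gs_kind gs h.
  have h0 : In_list (nt A 0, 0, App 1 [::]) (rules_of D (A, IWin)) by left.
  have [U] := bisim_step hb (step_intro rho h h0).
  case/(step_inv (k := 1) isT) => it [V [h1 h2 ->]].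
  have := gs_kind gs h1; rewrite -k; case: it h1 h2 => //= h1.
  by case=> //; apply: pair3; rewrite /nt; lia.
Qed.

(** The pairs that Defender can hold: positions not won by Attacker, the intermediate pairs of the
    gadget whose pending successor is not won, and equal terms. *)
Definition defrel (T U : term) : Prop :=
  T = U \/ exists A rho, size rho = D /\
   [\/ [/\ ~ awin sp A rho, T = pos 0 A rho & U = pos 1 A rho],
    (exists t1 t2, [/\ In_list (A, IDef t1 t2) sp, ~ awin sp t1.1 (map (ev rho) t1.2),
        T = pos 2 A rho & U = pos 3 A rho]) |
    (exists t1 t2, [/\ In_list (A, IDef t1 t2) sp, ~ awin sp t2.1 (map (ev rho) t2.2),
        T = pos 2 A rho & U = pos 4 A rho])].

Definition defbis T U := defrel T U \/ defrel U T.

Lemma defbis_tgt t rho : ~ awin sp t.1 (map (ev rho) t.2) -> wf_tgt D NN t ->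
  size rho = D ->
  defbis (subst (map chain rho) (ttgt 0 t)) (subst (map chain rho) (ttgt 1 t)).
Proof.
move=> h w hs; left; right; exists t.1, (map (ev rho) t.2); split.
  by case/and3P: w => _ /eqP; rewrite size_map.
by constructor 1; split; rewrite ?subst_ttgt.
Qed.

Lemma defbis_sym T U : defbis T U -> defbis U T.
Proof. by case; [right|left]. Qed.

Lemma defbis_refl T : defbis T T.
Proof. by left; left. Qed.

Ltac inrules := rewrite /=; tauto.

Lemma awin_complete A rho : ~ awin sp A rho -> size rho = D ->
  bisimilar G (pos 0 A rho) (pos 1 A rho).
Proof.
move=> hA hsA; exists defbis; split; last first.
  by left; right; exists A, rho; split=> //; constructor 1.
split=> [T U|]; first exact: defbis_sym.
have intro' A' it V k a rho' : In_list (A', it) sp -> In_list (nt A' k, a, V) (rules_of D (A', it)) ->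
  forall T, defbis T (subst (map chain rho') V) -> exists U', gstep G (pos k A' rho') a U' /\ defbis T U'.
  by move=> h1 h2 T h3; eexists; split; last exact: h3; apply: step_intro h1 h2.
move=> T U [] []; first by [move=> <- a T' h; exists T'; split=> //; exact: defbis_refl].
- case=> {hA hsA A rho} A [rho [hs []]].
  + case=> hA -> -> a T' /(step_inv (k := 0) isT)[it [V [h1 h2 ->]]].
    have [_ w] := gs_wf gs h1.
    case: it h1 h2 w => [b t|t1 t2|s|s|] h1 h2 w; move: (h2) => /=.
    * case; [apply: pair3 => _ <- <-|]; last by case=> //; apply: pair3; rewrite /nt; lia.
      apply: (intro' A (IOpt b t)) => //; first by inrules.
      by apply: defbis_tgt => // hw; apply: hA; apply: awin_opt h1 hw.
    * case; [apply: pair3 => _ <- <-|].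
        (* Attacker does not win both successors; Defender selects one that is not won, and excluded
           middle tells which. *)
        case: (classic (awin sp t1.1 (map (ev rho) t1.2))) => hw.
          apply: (intro' A (IDef t1 t2) (ttgt 4 (A, idargs D))) => //; first by inrules.
          rewrite !subst_id //; left; right; exists A, rho; split=> //; constructor 3.
          by exists t1, t2; split=> // hw2; apply: hA; apply: awin_def h1 hw hw2.
        apply: (intro' A (IDef t1 t2) (ttgt 3 (A, idargs D))) => //; first by inrules.
        rewrite !subst_id //; left; right; exists A, rho; split=> //; constructor 2.
        by exists t1, t2.
      case; [apply: pair3 => _ <- <-|].
        by apply: (intro' A (IDef t1 t2)) (defbis_refl _) => //; inrules.
      case; [apply: pair3 => _ <- <-|].
        by apply: (intro' A (IDef t1 t2)) (defbis_refl _) => //; inrules.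
      by repeat (case; first by apply: pair3; rewrite /nt; lia).
    * case=> //; apply: pair3 => _ <- <-.
      have [t ht et] : exists2 t, In_list (A, IMemT t) sp & map (ev rho) s = map (ev rho) t.
        apply: NNPP => hn; apply: hA; apply: awin_mem h1 _ => t ht et; apply: hn.
        by exists t.
      apply: (intro' A (IMemT t) (App 2 (map argt t))) => //; first by inrules.
      have [_ /andP[_ w2]] := gs_wf gs ht; case/andP: w => _ w1.
      by rewrite !substE !map_argt ?hs // et; exact: defbis_refl.
    * case; [apply: pair3 => _ <- <-|]; last by case=> //; apply: pair3; rewrite /nt; lia.
      by apply: (intro' A (IMemT s)) (defbis_refl _) => //; inrules.
    * by case: hA; apply: awin_win h1.
  + case=> t1 [t2 [h hw -> ->]] a T' /(step_inv (k := 2) isT)[it [V [h1 h2 ->]]].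
    have := gs_kind gs h1; rewrite -(gs_kind gs h); case: it h1 h2 => // t1' t2' h1.
    have [<- <-] := gs_def gs h h1 => h2 _; have [_ /andP[w1 w2]] := gs_wf gs h.
    move: h2 => /=; do 5?[case; first by apply: pair3; rewrite /nt; lia].
    case; [apply: pair3 => _ <- <-|].
      apply: (intro' A (IDef t1 t2) (ttgt 1 t1)) => //; first by inrules.
      exact: defbis_tgt.
    case; [apply: pair3 => _ <- <-|]; first by apply: (intro' A (IDef t1 t2)) (defbis_refl _) => //; inrules.
    by repeat (case; first by apply: pair3; rewrite /nt; lia).
  + case=> t1 [t2 [h hw -> ->]] a T' /(step_inv (k := 2) isT)[it [V [h1 h2 ->]]].
    have := gs_kind gs h1; rewrite -(gs_kind gs h); case: it h1 h2 => // t1' t2' h1.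
    have [<- <-] := gs_def gs h h1 => h2 _; have [_ /andP[w1 w2]] := gs_wf gs h.
    move: h2 => /=; do 5?[case; first by apply: pair3; rewrite /nt; lia].
    case; [apply: pair3 => _ <- <-|]; first by apply: (intro' A (IDef t1 t2)) (defbis_refl _) => //; inrules.
    case; [apply: pair3 => _ <- <-|].
      apply: (intro' A (IDef t1 t2) (ttgt 1 t2)) => //; first by inrules.
      exact: defbis_tgt.
    by repeat (case; first by apply: pair3; rewrite /nt; lia).
- by move=> -> a T' h; exists T'; split=> //; exact: defbis_refl.
- case=> {hA hsA A rho} A [rho [hs []]].
  + case=> hA -> -> a T' /(step_inv (k := 1) isT)[it [V [h1 h2 ->]]].
    have [_ w] := gs_wf gs h1.
    case: it h1 h2 w => [b t|t1 t2|s|s|] h1 h2 w; move: (h2) => /=.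
    * case; first by apply: pair3; rewrite /nt; lia.
      case=> //; apply: pair3 => _ <- <-.
      apply: (intro' A (IOpt b t) (ttgt 0 t)) => //; first by inrules.
      apply: defbis_sym.
      by apply: defbis_tgt => // hw; apply: hA; apply: awin_opt h1 hw.
    * do 3?[case; first by apply: pair3; rewrite /nt; lia].
      do 2?[case; [apply: pair3 => _ <- <-|]; first by apply: (intro' A (IDef t1 t2)) (defbis_refl _) => //; inrules].
      by repeat (case; first by apply: pair3; rewrite /nt; lia).
    * by case=> //; apply: pair3; rewrite /nt; lia.
    * case; first by apply: pair3; rewrite /nt; lia.
      case=> //; apply: pair3 => _ <- <-.
      by apply: (intro' A (IMemT s)) (defbis_refl _) => //; inrules.
    * by case: hA; apply: awin_win h1.
  + case=> t1 [t2 [h hw -> ->]] a T' /(step_inv (k := 3) isT)[it [V [h1 h2 ->]]].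
    have := gs_kind gs h1; rewrite -(gs_kind gs h); case: it h1 h2 => // t1' t2' h1.
    have [<- <-] := gs_def gs h h1 => h2 _; have [_ /andP[w1 w2]] := gs_wf gs h.
    move: h2 => /=; do 7?[case; first by apply: pair3; rewrite /nt; lia].
    case; [apply: pair3 => _ <- <-|].
      apply: (intro' A (IDef t1 t2) (ttgt 0 t1)) => //; first by inrules.
      by apply: defbis_sym; exact: defbis_tgt.
    case; [apply: pair3 => _ <- <-|]; first by apply: (intro' A (IDef t1 t2)) (defbis_refl _) => //; inrules.
    by repeat (case; first by apply: pair3; rewrite /nt; lia).
  + case=> t1 [t2 [h hw -> ->]] a T' /(step_inv (k := 4) isT)[it [V [h1 h2 ->]]].
    have := gs_kind gs h1; rewrite -(gs_kind gs h); case: it h1 h2 => // t1' t2' h1.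
    have [<- <-] := gs_def gs h h1 => h2 _; have [_ /andP[w1 w2]] := gs_wf gs h.
    move: h2 => /=; do 9?[case; first by apply: pair3; rewrite /nt; lia].
    case; [apply: pair3 => _ <- <-|]; first by apply: (intro' A (IDef t1 t2)) (defbis_refl _) => //; inrules.
    case=> //; apply: pair3 => _ <- <-.
    apply: (intro' A (IDef t1 t2) (ttgt 0 t2)) => //; first by inrules.
    by apply: defbis_sym; exact: defbis_tgt.
Qed.

End Game.

(** * The fast-growing hierarchy *)

Lemma iter_ge (f : nat -> nat) m x : (forall y, y <= f y) -> x <= iter m f x.
Proof. by move=> h; elim: m => //= m IH; apply: leq_trans IH (h _). Qed.

Lemma iter_mono (f : nat -> nat) m m' x x' : (forall y, y <= f y) ->
  (forall y z, y <= z -> f y <= f z) -> m <= m' -> x <= x' -> iter m f x <= iter m' f x'.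
Proof.
move=> h1 h2 hm hx; rewrite -(subnK hm) addnC iterD; move: (m' - m) => d.
apply: (@leq_trans (iter m f x')); first by elim: m {hm} => //= m IH; exact: h2.
elim: m {hm} => /= [|m IH]; [exact: iter_ge|exact: h2].
Qed.

Lemma fgh_gt k x : x < fgh k x.
Proof.
elim: k x => //= k IH x; apply: leq_trans (IH x) _; rewrite -/(iter x.+1 _ _) iterSr.
by apply: iter_ge => y; exact: ltnW.
Qed.

Lemma fgh_ge k x : x <= fgh k x.
Proof. by rewrite ltnW ?fgh_gt. Qed.

Lemma fgh_mono k x y : x <= y -> fgh k x <= fgh k y.
Proof.
elim: k x y => //= k IH x y h; rewrite -!/(iter _.+1 _ _).
by apply: iter_mono => //; exact: fgh_ge.
Qed.

(** The number reached from [x] when all pending applications, [a i] of each [fgh i], are carried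
    out with the lower levels first. This is the potential of the two counting phases. *)
Fixpoint potf (a : nat -> nat) k x :=
  if k is k'.+1 then iter (a k') (fgh k') (potf a k' x) else x.

Lemma potf_le a b m k x y : potf a m x <= potf b m y ->
  (forall i, m <= i < m + k -> a i <= b i) -> potf a (m + k) x <= potf b (m + k) y.
Proof.
move=> h; elim: k => [|k IH] hab; first by rewrite addn0.
rewrite addnS /=; apply: iter_mono; [exact: fgh_ge|exact: fgh_mono|apply: hab; lia|].
by apply: IH => i hi; apply: hab; lia.
Qed.

Lemma potf_mono a b k x y : (forall i, i < k -> a i <= b i) -> x <= y -> potf a k x <= potf b k y.
Proof. by move=> h hx; apply: (@potf_le a b 0 k x y hx) => i; exact: h. Qed.

Lemma potf_eq a b k x : (forall i, i < k -> a i = b i) -> potf a k x = potf b k x.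
Proof.
by move=> h; apply/eqP; rewrite eqn_leq !potf_mono // => i hi; rewrite h.
Qed.

Lemma potf_zero a k x : (forall i, i < k -> a i = 0) -> potf a k x = x.
Proof. by elim: k => //= k IH h; rewrite h // IH // => i hi; apply: h; lia. Qed.

Lemma potf_ge a k x : x <= potf a k x.
Proof.
elim: k => //= k IH; apply: leq_trans IH _; apply: iter_ge; exact: fgh_ge.
Qed.

(** A pending application of [fgh j.+1] is exchanged for the [x + 1] applications of [fgh j] to [x]
    that define it. Whatever was pending on lower levels is discarded, which can only lower the
    result. *)
Lemma potf_fwd a a' j k x : j.+1 < k -> a' j.+1 < a j.+1 -> a' j = x.+1 ->
  (forall i, i < j -> a' i = 0) -> (forall i, j.+1 < i < k -> a' i = a i) ->
  potf a' k x <= potf a k x.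
Proof.
move=> hj h1 h2 h3 h4; rewrite -(subnKC hj); apply: potf_le; last first.
  by move=> i hi; rewrite h4 //; lia.
rewrite [X in X <= _]/= h2 (potf_zero _ h3) -[iter x.+1 _ _]/(fgh j.+1 x) -iterSr.
by apply: iter_mono => //; [exact: (fgh_ge j.+1)|exact: (@fgh_mono j.+1)|exact: potf_ge a j.+1 x].
Qed.

(** The opposite exchange: [fgh j.+1 m] consists of [m + 1] applications of [fgh j], which [b j > m]
    supplies, and they start from a number [z >= m]. So the potential cannot be raised by recording
    one more application on level [j.+1]. *)
Lemma potf_rev b b' j k z m : j.+1 < k -> b' j.+1 <= (b j.+1).+1 -> m < b j -> m <= z ->
  (forall i, i <= j -> b' i = 0) -> (forall i, j.+1 < i < k -> b' i = b i) ->
  potf b' k m <= potf b k z.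
Proof.
move=> hj h1 h2 h3 h4 h5; rewrite -(subnKC hj); apply: potf_le; last first.
  by move=> i hi; rewrite h5 //; lia.
rewrite [X in X <= _]/= (h4 j) // (@potf_zero _ j) => [|i hi]; last by apply: h4; lia.
apply: (@leq_trans (iter (b j.+1).+1 (fgh j.+1) m)).
  by apply: iter_mono => //; [exact: (fgh_ge j.+1)|exact: (@fgh_mono j.+1)].
rewrite iterSr; apply: iter_mono => //; [exact: (fgh_ge j.+1)|exact: (@fgh_mono j.+1)|].
rewrite -[fgh j.+1 m]/(iter m.+1 (fgh j) m) [X in _ <= X]/=.
apply: iter_mono => //; [exact: fgh_ge|exact: fgh_mono|].
exact: leq_trans h3 (potf_ge b j z).
Qed.

(** * Machine runs with the tape as a function on the integers *)

Notation delta := (seq (nat * nat * nat * nat * move)).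
(** The game follows one cell while the head moves; absolute positions make a cell at a given
    distance from the head easy to name. *)
Definition fconf := (nat * Z * (Z -> nat))%type.
Definition zupd (t : Z -> nat) h b := fun p => if Z.eqb p h then b else t p.
Definition mvz d := match d with MoveL => Zneg xH | MoveR => Zpos xH | Stay => Z0 end.

Definition fstep (E : delta) (c : fconf) : option fconf :=
  let '(q, h, t) := c in
  match lookup_delta E q (t h) with
  | None => None
  | Some (q', b, d) => Some (q', Z.add h (mvz d), zupd t h b)
  end.

Fixpoint frun (E : delta) k (c : fconf) : option fconf :=
  if k is k'.+1 then if fstep E c is Some c' then frun E k' c' else None else Some c.

Lemma frunS E k c : frun E k.+1 c = obind (fstep E) (frun E k c).
Proof.
elim: k c => [|k IH] c; first by rewrite /=; case: (fstep E c).
by rewrite [LHS]/=; case e: (fstep E c) => [c'|]; rewrite /= e // -IH.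
Qed.

Definition key (e : nat * nat * nat * nat * move) := (e.1.1.1.1, e.1.1.1.2).
Definition val_of (e : nat * nat * nat * nat * move) := (e.1.1.2, e.1.2, e.2).
Definition dent : nat * nat * nat * nat * move := (0, 0, 0, 0, Stay).

Lemma lookup_first (E : delta) i : i < size E ->
  (forall j, j < i -> key (nth dent E j) <> key (nth dent E i)) ->
  lookup_delta E (key (nth dent E i)).1 (key (nth dent E i)).2 = Some (val_of (nth dent E i)).
Proof.
elim: E i => //= -[[[[q0 a0] q1] b] d] E IH [|i] hi hj; first by rewrite /= !eqxx.
rewrite /= IH => [|//|j hj2]; last exact: (hj j.+1).
case: ifP => // /andP[/eqP e1 /eqP e2]; case: (hj 0 isT).
by rewrite /key /= e1 e2.
Qed.

Lemma lookup_someP (E : delta) q a v : lookup_delta E q a = Some v ->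
  exists i, [/\ i < size E, key (nth dent E i) = (q, a), val_of (nth dent E i) = v
    & forall j, j < i -> key (nth dent E j) <> (q, a)].
Proof.
elim: E => //= -[[[[q0 a0] q1] b] d] E IH; case: ifP => [/andP[/eqP <- /eqP <-] [<-]|h /IH].
  by exists 0.
case=> i [h1 h2 h3 h4]; exists i.+1; split=> // -[|j] hj; last exact: h4.
by case=> e1 e2; move: h; rewrite e1 e2 !eqxx.
Qed.

Lemma lookup_none (E : delta) q a : lookup_delta E q a = None <->
  forall j, j < size E -> key (nth dent E j) <> (q, a).
Proof.
split; last first.
  case e: (lookup_delta E q a) => [v|] // h.
  by have [i [h1 h2 _ _]] := lookup_someP e; case: (h i h1).
elim: E => //= -[[[[q0 a0] q1] b] d] E IH; case: ifP => // h /IH h2 [|j] hj; last exact: h2.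
by case=> e1 e2; move: h; rewrite e1 e2 !eqxx.
Qed.

(** * The game simulating the machine *)

(* [(c, vs)] denotes [c] plus the values of the (at most two) program variables [vs]. *)
Notation expr := (nat * seq nat)%type.
Definition evx (e : nat -> nat) (x : expr) :=
  match x.2 with
  | [::] => x.1
  | [:: v] => x.1 + e v
  | v :: w :: _ => x.1 + (e v + e w)
  end.
Arguments evx e !x /.

Inductive sarg := SV of expr & expr | SC of expr.
Definition ev_sarg e (a : sarg) : arg :=
  match a with SV i c => AV (evx e i) (evx e c) | SC c => AK (evx e c) end.

(** The effect of a move on the counter registers. Counter [i] is [u_i - v_i] while the number is
    built and [v_i - u_i] while it is checked; hence raising [v_(j+1)] spends an application of
    [f_(j+1)] under [VFwd] and records one under [VRev]. Under [VFwd] counter [j] becomes [rX + 1],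
    under [VRev] it becomes 0. *)
Inductive vmode := VKeep | VZero | VFwd | VRev.

(** Items are written symbolically over these variables, which are also variables of the printing
    program: [genv] gives the items their meaning, and a state of the program that agrees with it
    prints them. *)
Definition vn := 0. Definition vl := 1. Definition vne := 2. Definition vj := 3.
Definition vk := 4. Definition vq0 := 5. Definition va0 := 6. Definition vq1 := 7.
Definition vb := 8. Definition vdl := 9. Definition vdr := 10. Definition vds := 11.
Definition vidx := 12.

(* [rE0], [rE1] are the operands of the tests [nEQ], [nLT].  [rX] is the number built by
   Attacker and [rT] the number of ticks used so far.  Going back in time, [rL], [rR] and
   [rS] count the left, right and stationary moves of the head, whence [rL + rR + rS = rT];
   the cell under observation is at distance [rL - rR] to the left of the head.  [rq], [ra]
   are the claimed state and symbol, and [rq0], [ra0], [rq1], [rb], [rix] the fields and the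
   index of the chosen table entry. *)
Notation rE0 := 0. Notation rE1 := 1. Notation rX := 2. Notation rT := 3.
Notation rL := 4. Notation rR := 5. Notation rS := 6. Notation rq := 7.
Notation ra := 8. Notation rq0 := 9. Notation ra0 := 10. Notation rq1 := 11.
Notation rb := 12. Notation rix := 13. Notation rv0 := 14.

(* The arguments after register 14 are [u_0 v_1 u_1 ... v_n u_n]; the [j]-th
   slot is the pair [(u_j, v_(j+1))] and register [rv0] holds [v_0]. *)
Definition slot (m : vmode) (j0 j : nat) : arg * arg :=
  let keep := (AV (15 + (j + j)) 0, AV (16 + (j + j)) 0) in
  match m with
  | VKeep => keep
  | VZero => (AK 0, AK 0)
  | VFwd => if j < j0 then (AK 0, AK 0)
            else if j0 < j then keep else (AV rX 1, AV (16 + (j + j)) 1)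
  | VRev => if j < j0 then (AK 0, AK 0)
            else if j0 < j then keep else (AK 0, AV (16 + (j + j)) 1)
  end.

Record starget := STgt { s_node : nat; s_fix : seq sarg; s_mode : vmode; s_last : sarg }.

Definition ev_tgt e (t : starget) : target :=
  (s_node t, map (ev_sarg e) (s_fix t) ++
     (flatten [seq [:: (slot (s_mode t) (e vj) j).1; (slot (s_mode t) (e vj) j).2]
              | j <- iota 0 (e vn)] ++ [:: ev_sarg e (s_last t)])).

Inductive sitem :=
| SOpt of expr & starget
| SDef of starget & starget
| SMemS of seq sarg
| SMemT of seq sarg
| SWin.

Definition ev_item e (p : nat * sitem) : nat * item :=
  (p.1, match p.2 with
        | SOpt a t => IOpt (evx e a) (ev_tgt e t)
        | SDef t1 t2 => IDef (ev_tgt e t1) (ev_tgt e t2)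
        | SMemS s => IMemS (map (ev_sarg e) s)
        | SMemT s => IMemT (map (ev_sarg e) s)
        | SWin => IWin
        end).

Definition reg i c := SV (i, [::]) (c, [::]).
Definition cst c := SC (c, [::]).
Definition zer := cst 0.

Fixpoint over (ov : seq (nat * sarg)) i : sarg :=
  match ov with [::] => reg i 0 | (j, a) :: ov' => if j == i then a else over ov' i end.
Definition fx ov := [seq over ov i | i <- iota 0 15].
Definition ulast := SV (15, [:: vn; vn]) (0, [::]).
Definition keep A ov := STgt A (fx ov) VKeep ulast.

(** Attacker wins [nEQ] iff [rE0] and [rE1] differ, [nLT] unless [rE0 < rE1 <= rE0 + N], and [nSH]
    iff no table entry for [rq], [ra] has its index in the last [N] values below [rix]. [nC], [nCC]
    build the number; [nI], [nIC] let ticks pass; [nJ], [nHC] fix the halting claim. [nRUN] is a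
    claim at some time, [nP1] to [nP5] the checks of the table entry chosen to justify it. At [nG1],
    [nG1b], [nG1c] the observed cell is said to be the one just written, which [nZC] and its
    successors verify; at [nG2], [nG3] it is another one. [nEND] and its successors compare with the
    start. The remaining nodes, from [nGD] on, prove the lower bound on [rX]. *)
Definition nEQ := 0. Definition nLT := 1. Definition nSH := 2. Definition nWIN := 3.
Definition nC := 4. Definition nCC := 5. Definition nI := 6. Definition nIC := 7.
Definition nJ := 8. Definition nHC := 9. Definition nRUN := 10. Definition nP1 := 11.
Definition nP2 := 12. Definition nP3 := 13. Definition nP4 := 14. Definition nP5 := 15.
Definition nG1 := 16. Definition nG1b := 17. Definition nG1c := 18. Definition nG2 := 19.
Definition nG3 := 20. Definition nZC := 21. Definition nZC1 := 22. Definition nZC2 := 23.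
Definition nEND := 24. Definition nEND2 := 25. Definition nEND3 := 26. Definition nGD := 27.
Definition nREV := 28. Definition nRC := 29. Definition nLC := 30. Definition nLO := 31.
Definition nLC2 := 32. Definition nFIN := 33. Definition nFIN2 := 34. Definition NN := 35.

Definition fixed_items : seq (nat * sitem) :=
  [:: (nEQ, SMemS [:: reg rE0 0; zer; zer]);
      (nEQ, SMemT [:: reg rE1 0; zer; zer]);
      (nLT, SMemS [:: reg rE1 0; zer; zer]);
      (nSH, SMemS [:: reg rq 0; reg ra 0; reg rix 0]);
      (nWIN, SWin);
      (nC, SOpt (0, [::]) (STgt nI [:: zer; zer; SV (rX, [::]) (1, [:: vl]); zer; zer; zer; zer; zer; zer; zer; zer; zer; zer; zer; zer] VZero zer));
      (nC, SOpt (1, [::]) (keep nCC [:: (rE0, reg 15 0); (rE1, reg rv0 0); (rv0, reg rv0 1); (rX, reg rX 1)]));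
      (nCC, SDef (keep nEQ [::]) (keep nC [::]));
      (nI, SOpt (0, [::]) (keep nIC [:: (rE0, reg rX 0); (rE1, reg rT 0); (rT, reg rT 1)]));
      (nIC, SDef (keep nEQ [::]) (keep nI [::]));
      (nHC, SDef (keep nSH [:: (rix, SC (0, [:: vne]))])
                 (keep nRUN [:: (rL, zer); (rR, zer); (rS, reg rT 0)]));
      (nRUN, SOpt (0, [::]) (keep nEND [::]));
      (nP1, SDef (keep nEQ [::]) (keep nP2 [::]));
      (nP2, SDef (keep nSH [:: (rq, reg rq0 0); (ra, reg ra0 0)]) (keep nP3 [::]));
      (nP3, SDef (keep nLT [:: (rE0, reg rq 0); (rE1, reg rq1 0)]) (keep nP4 [::]));
      (nP4, SDef (keep nLT [:: (rE0, reg rq1 0); (rE1, reg rq 0)]) (keep nP5 [::]));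
      (nP5, SOpt (0, [::]) (keep nG1 [::]));
      (nP5, SOpt (1, [::]) (keep nG2 [::]));
      (nG1, SDef (keep nLT [:: (rE0, reg ra 0); (rE1, reg rb 0)]) (keep nG1b [::]));
      (nG1b, SDef (keep nLT [:: (rE0, reg rb 0); (rE1, reg ra 0)]) (keep nG1c [::]));
      (nG1c, SDef (keep nZC [:: (rq0, zer); (ra0, zer)])
                  (keep nRUN [:: (rq, reg rq0 0); (ra, reg ra0 0); (rL, zer); (rR, zer); (rS, reg rT 0)]));
      (nG2, SDef (keep nEQ [:: (rE0, reg rL 0); (rE1, reg rR 0)]) (keep nG3 [::]));
      (nG3, SDef (keep nRUN [:: (rq, reg rq0 0)])
                 (keep nRUN [:: (rq, reg rq0 0); (ra, reg ra0 0); (rL, zer); (rR, zer); (rS, reg rT 0)]));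
      (nZC, SOpt (0, [::]) (keep nZC1 [:: (rE0, reg rX 0); (rE1, reg rT 0); (rT, reg rT 1); (rS, reg rS 1)]));
      (nZC, SOpt (1, [::]) (keep nZC2 [:: (rE0, reg rL 0); (rE1, reg rq0 0); (rq0, reg rq0 1)]));
      (nZC, SOpt (2, [::]) (keep nGD [:: (rX, reg rS 0)]));
      (nZC1, SDef (keep nEQ [::]) (keep nZC [::]));
      (nZC2, SDef (keep nEQ [::])
                  (keep nZC1 [:: (rE0, reg rR 0); (rE1, reg ra0 0); (ra0, reg ra0 1); (rS, reg rS 2)]));
      (nEND, SDef (keep nLT [:: (rE0, reg rq 0); (rE1, SC (0, [:: vl]))]) (keep nEND2 [::]));
      (nEND2, SDef (keep nLT [:: (rE0, SC (0, [:: vl])); (rE1, reg rq 0)]) (keep nEND3 [::]));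
      (nEND3, SDef (keep nLT [:: (rE0, zer); (rE1, reg ra 0)]) (keep nGD [:: (rX, reg rT 0)]));
      (nGD, SDef (keep nLT [:: (rE0, reg rX 0); (rE1, SC (1, [:: vl]))])
                 (STgt nREV (fx [:: (rT, SC (1, [:: vl])); (rv0, zer)]) VZero zer));
      (nREV, SOpt (0, [::]) (keep nFIN [::]));
      (nREV, SOpt (1, [::]) (keep nRC [:: (rE0, reg rX 0); (rE1, reg rT 0); (rT, reg rT 1); (rv0, reg rv0 1)]));
      (nRC, SDef (keep nEQ [::]) (keep nREV [::]));
      (nLC, SDef (keep nEQ [::]) (keep nLO [::]));
      (nLO, SOpt (0, [::]) (keep nLC2 [:: (rE0, reg rL 0); (rE1, reg rR 0); (rR, reg rR 1)]));
      (nLO, SOpt (1, [::]) (keep nREV [:: (rX, reg rS 0); (rT, zer)]));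
      (nLC2, SDef (keep nEQ [::])
                  (keep nLC [:: (rE0, reg rX 0); (rE1, reg rT 0); (rT, reg rT 1); (rS, reg rS 1)]));
      (nFIN, SDef (keep nEQ [:: (rE0, SV (14, [:: vn; vn]) (0, [::])); (rE1, SV (15, [:: vn; vn]) (0, [::]))])
                  (keep nFIN2 [::]));
      (nFIN2, SDef (keep nLT [:: (rE0, reg rX 0); (rE1, SV (rT, [::]) (0, [:: vn]))]) (keep nWIN [::]))
  ].

Definition vec_items : seq (nat * sitem) :=
  [:: (nC, SOpt (2, [:: vj])
        (STgt nCC (fx [:: (rE0, SV (17, [:: vj; vj]) (0, [::])); (rE1, SV (16, [:: vj; vj]) (0, [::]));
                         (rv0, zer)]) VFwd ulast));
      (nREV, SOpt (2, [:: vj])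
        (STgt nLC (fx [:: (rE0, SV (14, [:: vj; vj]) (0, [::])); (rE1, SV (15, [:: vj; vj]) (0, [::]));
                         (rL, SV (14, [:: vj; vj]) (0, [::])); (rR, SV (15, [:: vj; vj]) (1, [::]));
                         (rS, zer); (rv0, zer)]) VRev ulast))].

Definition val_items : seq (nat * sitem) :=
  [:: (nLT, SMemT [:: SV (rE0, [::]) (1, [:: vk]); zer; zer]);
      (nI, SOpt (1, [:: vk]) (keep nJ [:: (rq, SC (0, [:: vk]))]));
      (nJ, SOpt (0, [:: vk]) (keep nHC [:: (ra, SC (0, [:: vk]))]))].

Definition pick_item : nat * sitem :=
  (nRUN, SOpt (1, [:: vidx])
    (keep nP1 [:: (rE0, reg rX 0); (rE1, reg rT 0); (rT, reg rT 1);
                  (rL, SV (rL, [::]) (0, [:: vdl])); (rR, SV (rR, [::]) (0, [:: vdr]));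
                  (rS, SV (rS, [::]) (0, [:: vds]));
                  (rq0, SC (0, [:: vq0])); (ra0, SC (0, [:: va0])); (rq1, SC (0, [:: vq1]));
                  (rb, SC (0, [:: vb])); (rix, SC (0, [:: vidx]))])).

(** For each [kk < N] this forbids the index [vidx + kk + 1], so the entry is found whenever it
    comes before the index under test. *)
Definition sh_item : nat * sitem :=
  (nSH, SMemT [:: SC (0, [:: vq0]); SC (0, [:: va0]); SC (1, [:: vidx; vk])]).

Definition entry := (nat * nat * nat * nat * move)%type.

Definition isL d := if d is MoveL then 1 else 0.
Definition isR d := if d is MoveR then 1 else 0.
Definition isS d := if d is Stay then 1 else 0.

Definition genv n l ne j kk (en : entry) idx : nat -> nat :=
  let '(q0, a0, q1, b, d) := en in
  nth 0 [:: n; l; ne; j; kk; q0; a0; q1; b; isL d; isR d; isS d; idx].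

Section Gspec.
Variables (n l N : nat) (ents : seq entry).
Let ne := size ents.

Definition ent_spec i : spec :=
  ev_item (genv n l ne 0 0 (nth dent ents i) i) pick_item ::
  [seq ev_item (genv n l ne 0 kk (nth dent ents i) i) sh_item | kk <- iota 0 N].

Definition gspec : spec :=
  map (ev_item (genv n l ne 0 0 dent 0)) fixed_items ++
  (flatten [seq map (ev_item (genv n l ne j 0 dent 0)) vec_items | j <- iota 0 n] ++
  (flatten [seq map (ev_item (genv n l ne 0 kk dent 0)) val_items | kk <- iota 0 N] ++
   flatten [seq ent_spec i | i <- iota 0 ne])).

Definition gD := 16 + (n + n).

Lemma in_gspec A it : In_list (A, it) gspec <->
  [\/ exists2 p, In_list p fixed_items & (A, it) = ev_item (genv n l ne 0 0 dent 0) p,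
      exists j p, [/\ j < n, In_list p vec_items & (A, it) = ev_item (genv n l ne j 0 dent 0) p],
      exists j p, [/\ j < N, In_list p val_items & (A, it) = ev_item (genv n l ne 0 j dent 0) p] |
      exists i, i < ne /\ ((A, it) = ev_item (genv n l ne 0 0 (nth dent ents i) i) pick_item \/
        exists2 j, j < N & (A, it) = ev_item (genv n l ne 0 j (nth dent ents i) i) sh_item)].
Proof.
have in_map (S T : Type) (f : S -> T) x s : In_list x (map f s) <-> exists2 y, In_list y s & x = f y.
  elim: s => /= [|y s IH]; first by split=> // -[].
  rewrite IH; split; first by case=> [<-|[w h ->]]; [exists y; auto|exists w; auto].
  by case=> w [->|h] ->; [left|right; exists w].
have in_iota m x : In_list x (iota 0 m) <-> x < m.
  have H b : In_list x (iota b m) <-> b <= x < b + m.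
    elim: m b => [|m IH] b /=; first by split=> //; lia.
    rewrite IH; split; first by case=> [->|]; lia.
    by move=> h; case: (b =P x); [left|right; lia].
  by rewrite H.
rewrite /gspec !In_list_cat in_map !In_flatten.
split.
- case=> [h|[[j /in_iota hj /in_map[p hp ->]]|[[j /in_iota hj /in_map[p hp ->]]|[i /in_iota hi h]]]].
  + by constructor 1.
  + by constructor 2; exists j, p.
  + by constructor 3; exists j, p.
  + constructor 4; exists i; split=> //; case: h => [->|/in_map[j /in_iota hj ->]]; first by left.
    by right; exists j.
- case=> [h|[j [p [hj hp ->]]]|[j [p [hj hp ->]]]|[i [hi h]]].
  + by left.
  + by right; left; exists j; [apply/in_iota|apply/in_map; exists p].
  + by right; right; left; exists j; [apply/in_iota|apply/in_map; exists p].
  + right; right; right; exists i; first exact/in_iota.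
    case: h => [->|[j hj ->]]; first by left.
    by right; apply/in_map; exists j => //; apply/in_iota.
Qed.

Definition gkind (A : nat) : kind :=
  if A == nWIN then KWin
  else if A \in [:: nEQ; nLT; nSH] then KMem
  else if A \in [:: nC; nI; nJ; nRUN; nP5; nZC; nREV; nLO] then KOpt else KDef.

Lemma all_flatten (T : Type) (p : pred T) (ss : seq (seq T)) :
  all p (flatten ss) = all (all p) ss.
Proof. by elim: ss => //= s ss IH; rewrite all_cat IH. Qed.

Lemma size_ev_tgt e t : size (s_fix t) = 15 -> e vn = n -> size (ev_tgt e t).2 = gD.
Proof.
move=> h en; rewrite /= !size_cat size_map h size_flatten /shape -map_comp.
rewrite (eq_map (g := fun=> 2)) // en /gD.
have -> m : sumn [seq 2 | _ <- iota 0 m] = m + m.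
  suff H b : sumn [seq 2 | _ <- iota b m] = m + m by [].
  by elim: m b => //= m IH b; rewrite IH; lia.
by rewrite /=; lia.
Qed.

Lemma wf_ev_tgt e t : s_node t < NN -> size (s_fix t) = 15 -> e vn = n ->
  all (wf_arg gD) (map (ev_sarg e) (s_fix t)) -> wf_arg gD (ev_sarg e (s_last t)) ->
  wf_tgt gD NN (ev_tgt e t).
Proof.
move=> h1 h2 en h3 h4; rewrite /wf_tgt size_ev_tgt // eqxx h1 !andTb /= !all_cat h3 /= h4 !andbT.
rewrite all_flatten all_map; apply/allP => j; rewrite mem_iota en /= add0n => hj.
rewrite andbT /slot /gD; case: (s_mode t) => //=; try lia;
 by do 2?[case: ifP => _ //=]; lia.
Qed.

Lemma gspec_wf A it : In_list (A, it) gspec -> A < NN /\ wf_item gD NN it.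
Proof.
case/in_gspec.
- by case=> p /=; repeat (case; first by move=> <- [-> ->]; split=> //=;
    rewrite ?wf_ev_tgt //= /gD /evx /=; lia).
- by case=> j [p [hj]]; repeat (case; first by move=> <- [-> ->]; split=> //=;
    rewrite ?wf_ev_tgt //= /gD /evx /=; lia).
- by case=> j [p [hj]]; repeat (case; first by move=> <- [-> ->]; split=> //=;
    rewrite ?wf_ev_tgt //= /gD /evx /=; lia).
- case=> i [hi]; case: (nth dent ents i) => [[[[q0 a0] q1] b] d].
  by case=> [|[j hj]] [-> ->]; split=> //=; rewrite ?wf_ev_tgt //= /gD /evx /=; lia.
Qed.

Lemma gspec_kind A it : In_list (A, it) gspec -> kind_of it = gkind A.
Proof.
case/in_gspec.
- by case=> p /=; repeat (case; first by move=> <- [-> ->]).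
- by case=> j [p [hj]]; repeat (case; first by move=> <- [-> ->]).
- by case=> j [p [hj]]; repeat (case; first by move=> <- [-> ->]).
- by case=> i [hi]; case: (nth dent ents i) => [[[[q0 a0] q1] b] d]; case=> [|[j hj]] [-> ->].
Qed.

Let E0 := genv n l ne 0 0 dent 0.
Let dtgt := STgt 0 [::] VKeep zer.

Definition fopt A a : starget :=
  head dtgt (pmap (fun p => if p.2 is SOpt c t then
    if (p.1 == A) && (c.1 == a) then Some t else None else None) fixed_items).
Definition fdef A : starget * starget :=
  head (dtgt, dtgt) (pmap (fun p => if p.2 is SDef t1 t2 then
    if p.1 == A then Some (t1, t2) else None else None) fixed_items).
Definition fmem A : seq sarg :=
  head [::] (pmap (fun p => if p.2 is SMemS s then
    if p.1 == A then Some s else None else None) fixed_items).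
Definition stgt_of (p : nat * sitem) := if p.2 is SOpt _ t then t else dtgt.

(** Uniqueness of options in functional form: once the target of every option is computed from its
    node and action, two options with the same action coincide. [fdef] and [fmem] do the same for
    the other items. *)
Definition dopt A a : target :=
  if A == nC then
    if a < 2 then ev_tgt E0 (fopt A a)
    else ev_tgt (genv n l ne (a - 2) 0 dent 0) (stgt_of (nth pick_item vec_items 0))
  else if A == nREV then
    if a < 2 then ev_tgt E0 (fopt A a)
    else ev_tgt (genv n l ne (a - 2) 0 dent 0) (stgt_of (nth pick_item vec_items 1))
  else if A == nI then
    if a < 1 then ev_tgt E0 (fopt A a)
    else ev_tgt (genv n l ne 0 (a - 1) dent 0) (stgt_of (nth pick_item val_items 1))
  else if A == nJ then
    ev_tgt (genv n l ne 0 a dent 0) (stgt_of (nth pick_item val_items 2))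
  else if A == nRUN then
    if a < 1 then ev_tgt E0 (fopt A a)
    else ev_tgt (genv n l ne 0 0 (nth dent ents (a - 1)) (a - 1)) (stgt_of pick_item)
  else ev_tgt E0 (fopt A a).

Lemma gspec_opt A a t : In_list (A, IOpt a t) gspec -> t = dopt A a.
Proof.
case/in_gspec.
- by case=> p /=; repeat (case; first by move=> <- // [-> -> ->]).
- case=> j [p [hj]].
  by repeat (case; first by move=> <- // [-> -> ->]; rewrite /evx /dopt /= ?addKn).
- case=> j [p [hj]].
  by repeat (case; first by move=> <- // [-> -> ->]; rewrite /evx /dopt /= ?addKn).
- case=> i [hi]; case=> [|[j hj]] // [-> -> ->].
  have e : genv n l ne 0 0 (nth dent ents i) i vidx = i.
    by case: (nth dent ents i) => [[[[q0 a0] q1] b] d].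
  by rewrite /evx /= e /dopt /= subSS subn0.
Qed.

Lemma gspec_def A t1 t2 : In_list (A, IDef t1 t2) gspec ->
  (t1, t2) = (ev_tgt E0 (fdef A).1, ev_tgt E0 (fdef A).2).
Proof.
case/in_gspec.
- by case=> p /=; repeat (case; first by move=> <- // [-> -> ->]).
- by case=> j [p [hj]]; repeat (case; first by move=> <- // [-> -> ->]).
- by case=> j [p [hj]]; repeat (case; first by move=> <- // [-> -> ->]).
- by case=> i [hi]; case=> [|[j hj]].
Qed.

Lemma gspec_mem A s : In_list (A, IMemS s) gspec -> s = map (ev_sarg E0) (fmem A).
Proof.
case/in_gspec.
- by case=> p /=; repeat (case; first by move=> <- // [-> ->]).
- by case=> j [p [hj]]; repeat (case; first by move=> <- // [-> ->]).
- by case=> j [p [hj]]; repeat (case; first by move=> <- // [-> ->]).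
- by case=> i [hi]; case=> [|[j hj]].
Qed.

Lemma gspec_good : good_spec gD NN gkind gspec.
Proof.
split.
- exact: gspec_wf.
- exact: gspec_kind.
- by move=> A a t t' /gspec_opt -> /gspec_opt ->.
- by move=> A t1 t2 t1' t2' /gspec_def[-> ->] /gspec_def[-> ->].
- by move=> A s s' /gspec_mem -> /gspec_mem ->.
Qed.

End Gspec.

(** * Soundness of the game *)

Definition nxt e (t : starget) rho := map (ev rho) (ev_tgt e t).2.
Notation g := (nth 0).
Definition uu rho i := nth 0 rho (15 + (i + i)).
Definition vv rho i := nth 0 rho (14 + (i + i)).

Lemma nth_flat2 (f : nat -> nat * nat) m j tl : j < m ->
  nth 0 (flatten [seq [:: (f i).1; (f i).2] | i <- iota 0 m] ++ tl) (j + j) = (f j).1 /\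
  nth 0 (flatten [seq [:: (f i).1; (f i).2] | i <- iota 0 m] ++ tl) (j + j).+1 = (f j).2.
Proof.
suff H b : j < m ->
  nth 0 (flatten [seq [:: (f i).1; (f i).2] | i <- iota b m] ++ tl) (j + j) = (f (b + j)).1 /\
  nth 0 (flatten [seq [:: (f i).1; (f i).2] | i <- iota b m] ++ tl) (j + j).+1 = (f (b + j)).2.
  exact: H.
elim: m b j => //= m IH b [|j] hj; first by rewrite !addn0.
by rewrite addSn addnS /= -addSnnS; exact: IH.
Qed.

Lemma nth_flat2_last (f : nat -> nat * nat) m x :
  nth 0 (flatten [seq [:: (f i).1; (f i).2] | i <- iota 0 m] ++ [:: x]) (m + m) = x.
Proof.
suff H b : nth 0 (flatten [seq [:: (f i).1; (f i).2] | i <- iota b m] ++ [:: x]) (m + m) = x by exact: H.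
elim: m b => //= m IH b; by rewrite addnS /= IH.
Qed.

Lemma nth_cat_add (s s' : seq nat) m k : size s = m -> nth 0 (s ++ s') (m + k) = nth 0 s' k.
Proof. by move=> <-; rewrite nth_cat ltnNge leq_addr /= addKn. Qed.

Section Nxt.
Variables (e : nat -> nat) (t : starget) (rho : seq nat).
Hypothesis hsz : size (s_fix t) = 15.

Lemma nxtE : nxt e t rho = map (ev rho) (map (ev_sarg e) (s_fix t)) ++
  (flatten [seq [:: (ev rho (slot (s_mode t) (e vj) j).1, ev rho (slot (s_mode t) (e vj) j).2).1;
                    (ev rho (slot (s_mode t) (e vj) j).1, ev rho (slot (s_mode t) (e vj) j).2).2]
   | j <- iota 0 (e vn)] ++ [:: ev rho (ev_sarg e (s_last t))]).
Proof.
rewrite /nxt /ev_tgt [(_, _).2]/= !map_cat map_flatten.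
congr (_ ++ (flatten _ ++ _)); rewrite -map_comp; exact: eq_map.
Qed.

Lemma nxt_slot j : j < e vn ->
  uu (nxt e t rho) j = ev rho (slot (s_mode t) (e vj) j).1 /\
  vv (nxt e t rho) j.+1 = ev rho (slot (s_mode t) (e vj) j).2.
Proof.
move=> hj; rewrite /uu /vv nxtE.
have -> : 14 + (j.+1 + j.+1) = 15 + (j + j).+1 by lia.
rewrite !(@nth_cat_add _ _ 15) ?size_map //.
set tl := [:: _]; have [h1 h2] := nth_flat2 (fun j => (ev rho (slot (s_mode t) (e vj) j).1, ev rho (slot (s_mode t) (e vj) j).2)) tl hj.
by split.
Qed.

Lemma nxt_last : uu (nxt e t rho) (e vn) = ev rho (ev_sarg e (s_last t)).
Proof.
rewrite /uu nxtE (@nth_cat_add _ _ 15) ?size_map //.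
exact: (nth_flat2_last (fun j => (ev rho (slot (s_mode t) (e vj) j).1, ev rho (slot (s_mode t) (e vj) j).2))).
Qed.

End Nxt.

(* The counters of the functions [f_i] while [rX] is built, respectively checked. *)
Definition fwd rho i := uu rho i - vv rho i.
Definition bwd rho i := vv rho i - uu rho i.

Section Sem.
Variables (n l N : nat) (ents : seq entry).
Hypothesis hne : size ents <= N.
Hypothesis hn : n <= N.
Hypothesis hl : l < N.
Hypothesis hents : forall i, i < size ents ->
  let '(q0, a0, q1, b, d) := nth dent ents i in [&& q0 < N, a0 < N, q1 < N & b < N].
Let ne := size ents.
Let sp := gspec n l N ents.
Let TT := fgh n n + l.+1.

Lemma keep_uv e A ov rho i : e vn = n -> i <= n ->
  uu (nxt e (keep A ov) rho) i = uu rho i /\ (0 < i -> vv (nxt e (keep A ov) rho) i = vv rho i).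
Proof.
move=> en hi; split.
  case: (ltngtP i n) hi => // [hi|->] _.
    by have [|-> _] := @nxt_slot e (keep A ov) rho erefl i; rewrite ?en //= addn0.
  by rewrite -[in LHS]en nxt_last //= /evx /= en !addn0.
case: i hi => // i hi _.
have [|_ ->] := @nxt_slot e (keep A ov) rho erefl i; rewrite ?en //= addn0 /vv.
by congr nth; lia.
Qed.

Definition conf k := frun ents k (l, Z0, fun _ => 0).
Definition HALT := exists k c, [/\ k <= TT, conf k = Some c & fstep ents c = None].

(** This is all that the finite test establishes; it amounts to [y <= x] once [y <= x + N] is known
    from elsewhere. *)
Definition LTP x y := forall k, k < N -> y <> x + k.+1.
Definition SHP q a ix := forall i, i < ne -> forall k, k < N ->
  (q, a, ix) <> (key (nth dent ents i), i + k.+1).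
(** The claim is about time [TT - T], although the play so far guarantees only [X <= TT]; that
    [X = TT] is part of what a win from here proves. *)
Definition RUNP X T L R S q a := L + R + S = T -> T <= X -> X <= TT -> q < N -> a < N ->
  X = TT /\ exists h tp, conf (TT - T) = Some (q, h, tp) /\ tp (Z.sub h (Z.sub (Z.of_nat L) (Z.of_nat R))) = a.
Definition P5P X T L R S a q0 a0 b := L + R + S = T -> T <= X -> X <= TT -> q0 < N ->
  a0 < N -> a < N -> b < N ->
  X = TT /\ exists h tp, [/\ conf (TT - T) = Some (q0, h, tp), tp h = a0 &
   (L = R /\ a = b) \/ (L <> R /\ tp (Z.sub h (Z.sub (Z.of_nat L) (Z.of_nat R))) = a)].
(** Here [L'] and [R'] are the parts of [L] and [R] already consumed in pairs. When both are 0 and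
    [L + R + S = T], the right side is [X - |L - R|], so together with [X <= TT] it forces
    [L = R]. *)
Definition ZCP X T L R S L' R' := L' <= L -> R' <= R -> T <= X ->
  TT <= S + (X - T) + 2 * minn (L - L') (R - R').
Definition HCP X T q a := T <= X -> X <= TT -> q < N -> a < N ->
  exists h tp, [/\ conf (TT - T) = Some (q, h, tp), tp h = a & lookup_delta ents q a = None].
Definition REVP rho z := (forall i, i <= n -> uu rho i <= vv rho i) ->
  fgh n n <= potf (bwd rho) n.+1 z.
Definition CP rho := (forall i, i <= n -> vv rho i <= uu rho i) ->
  potf (fwd rho) n.+1 (g rho rX) <= fgh n n -> HALT.

(* The [A]-th predicate holds at every position with node [A] that Attacker wins. *)
Definition phis : seq (seq nat -> Prop) := [::
  (fun x => g x 0 <> g x 1);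
  (fun x => LTP (g x 0) (g x 1));
  (fun x => SHP (g x 7) (g x 8) (g x 13));
  (fun x => True);
  CP;
  (fun x => g x 0 <> g x 1 /\ CP x);
  (fun x => g x 3 <= g x 2 -> g x 2 <= TT -> HALT);
  (fun x => g x 0 <> g x 1 /\ (g x 3 <= g x 2 -> g x 2 <= TT -> HALT));
  (fun x => g x 3 <= g x 2 -> g x 2 <= TT -> g x 7 < N -> HALT);
  (fun x => HCP (g x 2) (g x 3) (g x 7) (g x 8));
  (fun x => RUNP (g x 2) (g x 3) (g x 4) (g x 5) (g x 6) (g x 7) (g x 8));
  (fun x => [/\ g x 0 <> g x 1, SHP (g x 9) (g x 10) (g x 13), LTP (g x 7) (g x 11),
      LTP (g x 11) (g x 7) & P5P (g x 2) (g x 3) (g x 4) (g x 5) (g x 6) (g x 8) (g x 9) (g x 10) (g x 12)]);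
  (fun x => [/\ SHP (g x 9) (g x 10) (g x 13), LTP (g x 7) (g x 11),
      LTP (g x 11) (g x 7) & P5P (g x 2) (g x 3) (g x 4) (g x 5) (g x 6) (g x 8) (g x 9) (g x 10) (g x 12)]);
  (fun x => [/\ LTP (g x 7) (g x 11),
      LTP (g x 11) (g x 7) & P5P (g x 2) (g x 3) (g x 4) (g x 5) (g x 6) (g x 8) (g x 9) (g x 10) (g x 12)]);
  (fun x => 
      LTP (g x 11) (g x 7) /\ P5P (g x 2) (g x 3) (g x 4) (g x 5) (g x 6) (g x 8) (g x 9) (g x 10) (g x 12));
  (fun x => P5P (g x 2) (g x 3) (g x 4) (g x 5) (g x 6) (g x 8) (g x 9) (g x 10) (g x 12));
  (fun x => [/\ LTP (g x 8) (g x 12), LTP (g x 12) (g x 8), ZCP (g x 2) (g x 3) (g x 4) (g x 5) (g x 6) 0 0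
     & RUNP (g x 2) (g x 3) 0 0 (g x 3) (g x 9) (g x 10)]);
  (fun x => [/\ LTP (g x 12) (g x 8), ZCP (g x 2) (g x 3) (g x 4) (g x 5) (g x 6) 0 0
     & RUNP (g x 2) (g x 3) 0 0 (g x 3) (g x 9) (g x 10)]);
  (fun x => ZCP (g x 2) (g x 3) (g x 4) (g x 5) (g x 6) 0 0
     /\ RUNP (g x 2) (g x 3) 0 0 (g x 3) (g x 9) (g x 10));
  (fun x => [/\ g x 4 <> g x 5, RUNP (g x 2) (g x 3) (g x 4) (g x 5) (g x 6) (g x 9) (g x 8)
     & RUNP (g x 2) (g x 3) 0 0 (g x 3) (g x 9) (g x 10)]);
  (fun x => RUNP (g x 2) (g x 3) (g x 4) (g x 5) (g x 6) (g x 9) (g x 8)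
     /\ RUNP (g x 2) (g x 3) 0 0 (g x 3) (g x 9) (g x 10));
  (fun x => ZCP (g x 2) (g x 3) (g x 4) (g x 5) (g x 6) (g x 9) (g x 10));
  (fun x => g x 0 <> g x 1 /\ ZCP (g x 2) (g x 3) (g x 4) (g x 5) (g x 6) (g x 9) (g x 10));
  (fun x => [/\ g x 0 <> g x 1, g x 5 <> g x 10
    & ZCP (g x 2) (g x 3) (g x 4) (g x 5) (g x 6 + 2) (g x 9) (g x 10 + 1)]);
  (fun x => [/\ LTP (g x 7) l, LTP l (g x 7), LTP 0 (g x 8) & TT <= g x 3]);
  (fun x => [/\ LTP l (g x 7), LTP 0 (g x 8) & TT <= g x 3]);
  (fun x => LTP 0 (g x 8) /\ TT <= g x 3);
  (fun x => TT <= g x 2 : Prop);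
  (fun x => g x 3 <= g x 2 -> REVP x (g x 2 - g x 3));
  (fun x => g x 0 <> g x 1 /\ (g x 3 <= g x 2 -> REVP x (g x 2 - g x 3)));
  (fun x => g x 0 <> g x 1 /\ (g x 3 <= g x 2 -> g x 5 <= g x 4 ->
     REVP x (g x 6 + minn (g x 4 - g x 5) (g x 2 - g x 3))));
  (fun x => g x 3 <= g x 2 -> g x 5 <= g x 4 ->
     REVP x (g x 6 + minn (g x 4 - g x 5) (g x 2 - g x 3)));
  (fun x => [/\ g x 0 <> g x 1, g x 2 <> g x 3 & g x 3 < g x 2 -> g x 5 <= g x 4 ->
     REVP x (g x 6 + 1 + minn (g x 4 - g x 5) (g x 2 - (g x 3).+1))]);
  (fun x => vv x n <> uu x n /\ LTP (g x 2) (g x 3 + n));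
  (fun x => LTP (g x 2) (g x 3 + n))
 ].

Definition phi A := nth (fun _ => True) phis A.

Lemma ltp_le x y : LTP x y -> y <= x + N -> y <= x.
Proof.
move=> h hy; rewrite leqNgt; apply/negP => hxy.
by apply: (h (y - x.+1)); lia.
Qed.

Lemma revp_keep e A ov rho z : e vn = n ->
  vv (nxt e (keep A ov) rho) 0 = vv rho 0 ->
  REVP (nxt e (keep A ov) rho) z -> REVP rho z.
Proof.
move=> en h0 h hi.
have hv i : i <= n -> vv (nxt e (keep A ov) rho) i = vv rho i.
  by case: i => // i h1; case: (keep_uv A ov rho en h1) => _ ->.
have hu i : i <= n -> uu (nxt e (keep A ov) rho) i = uu rho i.
  by move=> h1; case: (keep_uv A ov rho en h1).
have <- : potf (bwd (nxt e (keep A ov) rho)) n.+1 z = potf (bwd rho) n.+1 z.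
  by apply: potf_eq => i hi2; rewrite /bwd hv // hu.
by apply: h => i hi2; rewrite hv // hu // hi.
Qed.

Lemma cp_keep e A ov rho : e vn = n ->
  vv (nxt e (keep A ov) rho) 0 = vv rho 0 -> g (nxt e (keep A ov) rho) rX = g rho rX ->
  CP (nxt e (keep A ov) rho) -> CP rho.
Proof.
move=> en h0 hX h hi hp.
have hv i : i <= n -> vv (nxt e (keep A ov) rho) i = vv rho i.
  by case: i => // i h1; case: (keep_uv A ov rho en h1) => _ ->.
have hu i : i <= n -> uu (nxt e (keep A ov) rho) i = uu rho i.
  by move=> h1; case: (keep_uv A ov rho en h1).
apply: h; first by move=> i hi2; rewrite hv // hu // hi.
rewrite hX (@potf_eq _ (fwd rho)) // => i hi2.
by rewrite /fwd hv // hu.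
Qed.

Let E0 := genv n l ne 0 0 dent 0.

(** Attacker may leave with applications still pending: [potf] is never below its argument, so
    [rX + l + 1 <= TT] holds in any case. *)
Lemma phi_C0 rho : phi nI (nxt E0 (STgt nI [:: zer; zer; SV (rX, [::]) (1, [:: vl]); zer; zer; zer; zer; zer; zer; zer; zer; zer; zer; zer; zer] VZero zer) rho) ->
  phi nC rho.
Proof.
rewrite /phi /nxt /E0 /= /evx /= => h hi hp; apply: h => //.
have := leq_trans (potf_ge _ _ _) hp; rewrite /TT; lia.
Qed.

Lemma phi_C1 rho : phi nCC (nxt E0 (keep nCC [:: (rE0, reg 15 0); (rE1, reg rv0 0); (rv0, reg rv0 1); (rX, reg rX 1)]) rho) ->
  phi nC rho.
Proof.
set t := keep _ _; rewrite /phi /= => -[h1 h2] hi hp.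
have e0 : vv (nxt E0 t rho) 0 = (vv rho 0).+1 by rewrite /vv /nxt /= /evx /= addn1.
have eX : g (nxt E0 t rho) rX = (g rho rX).+1 by rewrite /nxt /= /evx /= addn1.
have hv i : 0 < i <= n -> vv (nxt E0 t rho) i = vv rho i.
  by case/andP=> h3 h4; case: (@keep_uv E0 nCC [:: (rE0, reg 15 0); (rE1, reg rv0 0); (rv0, reg rv0 1); (rX, reg rX 1)] rho i erefl h4) => _ ->.
have hu i : i <= n -> uu (nxt E0 t rho) i = uu rho i.
  by move=> h4; case: (@keep_uv E0 nCC [:: (rE0, reg 15 0); (rE1, reg rv0 0); (rv0, reg rv0 1); (rX, reg rX 1)] rho i erefl h4).
have h0 : vv rho 0 < uu rho 0.
  by rewrite ltn_neqAle hi // andbT; apply/eqP => e; apply: h1; move: e; rewrite /uu /vv /nxt /= /evx /= !addn0.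
apply: h2.
  by move=> [|i] hin; rewrite hu // ?e0 // hv // hi.
apply: leq_trans hp; rewrite eX -(add1n n); apply: potf_le; last first.
  by move=> i hin; rewrite /fwd hu ?hv; lia.
rewrite /= /fwd e0 hu // subnS -iterSr prednK //; lia.
Qed.

Lemma phi_Cj rho j : j < n ->
  phi nCC (nxt (genv n l ne j 0 dent 0) (STgt nCC (fx [:: (rE0, SV (17, [:: vj; vj]) (0, [::])); (rE1, SV (16, [:: vj; vj]) (0, [::]));
                         (rv0, zer)]) VFwd ulast) rho) ->
  phi nC rho.
Proof.
move=> hj; set t := STgt _ _ _ _; set e := genv _ _ _ _ _ _ _; rewrite /phi /= => -[h1 h2] hi hp.
have hsl i (h : i < n) := @nxt_slot e t rho erefl i h.
have hla := @nxt_last e t rho erefl; rewrite [e vn]/= [LHS]/= in hla.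
have eX : g (nxt e t rho) rX = g rho rX by rewrite /nxt /= /evx /= addn0.
(* The test yields only that the registers differ; the invariant [v <= u] makes the counter
   positive. *)
have hlt : vv rho j.+1 < uu rho j.+1.
  rewrite ltn_neqAle hi // andbT; apply/eqP => e1; apply: h1; move: e1; rewrite /uu /vv /nxt /= /evx /= !addn0.
  by rewrite addSn addnS => ->.
have hu i : i <= n -> uu (nxt e t rho) i = if i < j then 0 else if i == j then (g rho rX).+1 else uu rho i.
  rewrite leq_eqVlt => /orP[/eqP ->|h].
    rewrite -[in LHS](erefl : e vn = n) nxt_last // /evx /= /evx /= !addn0 ltnNge (ltnW hj) /= gtn_eqF //.
  have [-> _] := hsl i h; rewrite /= /evx /=; case: (ltngtP i j) => //= _; rewrite ?addn0 ?addn1 //.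
have hv i : i <= n -> vv (nxt e t rho) i = if i <= j then 0 else if i == j.+1 then (vv rho i).+1 else vv rho i.
  case: i => [|i] h; first by rewrite /vv /nxt /= /evx.
  have [_ ->] := hsl i h; rewrite /= /evx /= /vv (_ : 14 + (i.+1 + i.+1) = 16 + (i + i)); last lia.
  by rewrite eqSS; case: (ltngtP i j) => //= _; rewrite ?addn0 ?addn1.
apply: h2.
  by move=> i hin; rewrite hu // hv //; have := hi _ hin; case: (ltngtP i j) => // h3; case: eqP => // ->.
apply: leq_trans hp; rewrite eX; apply: (@potf_fwd _ _ j) => //.
- rewrite /fwd hu // hv // ltnn eqxx gtn_eqF // (_ : j.+1 < j = false); lia.
- by rewrite /fwd hu ?hv ?leqnn ?ltnn ?eqxx ?subn0 //; exact: ltnW.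
- by move=> i hij; rewrite /fwd hu ?hij //; lia.
- move=> i /andP[h3 h4]; rewrite /fwd hu // hv //.
  have [-> -> -> ->] // : [/\ i < j = false, (i == j) = false, i <= j = false & (i == j.+1) = false].
  by split; lia.
Qed.

(** One recorded application of [fgh n] and a remaining number of at least [n] already put the
    potential at [fgh n n] or more. *)
Lemma phi_REV0 rho : phi nFIN (nxt E0 (keep nFIN [::]) rho) -> phi nREV rho.
Proof.
set t := keep _ _; rewrite /phi /= => -[h1 h2] hTX hi.
have hu := (@keep_uv E0 nFIN [::] rho n erefl (leqnn n)).1.
have hv : vv (nxt E0 t rho) n = vv rho n.
  have [_] := @keep_uv E0 nFIN [::] rho n erefl (leqnn n).
  case: (posnP n) => [e|hn0 ->] //; rewrite /vv (_ : 14 + (n + n) = 14); last lia.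
  by rewrite /nxt /= addn0.
have hb : 0 < bwd rho n.
  by rewrite /bwd subn_gt0 ltn_neqAle hi // andbT; apply/eqP => e; apply: h1; rewrite hv hu e.
have hz : n <= g rho 2 - g rho 3.
  have := ltp_le h2; rewrite /nxt /E0 /= /evx /= !addn0; lia.
rewrite /=; apply: (@leq_trans (iter 1 (fgh n) n)) => //.
apply: iter_mono => //; [exact: fgh_ge|exact: fgh_mono|].
exact: leq_trans hz (potf_ge _ _ _).
Qed.

Lemma phi_REV1 rho : phi nRC (nxt E0 (keep nRC [:: (rE0, reg rX 0); (rE1, reg rT 0); (rT, reg rT 1); (rv0, reg rv0 1)]) rho) ->
  phi nREV rho.
Proof.
set ov := [:: _; _; _; _]; set t := keep _ _; rewrite /phi /= => -[h1 h2] hTX hi.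
have e0 : vv (nxt E0 t rho) 0 = (vv rho 0).+1 by rewrite /vv /nxt /= addn1.
have hv i : 0 < i <= n -> vv (nxt E0 t rho) i = vv rho i.
  by case/andP=> h3 h4; case: (@keep_uv E0 nRC ov rho i erefl h4) => _ ->.
have hu i : i <= n -> uu (nxt E0 t rho) i = uu rho i.
  by move=> h4; case: (@keep_uv E0 nRC ov rho i erefl h4).
have hlt : g rho 3 < g rho 2.
  rewrite ltn_neqAle hTX andbT; apply/eqP => e; apply: h1; rewrite /nxt /t /ov /=; lia.
have h3 : fgh n n <= potf (bwd (nxt E0 t rho)) n.+1 (g rho 2 - (g rho 3).+1).
  have -> : g rho 2 - (g rho 3).+1 = g (nxt E0 t rho) 2 - g (nxt E0 t rho) 3.
    by rewrite /nxt /t /ov /= addn0 addn1.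
  apply: h2; first by rewrite /nxt /t /ov /=; lia.
  move=> [|i] hin; rewrite hu // ?e0 ?hv //; first exact: leqW (hi _ _).
  exact: hi.
apply: leq_trans h3 _; rewrite -(add1n n); apply: potf_le; last first.
  by move=> i hin; rewrite /bwd hu ?hv //; lia.
rewrite /= /bwd e0 hu // subSn ?hi // iterSr.
by apply: iter_mono => //; lia.
Qed.

(** The loop at [nLC] copies units into [rS], the new number, and each unit costs one increment of
    [rR] and one of [rT]. As [rR] starts at [u_j + 1], at most the minimum of the counter less one
    and the old number is copied, as [potf_rev] requires. *)
Lemma phi_REVj rho j : j < n ->
  phi nLC (nxt (genv n l ne j 0 dent 0) (STgt nLC (fx [:: (rE0, SV (14, [:: vj; vj]) (0, [::])); (rE1, SV (15, [:: vj; vj]) (0, [::]));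
                         (rL, SV (14, [:: vj; vj]) (0, [::])); (rR, SV (15, [:: vj; vj]) (1, [::]));
                         (rS, zer); (rv0, zer)]) VRev ulast) rho) ->
  phi nREV rho.
Proof.
move=> hj; set t := STgt _ _ _ _; set e := genv _ _ _ _ _ _ _; rewrite /phi /= => -[h1 h2] hTX hi.
have hsl i (h : i < n) := @nxt_slot e t rho erefl i h.
have hlt : uu rho j < vv rho j.
  rewrite ltn_neqAle hi ?(ltnW hj) // andbT; apply/eqP => e1; apply: h1; move: e1.
  by rewrite /uu /vv /nxt /= /evx /= !addn0 => ->.
have hu i : i <= n -> uu (nxt e t rho) i = if i <= j then 0 else uu rho i.
  rewrite leq_eqVlt => /orP[/eqP ->|h].
    by rewrite -[in LHS](erefl : e vn = n) nxt_last // /evx /= /evx /= !addn0 leqNgt hj.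
  by have [-> _] := hsl i h; rewrite /= /evx /=; case: (ltngtP i j) => //= _; rewrite ?addn0 ?addn1.
have hv i : i <= n -> vv (nxt e t rho) i = if i <= j then 0 else if i == j.+1 then (vv rho i).+1 else vv rho i.
  case: i => [|i] h; first by rewrite /vv /nxt /= /evx.
  have [_ ->] := hsl i h; rewrite /= /evx /= /vv (_ : 14 + (i.+1 + i.+1) = 16 + (i + i)); last lia.
  by rewrite eqSS; case: (ltngtP i j) => //= _; rewrite ?addn0 ?addn1.
have h3 : fgh n n <= potf (bwd (nxt e t rho)) n.+1 (minn (bwd rho j).-1 (g rho 2 - g rho 3)).
  have -> : minn (bwd rho j).-1 (g rho 2 - g rho 3) = g (nxt e t rho) 6 +
     minn (g (nxt e t rho) 4 - g (nxt e t rho) 5) (g (nxt e t rho) 2 - g (nxt e t rho) 3).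
    by rewrite /nxt /t /e /= /evx /= !addn0 add0n addn1 subnS.
  apply: h2.
  - by rewrite /nxt /t /e /= !addn0.
  - by move: hlt; rewrite /nxt /t /e /= /evx /= /uu /vv !addn0; lia.
  - move=> i hin; rewrite hu // hv //; case: ifP => // _; case: ifP => // _; last exact: hi.
    by apply: leqW; exact: hi.
apply: leq_trans h3 _; apply: (@potf_rev _ _ j) => //.
- rewrite /bwd hu // hv // ltnn eqxx; have := hi j.+1 hj; lia.
- by move: hlt; rewrite /bwd; lia.
- exact: geq_minr.
- by move=> i hij; rewrite /bwd hu ?hij ?sub0n ?hv ?hij //; lia.
- move=> i /andP[h4 h5]; rewrite /bwd hu // hv //.
  by have [-> ->] // : i <= j = false /\ (i == j.+1) = false by split; lia.
Qed.

Lemma revp_le e A ov rho z z' : e vn = n ->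
  vv (nxt e (keep A ov) rho) 0 = vv rho 0 -> z <= z' ->
  REVP (nxt e (keep A ov) rho) z -> REVP rho z'.
Proof.
move=> en h0 hz h hi; apply: leq_trans (revp_keep en h0 h hi) _.
exact: potf_mono.
Qed.

Lemma phi_LO0 rho : phi nLC2 (nxt E0 (keep nLC2 [:: (rE0, reg rL 0); (rE1, reg rR 0); (rR, reg rR 1)]) rho) ->
  phi nLO rho.
Proof.
rewrite /phi /= => -[h1 h2 h3] hTX hRL.
apply: revp_le (h3 _ _) => //; rewrite ?[LHS]addn0 //;
  rewrite /nxt /= in h1 h2 *; rewrite ?addn0 in h1 h2 *; lia.
Qed.

Lemma phi_LO1 rho : phi nREV (nxt E0 (keep nREV [:: (rX, reg rS 0); (rT, zer)]) rho) -> phi nLO rho.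
Proof.
rewrite /phi /= => h1 hTX hRL.
apply: revp_le (h1 _) => //; rewrite ?[LHS]addn0 //; rewrite /nxt /=; lia.
Qed.

Lemma phi_ZC0 rho : phi nZC1 (nxt E0 (keep nZC1 [:: (rE0, reg rX 0); (rE1, reg rT 0); (rT, reg rT 1); (rS, reg rS 1)]) rho) ->
  phi nZC rho.
Proof. rewrite /phi /nxt /= !addn0 => -[h1 h2] hL hR hTX; have := h2 hL hR; lia. Qed.

Lemma phi_ZC1 rho : phi nZC2 (nxt E0 (keep nZC2 [:: (rE0, reg rL 0); (rE1, reg rq0 0); (rq0, reg rq0 1)]) rho) ->
  phi nZC rho.
Proof. rewrite /phi /nxt /= !addn0 => -[h1 h2 h3] hL hR hTX; move: h3; rewrite /ZCP; lia. Qed.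

Lemma phi_ZC2 rho : phi nGD (nxt E0 (keep nGD [:: (rX, reg rS 0)]) rho) -> phi nZC rho.
Proof. rewrite /phi /nxt /= !addn0 => h1 hL hR hTX; lia. Qed.

(** The lower bound [TT <= rT] meets [rT <= rX <= TT], so the claim is about time 0. There every
    cell is blank, and the position of the observed one does not have to be known. *)
Lemma phi_RUN0 rho : phi nEND (nxt E0 (keep nEND [::]) rho) -> phi nRUN rho.
Proof.
rewrite /phi /nxt /= !addn0 => -[h1 h2 h3 h4] hT hTX hX hq ha.
have eX : g rho 2 = TT by lia.
have eT : g rho 3 = TT by lia.
split=> //; exists Z0, (fun _ => 0); rewrite eT subnn /conf /=.
have h5 := ltp_le h1; have h6 := ltp_le h2; have h7 := ltp_le h3.
split; last by lia.
by congr (Some (_, _, _)); lia.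
Qed.

Lemma phi_P50 rho : phi nG1 (nxt E0 (keep nG1 [::]) rho) -> phi nP5 rho.
Proof.
rewrite /phi /nxt /= !addn0 => -[h1 h2 h3 h4] hT hTX hX hq0 ha0 ha hb.
have [eX [h [tp [h5 h6]]]] := h4 erefl hTX hX hq0 ha0.
split=> //; exists h, tp; split=> //.
  by rewrite -h6; congr tp; lia.
left; have h7 := ltp_le h1; have h8 := ltp_le h2; have := h3 isT isT hTX; lia.
Qed.

(** The claims about the head cell and about the observed cell concern the same time, and [conf] is
    a function, so they speak of one configuration. *)
Lemma phi_P51 rho : phi nG2 (nxt E0 (keep nG2 [::]) rho) -> phi nP5 rho.
Proof.
rewrite /phi /nxt /= !addn0 => -[h1 h2 h3] hT hTX hX hq0 ha0 ha hb.
have [eX [h [tp [h5 h6]]]] := h2 hT hTX hX hq0 ha.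
have [_ [h' [tp' [h7 h8]]]] := h3 erefl hTX hX hq0 ha0.
move: h7 h8; rewrite h5 => -[<- <-] h8.
split=> //; exists h, tp; split=> //; last by right.
by rewrite -h8; congr tp; lia.
Qed.

(** A win at [nP1] describes the configuration one step earlier, and [fstep] carries it forward. The
    chosen entry is the one [lookup_delta] finds, since no earlier entry has its key. *)
Lemma phi_pick rho i : i < ne ->
  phi nP1 (nxt (genv n l ne 0 0 (nth dent ents i) i) (stgt_of pick_item) rho) -> phi nRUN rho.
Proof.
move=> hi; have := hents hi.
case ei : (nth dent ents i) => [[[[q0 a0] q1] b] d] /and4P[b1 b2 b3 b4].
rewrite /phi /nxt /= /evx /= !addn0 => -[h1 h2 h3 h4 h5] hT hTX hX hq ha.
have hlt : g rho 3 < g rho 2 by lia.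
have {h5} h5 := h5 _ _ hX b1 b2 ha b4.
case: h5 => [||eX [h [tp [h5 h6 h7]]]]; [by case: d {ei} => /=; lia|by lia|].
split=> //.
have hlk : lookup_delta ents q0 a0 = Some (q1, b, d).
  have := @lookup_first ents i hi; rewrite ei; apply=> j hj e.
  apply: (h2 j _ (i - j.+1) _); first by apply: ltn_trans hi.
    by move: hi hne; rewrite /ne; lia.
  by rewrite e /=; congr (_, _, _); lia.
have eq1 : g rho 7 = q1 by have h8 := ltp_le h3; have h9 := ltp_le h4; lia.
have eTT : TT - g rho 3 = (TT - (g rho 3 + 1)).+1 by lia.
exists (Z.add h (mvz d)), (zupd tp h b); rewrite eTT /conf frunS -/(conf _) h5 /= h6 hlk eq1.
split=> //.
(* The new [rL - rR] already accounts for the head move, so the observed cell is the one just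
   written iff the new [rL] and [rR] agree. *)
rewrite /zupd; case: Z.eqb_spec => hz.
  by case: h7 => [[_ ->]|[hne2 _]] //; case: hne2; move: hz; case: d {hlk h5 ei} => /=; lia.
case: h7 => [[h7 _]|[_ h7]]; first by case: hz; move: h7; case: d {hlk h5 ei} => /=; lia.
by rewrite -h7; congr tp; case: d {hlk h5 ei h7} hz => /=; lia.
Qed.

Lemma phi_I0 rho : phi nIC (nxt E0 (keep nIC [:: (rE0, reg rX 0); (rE1, reg rT 0); (rT, reg rT 1)]) rho) ->
  phi nI rho.
Proof. rewrite /phi /nxt /= !addn0 => -[h1 h2] hTX hX; apply: h2 => //; lia. Qed.

Lemma phi_IJ rho v : v < N ->
  phi nJ (nxt (genv n l ne 0 v dent 0) (keep nJ [:: (rq, SC (0, [:: vk]))]) rho) -> phi nI rho.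
Proof. by rewrite /phi /nxt /= !addn0 => hv h1 hTX hX; apply: h1. Qed.

Lemma phi_J rho v : v < N ->
  phi nHC (nxt (genv n l ne 0 v dent 0) (keep nHC [:: (ra, SC (0, [:: vk]))]) rho) -> phi nJ rho.
Proof.
rewrite /phi /nxt /= !addn0 => hv h1 hTX hX hq.
have [h [tp [h2 h3 h4]]] := h1 hTX hX hq hv.
exists (TT - g rho 3); eexists; split; [exact: leq_subr|exact: h2|].
by rewrite /= h3 h4.
Qed.

Lemma phi_HC rho :
  phi nSH (nxt E0 (keep nSH [:: (rix, SC (0, [:: vne]))]) rho) ->
  phi nRUN (nxt E0 (keep nRUN [:: (rL, zer); (rR, zer); (rS, reg rT 0)]) rho) -> phi nHC rho.
Proof.
rewrite /phi /nxt /= !addn0 => h1 h2 hTX hX hq ha.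
have [eX [h [tp [h3 h4]]]] := h2 erefl hTX hX hq ha.
exists h, tp; split=> //; first by rewrite -h4; congr tp; lia.
apply/lookup_none => j hj e; apply: (h1 j hj (ne - j.+1)).
  by rewrite /ne in hj *; lia.
rewrite e /=; congr (_, _, _).
change (0 + size ents = j + (size ents - j.+1).+1).
by rewrite add0n -subSn // subSS subnKC // ltnW.
Qed.

Lemma phi_CC rho : phi nEQ (nxt E0 (keep nEQ [::]) rho) -> phi nC (nxt E0 (keep nC [::]) rho) ->
  phi nCC rho.
Proof.
move=> h1 h2; split; first by move: h1; rewrite /phi /nxt /= !addn0.
by apply: cp_keep h2; rewrite // ?[LHS]addn0.
Qed.

(** The reverse phase starts with all counters 0, where the potential is just the number
    [rX - (l + 1)]. *)
Lemma phi_GD rho : phi nLT (nxt E0 (keep nLT [:: (rE0, reg rX 0); (rE1, SC (1, [:: vl]))]) rho) ->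
  phi nREV (nxt E0 (STgt nREV (fx [:: (rT, SC (1, [:: vl])); (rv0, zer)]) VZero zer) rho) -> phi nGD rho.
Proof.
set t := STgt _ _ _ _; rewrite /phi /=.
move=> h1 h2; rewrite /nxt /= ?addn0 in h1; have h3 := ltp_le h1.
have hl2 : 1 + l <= g rho 2 by apply: h3; change (1 + l <= g rho 2 + N); lia.
have hz i : i <= n -> uu (nxt E0 t rho) i = 0 /\ vv (nxt E0 t rho) i = 0.
  move=> hi; split.
    move: hi; rewrite leq_eqVlt => /orP[/eqP ->|h]; first exact: (@nxt_last E0 t rho erefl).
    by have [-> _] := @nxt_slot E0 t rho erefl i h.
  case: i hi => // i h; by have [_ ->] := @nxt_slot E0 t rho erefl i h.
have h4 : fgh n n <= potf (bwd (nxt E0 t rho)) n.+1 (g rho 2 - l.+1).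
  have -> : g rho 2 - l.+1 = g (nxt E0 t rho) 2 - g (nxt E0 t rho) 3 by rewrite /nxt /= addn0.
  apply: h2; first by rewrite /nxt /= addn0.
  by move=> i hi; have [-> ->] := hz i hi.
rewrite potf_zero in h4; first by rewrite /TT; lia.
by move=> i hi; have [e1 e2] := hz i hi; rewrite /bwd e1 e2.
Qed.

Lemma phi_FIN rho :
  phi nEQ (nxt E0 (keep nEQ [:: (rE0, SV (14, [:: vn; vn]) (0, [::])); (rE1, SV (15, [:: vn; vn]) (0, [::]))]) rho) ->
  phi nFIN2 (nxt E0 (keep nFIN2 [::]) rho) -> phi nFIN rho.
Proof. by rewrite /phi /nxt /= !addn0. Qed.

Lemma phi_keepREV A rho B : phi B (nxt E0 (keep B [::]) rho) ->
  g rho 0 <> g rho 1 ->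
  [\/ A = nRC /\ B = nREV | A = nLC /\ B = nLO] -> phi A rho.
Proof.
rewrite /phi => h h0 [] [eA eB]; rewrite eA eB in h *; split=> //.
  by move=> hTX; apply: revp_le (h _) => //; rewrite ?[LHS]addn0 //; rewrite /nxt /=; lia.
by move=> hTX hRL; apply: revp_le (h _ _) => //; rewrite ?[LHS]addn0 //; rewrite /nxt /=; lia.
Qed.

(** Induction on the win; the chains of [case] go through the items in list order, each using the
    preservation lemma for its item. *)
Lemma awin_phi A rho : awin sp A rho -> phi A rho.
Proof.
move=> hw; elim: hw => {A rho}.
- move=> A rho a t + _; case/in_gspec.
  + move=> [p hp ep] IH; move: ep; move: hp => /=.
    do 5?[case; first by move=> <-].
    case; [move=> <- [eA _ eT]; rewrite eA; rewrite eT in IH; exact: phi_C0 IH|].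
    case; [move=> <- [eA _ eT]; rewrite eA; rewrite eT in IH; exact: phi_C1 IH|].
    case; first by move=> <-.
    case; [move=> <- [eA _ eT]; rewrite eA; rewrite eT in IH; exact: phi_I0 IH|].
    do 2?[case; first by move=> <-].
    case; [move=> <- [eA _ eT]; rewrite eA; rewrite eT in IH; exact: phi_RUN0 IH|].
    do 4?[case; first by move=> <-].
    case; [move=> <- [eA _ eT]; rewrite eA; rewrite eT in IH; exact: phi_P50 IH|].
    case; [move=> <- [eA _ eT]; rewrite eA; rewrite eT in IH; exact: phi_P51 IH|].
    do 5?[case; first by move=> <-].
    case; [move=> <- [eA _ eT]; rewrite eA; rewrite eT in IH; exact: phi_ZC0 IH|].
    case; [move=> <- [eA _ eT]; rewrite eA; rewrite eT in IH; exact: phi_ZC1 IH|].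
    case; [move=> <- [eA _ eT]; rewrite eA; rewrite eT in IH; exact: phi_ZC2 IH|].
    do 6?[case; first by move=> <-].
    case; [move=> <- [eA _ eT]; rewrite eA; rewrite eT in IH; exact: phi_REV0 IH|].
    case; [move=> <- [eA _ eT]; rewrite eA; rewrite eT in IH; exact: phi_REV1 IH|].
    do 2?[case; first by move=> <-].
    case; [move=> <- [eA _ eT]; rewrite eA; rewrite eT in IH; exact: phi_LO0 IH|].
    case; [move=> <- [eA _ eT]; rewrite eA; rewrite eT in IH; exact: phi_LO1 IH|].
    by do 3?[case; first by move=> <-].
  + move=> [j [p [hj hp ep]]] IH; move: ep; move: hp => /=.
    case; [move=> <- [eA _ eT]; rewrite eA; rewrite eT in IH; exact: phi_Cj IH|].
    case=> // <- [eA _ eT]; rewrite eA; rewrite eT in IH; exact: phi_REVj IH.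
  + move=> [v [p [hv hp ep]]] IH; move: ep; move: hp => /=.
    case; first by move=> <-.
    case; [move=> <- [eA _ eT]; rewrite eA; rewrite eT in IH; exact: phi_IJ IH|].
    case=> // <- [eA _ eT]; rewrite eA; rewrite eT in IH; exact: phi_J IH.
  + move=> [i [hi hp]] IH; move: hp; case=> [|[]//] [eA _ eT].
    rewrite eA; rewrite eT in IH; exact: phi_pick IH.
- move=> A rho t1 t2 + _ + _; case/in_gspec; first last.
  + by move=> [i [hi [|[]]]].
  + by move=> [v [p [hv /=]]]; do 3?[case; first by move=> <-].
  + by move=> [v [p [hv /=]]]; do 2?[case; first by move=> <-].
  move=> [p hp ep] IH1 IH2; move: ep; move: hp => /=.
  do 7?[case; first by move=> <-].
  case; [move=> <- [eA e1 e2]; rewrite eA; rewrite e1 in IH1; rewrite e2 in IH2; exact: phi_CC IH1 IH2|].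
  case; first by move=> <-.
  case; first by move=> <- [eA e1 e2]; rewrite eA; rewrite e1 in IH1; rewrite e2 in IH2; move: IH1 IH2; rewrite /phi /nxt /= ?addn0.
  case; [move=> <- [eA e1 e2]; rewrite eA; rewrite e1 in IH1; rewrite e2 in IH2; exact: phi_HC IH1 IH2|].
  case; first by move=> <-.
  case; first by move=> <- [eA e1 e2]; rewrite eA; rewrite e1 in IH1; rewrite e2 in IH2; move: IH1 IH2; rewrite /phi /nxt /= ?addn0 => h1 [].
  case; first by move=> <- [eA e1 e2]; rewrite eA; rewrite e1 in IH1; rewrite e2 in IH2; move: IH1 IH2; rewrite /phi /nxt /= ?addn0 => h1 [].
  case; first by move=> <- [eA e1 e2]; rewrite eA; rewrite e1 in IH1; rewrite e2 in IH2; move: IH1 IH2; rewrite /phi /nxt /= ?addn0 => h1 [].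
  case; first by move=> <- [eA e1 e2]; rewrite eA; rewrite e1 in IH1; rewrite e2 in IH2; move: IH1 IH2; rewrite /phi /nxt /= ?addn0.
  do 2?[case; first by move=> <-].
  case; first by move=> <- [eA e1 e2]; rewrite eA; rewrite e1 in IH1; rewrite e2 in IH2; move: IH1 IH2; rewrite /phi /nxt /= ?addn0 => h1 [].
  case; first by move=> <- [eA e1 e2]; rewrite eA; rewrite e1 in IH1; rewrite e2 in IH2; move: IH1 IH2; rewrite /phi /nxt /= ?addn0 => h1 [].
  case; first by move=> <- [eA e1 e2]; rewrite eA; rewrite e1 in IH1; rewrite e2 in IH2; move: IH1 IH2; rewrite /phi /nxt /= ?addn0.
  case; first by move=> <- [eA e1 e2]; rewrite eA; rewrite e1 in IH1; rewrite e2 in IH2; move: IH1 IH2; rewrite /phi /nxt /= ?addn0 => h1 [].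
  case; first by move=> <- [eA e1 e2]; rewrite eA; rewrite e1 in IH1; rewrite e2 in IH2; move: IH1 IH2; rewrite /phi /nxt /= ?addn0.
  do 3?[case; first by move=> <-].
  case; first by move=> <- [eA e1 e2]; rewrite eA; rewrite e1 in IH1; rewrite e2 in IH2; move: IH1 IH2; rewrite /phi /nxt /= ?addn0.
  case; first by move=> <- [eA e1 e2]; rewrite eA; rewrite e1 in IH1; rewrite e2 in IH2; move: IH1 IH2; rewrite /phi /nxt /= ?addn0 => h1 [h2 h3]; rewrite addn1 in h3 *.
  case; first by move=> <- [eA e1 e2]; rewrite eA; rewrite e1 in IH1; rewrite e2 in IH2; move: IH1 IH2; rewrite /phi /nxt /= ?addn0 => h1 [].
  case; first by move=> <- [eA e1 e2]; rewrite eA; rewrite e1 in IH1; rewrite e2 in IH2; move: IH1 IH2; rewrite /phi /nxt /= ?addn0 => h1 [].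
  case; first by move=> <- [eA e1 e2]; rewrite eA; rewrite e1 in IH1; rewrite e2 in IH2; move: IH1 IH2; rewrite /phi /nxt /= ?addn0.
  case; [move=> <- [eA e1 e2]; rewrite eA; rewrite e1 in IH1; rewrite e2 in IH2; exact: phi_GD IH1 IH2|].
  do 2?[case; first by move=> <-].
  case; [move=> <- [eA e1 e2]; rewrite eA; rewrite e1 in IH1; rewrite e2 in IH2|].
    apply: phi_keepREV IH2 _ _; last by left.
    by move: IH1; rewrite /phi /nxt /= !addn0.
  case; [move=> <- [eA e1 e2]; rewrite eA; rewrite e1 in IH1; rewrite e2 in IH2|].
    apply: phi_keepREV IH2 _ _; last by right.
    by move: IH1; rewrite /phi /nxt /= !addn0.
  do 2?[case; first by move=> <-].
  case; [move=> <- [eA e1 e2]; rewrite eA; rewrite e1 in IH1; rewrite e2 in IH2|].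
    move: IH1 IH2; rewrite /phi => IH1 [h2 h3]; split.
    * by move: IH1; rewrite /nxt /= !addn0.
    * by move: h2; rewrite /nxt /= !addn0.
    * by move=> h4 h5; apply: revp_le (h3 _ _) => //; rewrite ?[LHS]addn0 //; rewrite /nxt /=; lia.
  case; [move=> <- [eA e1 e2]; rewrite eA; rewrite e1 in IH1; rewrite e2 in IH2; exact: phi_FIN IH1 IH2|].
  by case=> //; move=> <- [eA e1 e2]; rewrite eA; rewrite e1 in IH1; rewrite e2 in IH2; move: IH1 IH2; rewrite /phi /nxt /= ?addn0.
- move=> A rho s + hm; case/in_gspec; first last.
  + by move=> [i [hi [|[]]]].
  + by move=> [v [p [hv /=]]]; do 3?[case; first by move=> <-].
  + by move=> [v [p [hv /=]]]; do 2?[case; first by move=> <-].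
  move=> [p hp ep]; move: ep; move: hp => /=.
  case.
    move=> <- [eA es]; rewrite eA es in hm *; rewrite /phi /= => e.
    apply: (hm (map (ev_sarg E0) [:: reg rE1 0; zer; zer])); last by rewrite /= !addn0 e.
    by apply/in_gspec; constructor 1; exists (nEQ, SMemT [:: reg rE1 0; zer; zer]) => //=; tauto.
  case; first by move=> <-.
  case.
    move=> <- [eA es]; rewrite eA es in hm *; rewrite /phi /= => k hk e.
    pose e' := genv n l ne 0 k dent 0.
    apply: (hm (map (ev_sarg e') [:: SV (rE0, [::]) (1, [:: vk]); zer; zer])); last by rewrite /= !addn0 e.
    apply/in_gspec; constructor 3; exists k, (nLT, SMemT [:: SV (rE0, [::]) (1, [:: vk]); zer; zer]).
    by split=> //=; tauto.
  case.
    move=> <- [eA es]; rewrite eA es in hm *; rewrite /phi /= => i hi k hk e.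
    pose e' := genv n l ne 0 k (nth dent ents i) i.
    apply: (hm (map (ev_sarg e') [:: SC (0, [:: vq0]); SC (0, [:: va0]); SC (1, [:: vidx; vk])])).
      by apply/in_gspec; constructor 4; exists i; split=> //; right; exists k.
    rewrite /e' /genv; case en: (nth dent ents i) e => [[[[q0 a0] q1] b] d] /=.
    by rewrite /key /= !addn0 => -[-> -> ->]; rewrite addnS.
  by repeat (case; first by move=> <-).
- move=> A rho; case/in_gspec.
  + by case=> p /=; repeat (case; first by move=> <- // [->]).
  + by case=> j [p [hj]]; repeat (case; first by move=> <- // [->]).
  + by case=> j [p [hj]]; repeat (case; first by move=> <- // [->]).
  + by case=> i [hi]; case=> [|[j hj]].
Qed.

End Sem.

(** * Completeness of the game *)

Section Sem2.
Variables (n l N : nat) (ents : seq entry).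
Hypothesis hne : size ents <= N.
Hypothesis hn : n <= N.
Hypothesis hl : l < N.
Hypothesis hents : forall i, i < size ents ->
  let '(q0, a0, q1, b, d) := nth dent ents i in [&& q0 < N, a0 < N, q1 < N & b < N].
Notation ne := (size ents).
Notation sp := (gspec n l N ents).
Notation TT := (fgh n n + l.+1).
Notation E0 := (genv n l ne 0 0 dent 0).
Notation cnf := (conf l ents).

Lemma In_nth (T : Type) (d : T) s i : i < size s -> In_list (nth d s i) s.
Proof. by elim: s i => //= x s IH [|i] hi; [left|right; exact: IH]. Qed.

(** Lets Attacker's strategy refer to a rule by its position in [fixed_items]; the numerals in the
    strategies below are these positions. *)
Lemma use_fixed rho i : i < size fixed_items ->
  match nth pick_item fixed_items i with
  | (A, SOpt a t) => awin sp (s_node t) (nxt E0 t rho) -> awin sp A rho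
  | (A, SDef t1 t2) => awin sp (s_node t1) (nxt E0 t1 rho) ->
       awin sp (s_node t2) (nxt E0 t2 rho) -> awin sp A rho
  | _ => True
  end.
Proof.
move=> hi; have := In_nth pick_item hi; case: (nth _ _ _) => A [a t|t1 t2|s|s|] // h.
  move=> hw; apply: (@awin_opt sp A rho (evx E0 a) (ev_tgt E0 t)) hw.
  by apply/in_gspec; constructor 1; exists (A, SOpt a t).
move=> h1 h2; apply: (@awin_def sp A rho (ev_tgt E0 t1) (ev_tgt E0 t2)) h1 h2.
by apply/in_gspec; constructor 1; exists (A, SDef t1 t2).
Qed.

Lemma w_EQ rho : g rho 0 <> g rho 1 -> awin sp nEQ rho.
Proof.
move=> h; apply: (@awin_mem sp nEQ rho (map (ev_sarg E0) [:: reg rE0 0; zer; zer])).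
  by apply/in_gspec; constructor 1; exists (nEQ, SMemS [:: reg rE0 0; zer; zer]) => //; left.
move=> t /in_gspec[[p /= hp ep]|[j [p [_ /= hp ep]]]|[j [p [_ /= hp ep]]]|[i [_ [//|[j _ [//]]]]]].
- move: ep; move: hp; case; first by move=> <-.
  case; first by move=> <- [->] /= [e]; rewrite !addn0 in e.
  by repeat (case; first by move=> <-).
- by move: ep; move: hp; repeat (case; first by move=> <-).
- by move: ep; move: hp; repeat (case; first by move=> <-).
Qed.

Lemma w_LT rho : g rho 1 <= g rho 0 -> awin sp nLT rho.
Proof.
move=> h; apply: (@awin_mem sp nLT rho (map (ev_sarg E0) [:: reg rE1 0; zer; zer])).
  by apply/in_gspec; constructor 1; exists (nLT, SMemS [:: reg rE1 0; zer; zer]) => //=; tauto.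
move=> t /in_gspec[[p /= hp ep]|[j [p [_ /= hp ep]]]|[j [p [_ /= hp ep]]]|[i [_ [//|[j _ [//]]]]]].
- by move: ep; move: hp; repeat (case; first by move=> <-).
- by move: ep; move: hp; repeat (case; first by move=> <-).
- move: ep; move: hp; case; last by repeat (case; first by move=> <-).
  by move=> <- [->] /= [e]; lia.
Qed.

Lemma w_SH rho : (forall i, i < ne -> i < g rho rix -> key (nth dent ents i) <> (g rho rq, g rho ra)) ->
  awin sp nSH rho.
Proof.
move=> h; apply: (@awin_mem sp nSH rho (map (ev_sarg E0) [:: reg rq 0; reg ra 0; reg rix 0])).
  by apply/in_gspec; constructor 1; exists (nSH, SMemS [:: reg rq 0; reg ra 0; reg rix 0]) => //=; tauto.
move=> t /in_gspec[[p /= hp ep]|[j [p [_ /= hp ep]]]|[j [p [_ /= hp ep]]]|[i [hi [//|[j hj [et]]]]]].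
- by move: ep; move: hp; repeat (case; first by move=> <-).
- by move: ep; move: hp; repeat (case; first by move=> <-).
- by move: ep; move: hp; repeat (case; first by move=> <-).
rewrite et => e; apply: (h i hi).
  by move: e; rewrite /genv; case: (nth dent ents i) => [[[[q0 a0] q1] b] d] /= [_ _]; lia.
by move: e; rewrite /genv; case: (nth dent ents i) => [[[[q0 a0] q1] b] d] /= [e1 e2 _]; rewrite /key /=; congr (_, _); lia.
Qed.

Lemma w_WIN rho : awin sp nWIN rho.
Proof. by apply: awin_win; apply/in_gspec; constructor 1; exists (nWIN, SWin) => //=; tauto. Qed.

Lemma w_FIN rho : vv rho n <> uu rho n -> g rho 3 + n <= g rho 2 -> awin sp nFIN rho.
Proof.
move=> h1 h2; apply: (@use_fixed rho 39) => //=.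
  by apply: w_EQ; rewrite /nxt /= !addn0.
apply: (@use_fixed _ 40) => //=; last exact: w_WIN.
by apply: w_LT; rewrite /nxt /= !addn0.
Qed.

Definition same_uv rho' rho := forall i, i <= n -> uu rho' i = uu rho i /\ vv rho' i = vv rho i.

Lemma same_keep A ov rho : vv (nxt E0 (keep A ov) rho) 0 = vv rho 0 ->
  same_uv (nxt E0 (keep A ov) rho) rho.
Proof.
move=> h0 i hi; have [h1 h2] := @keep_uv n l N ents hne hn hl E0 A ov rho i erefl hi; split=> //.
by case: i hi h1 h2 => // i hi _; apply.
Qed.

Lemma same_trans rho1 rho2 rho3 : same_uv rho1 rho2 -> same_uv rho2 rho3 -> same_uv rho1 rho3.
Proof. by move=> h1 h2 i hi; have [-> ->] := h1 i hi; exact: h2. Qed.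

(** Attacker decides how many units are copied, up to the bound met in the soundness proof, and then
    leaves with that number in [rX]. *)
Lemma w_LO m rho : m <= g rho 4 - g rho 5 -> m <= g rho 2 - g rho 3 ->
  (forall rho', same_uv rho' rho -> g rho' 2 = g rho 6 + m -> g rho' 3 = 0 -> awin sp nREV rho') ->
  awin sp nLO rho.
Proof.
elim: m rho => [|m IH] rho h1 h2 h.
  apply: (@use_fixed rho 37) => //=; apply: h; last by [].
    by apply: same_keep; rewrite [LHS]addn0.
  by rewrite /nxt /=.
apply: (@use_fixed rho 36) => //=.
apply: (@use_fixed _ 38) => //=; first by apply: w_EQ; rewrite /nxt /=; lia.
apply: (@use_fixed _ 35) => //=; first by apply: w_EQ; rewrite /nxt /=; lia.
apply: IH; [by rewrite /nxt /=; lia|by rewrite /nxt /=; lia|].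
move=> rho' hs e2 e3; apply: h => //; last by rewrite e2 /nxt /=; lia.
apply: (same_trans hs); do 2![apply: same_trans; first by apply: same_keep; rewrite [LHS]addn0].
by apply: same_keep; rewrite [LHS]addn0.
Qed.

Definition revst rho (b : nat -> nat) y := [/\ forall i, i <= n -> vv rho i = uu rho i + b i,
  g rho 3 <= g rho 2 & g rho 2 - g rho 3 = y].

Lemma rev_vec rho j (e := genv n l ne j 0 dent 0)
  (t := STgt nLC (fx [:: (rE0, SV (14, [:: vj; vj]) (0, [::])); (rE1, SV (15, [:: vj; vj]) (0, [::]));
                         (rL, SV (14, [:: vj; vj]) (0, [::])); (rR, SV (15, [:: vj; vj]) (1, [::]));
                         (rS, zer); (rv0, zer)]) VRev ulast) i : j < n -> i <= n ->
  uu (nxt e t rho) i = (if i <= j then 0 else uu rho i) /\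
  vv (nxt e t rho) i = (if i <= j then 0 else if i == j.+1 then (vv rho i).+1 else vv rho i).
Proof.
move=> hj hi; have hsl i (h : i < n) := @nxt_slot e t rho erefl i h; split.
  move: hi; rewrite leq_eqVlt => /orP[/eqP ->|h].
    by rewrite -[in LHS](erefl : e vn = n) nxt_last //= !addn0 leqNgt hj.
  by have [-> _] := hsl i h; rewrite /=; case: (ltngtP i j) => //= _; rewrite ?addn0 ?addn1.
case: i hi => [|i] h; first by rewrite /vv /nxt /=.
have [_ ->] := hsl i h; rewrite /= /vv (_ : 14 + (i.+1 + i.+1) = 16 + (i + i)); last lia.
by rewrite eqSS; case: (ltngtP i j) => //= _; rewrite ?addn0 ?addn1.
Qed.

Lemma w_REVj j rho b y : j < n -> revst rho b y -> (forall i, i < j -> b i = 0) -> b j = y.+1 ->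
  (forall rho', revst rho' (fun i => if i <= j then 0 else if i == j.+1 then (b i).+1 else b i) y ->
     awin sp nREV rho') -> awin sp nREV rho.
Proof.
move=> hj [hv hTX hz] hb0 hbj h.
set e := genv n l ne j 0 dent 0; pose t := stgt_of (nth pick_item vec_items 1).
have hw : awin sp nLC (nxt e t rho) -> awin sp nREV rho.
  apply: (@awin_opt sp nREV rho (2 + j) (ev_tgt e t)).
  apply/in_gspec; constructor 2; exists j, (nth pick_item vec_items 1); split=> //=; tauto.
have hvj := hv j (ltnW hj).
apply: hw; apply: (@use_fixed _ 35) => //=.
  by apply: w_EQ; move: hvj; rewrite /nxt /e /t /= /uu /vv; lia.
apply: (@w_LO y).
- by move: hvj; rewrite /nxt /e /t /= /uu /vv; lia.
- by rewrite /nxt /e /t /=; lia.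
move=> rho' hs e2 e3; apply: h; split.
- move=> i hi; have [-> ->] := hs i hi.
  have hk : same_uv (nxt E0 (keep nLO [::]) (nxt e t rho)) (nxt e t rho).
    by apply: same_keep; rewrite [LHS]addn0.
  have [-> ->] := hk i hi; have [-> ->] := rev_vec rho hj hi.
  by case: ifP => // _; case: ifP => _; rewrite hv // addnS.
- by rewrite e3.
- by rewrite e2 e3 /nxt /=; lia.
Qed.

Lemma w_REV0 rho b y : revst rho b y.+1 ->
  (forall rho', revst rho' (fun i => if i == 0 then (b i).+1 else b i) y ->
     awin sp nREV rho') -> awin sp nREV rho.
Proof.
move=> [hv hTX hz] h.
apply: (@use_fixed rho 33) => //=; apply: (@use_fixed _ 34) => //=.
  by apply: w_EQ; rewrite /nxt /=; lia.
apply: h; split; [|by rewrite /nxt /=; lia|by rewrite /nxt /=; lia].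
move=> i hi; have := keep_uv hne hn hl nRC [:: (rE0, reg rX 0); (rE1, reg rT 0); (rT, reg rT 1); (rv0, reg rv0 1)] rho (erefl : E0 vn = n) hi.
set rho1 := nxt _ _ rho => -[hu1 hv1].
have hk : same_uv (nxt E0 (keep nREV [::]) rho1) rho1 by apply: same_keep; rewrite [LHS]addn0.
have [-> ->] := hk i hi; rewrite hu1.
case: i hi hu1 hv1 => [|i] hi hu1 hv1; last by rewrite hv1 // hv.
by rewrite addnS -hv // /vv /rho1 /nxt /= addn1.
Qed.

Lemma revst_eq rho b b' y : (forall i, i <= n -> b i = b' i) -> revst rho b y -> revst rho b' y.
Proof. by move=> e [h1 h2 h3]; split=> // i hi; rewrite -e // h1. Qed.

(** Attacker undoes one application of [fgh k] without loss. As [fgh k.+1 y] is [y + 1] applications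
    of [fgh k] to [y], these are undone one by one and then exchanged for one on level [k.+1]. *)
Lemma w_REV_level k rho b y : k <= n -> revst rho b (fgh k y) -> (forall i, i < k -> b i = 0) ->
  (forall rho', revst rho' (fun i => if i == k then (b i).+1 else b i) y -> awin sp nREV rho') ->
  awin sp nREV rho.
Proof.
elim: k rho b y => [|k IH] rho b y hk hst hb0 h; first exact: w_REV0 hst h.
have inner : forall m rho b, revst rho b (iter m (fgh k) y) -> (forall i, i < k -> b i = 0) ->
   (forall rho', revst rho' (fun i => if i == k then b i + m else b i) y -> awin sp nREV rho') ->
   awin sp nREV rho.
  elim=> [|m IHm] rho1 b1 hst1 hb1 h1.
    by apply: h1; apply: revst_eq hst1 => i _; case: eqP; rewrite ?addn0.
  apply: (IH _ _ _ _ hst1 hb1); first exact: ltnW.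
  move=> rho2 hst2; apply: (IHm _ _ hst2).
    by move=> i hi; rewrite ltn_eqF // hb1.
  move=> rho3 hst3; apply: h1; apply: revst_eq hst3 => i _.
  by case: eqP => // _; rewrite addSnnS.
apply: (inner _ _ _ hst); first by move=> i hi; apply: hb0; exact: ltnW.
(* Counter [k] is now [y + 1] and the number is [y]: exactly the case in which the exchange loses
   nothing. *)
move=> rho1 hst1; apply: (w_REVj hk hst1).
- by move=> i hi; rewrite ltn_eqF // hb0 // ltnW.
- by rewrite eqxx hb0.
move=> rho2 hst2; apply: h; apply: revst_eq hst2 => i hi.
case: leqP => h3; first by rewrite hb0 // ltn_eqF.
by rewrite [i == k]gtn_eqF.
Qed.

Lemma w_GD rho : g rho 2 = TT -> awin sp nGD rho.
Proof.
move=> eX; apply: (@use_fixed rho 31) => //=.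
  by apply: w_LT; rewrite /nxt /= eX addn0 add1n leq_addl.
set t := STgt _ _ _ _.
have hz i : i <= n -> uu (nxt E0 t rho) i = 0 /\ vv (nxt E0 t rho) i = 0.
  move=> hi; split.
    move: hi; rewrite leq_eqVlt => /orP[/eqP ->|h]; first exact: (@nxt_last E0 t rho erefl).
    by have [-> _] := @nxt_slot E0 t rho erefl i h.
  case: i hi => // i h; by have [_ ->] := @nxt_slot E0 t rho erefl i h.
have e2 : g (nxt E0 t rho) 2 = TT by rewrite /nxt /= addn0.
have e3 : g (nxt E0 t rho) 3 = l.+1 by [].
apply: (@w_REV_level n _ (fun _ => 0) n) => //.
  split; rewrite ?e2 ?e3; [|exact: leq_addl|by rewrite addnK].
  by move=> i hi; have [-> ->] := hz i hi.
move=> rho' [h1 h2 h3]; have := h1 n (leqnn n); rewrite eqxx addn1 => h4.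
apply: (@use_fixed rho' 32) => //=; apply: w_FIN; last by rewrite /nxt /=; lia.
have hk : same_uv (nxt E0 (keep nFIN [::]) rho') rho' by apply: same_keep; rewrite [LHS]addn0.
by have [-> ->] := hk n (leqnn n); lia.
Qed.

(** [rS] gains one for each of the [m] ticks left and two for each of the [k] units common to [rL]
    and [rR]. *)
Lemma w_ZC m k rho : m = g rho 2 - g rho 3 -> k = g rho 4 - g rho 9 -> k = g rho 5 - g rho 10 ->
  g rho 6 + m + 2 * k = TT -> awin sp nZC rho.
Proof.
elim: m k rho => [|m IHm] k rho e1 e2 e3 e4.
  elim: k rho e1 e2 e3 e4 => [|k IHk] rho e1 e2 e3 e4.
    by apply: (@use_fixed rho 25) => //=; apply: w_GD; rewrite /nxt /=; lia.
  apply: (@use_fixed rho 24) => //=; apply: (@use_fixed _ 27) => //=.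
    by apply: w_EQ; rewrite /nxt /=; lia.
  apply: (@use_fixed _ 26) => //=; first by apply: w_EQ; rewrite /nxt /=; lia.
  by apply: IHk; rewrite /nxt /=; lia.
apply: (@use_fixed rho 23) => //=; apply: (@use_fixed _ 26) => //=.
  by apply: w_EQ; rewrite /nxt /=; lia.
by apply: (IHm k); rewrite /nxt /=; lia.
Qed.

(** Attacker names the halting state and symbol through options numbered below [N]; the bound makes
    the true ones available. *)
Lemma conf_bnd t q h tp : cnf t = Some (q, h, tp) -> q < N /\ forall p, tp p < N.
Proof.
have N0 : 0 < N by apply: leq_ltn_trans hl.
elim: t q h tp => [|t IH] q h tp; first by case=> <- _ <-.
rewrite /conf frunS -/(conf l ents t); case: (cnf t) IH => [[[q0 h0] tp0]|] //= IH.
case e: (lookup_delta _ _ _) => [[[q1 b] d]|] // [<- _ <-].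
have [i [hi _ + _]] := lookup_someP e; have := hents hi; have [_ h1] := IH _ _ _ erefl.
case: (nth _ _ _) => [[[[x1 x2] x3] x4] x5] /and4P[b1 b2 b3 b4] [<- <- _]; split=> // p.
by rewrite /zupd; case: Z.eqb.
Qed.

(** Attacker retraces the actual run: at time [d] she chooses the entry used in the step that led
    there, so each claim Defender can select is again true. *)
Lemma w_RUN d rho q h tp a : g rho rX = TT -> TT = g rho rT + d ->
  g rho rL + g rho rR + g rho rS = g rho rT -> cnf d = Some (q, h, tp) -> g rho rq = q ->
  g rho ra = a -> tp (Z.sub h (Z.sub (Z.of_nat (g rho rL)) (Z.of_nat (g rho rR)))) = a ->
  awin sp nRUN rho.
Proof.
elim: d rho q h tp a => [|d IH] rho q h tp a eX eT eS hc eq ea ht.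
  case: hc => e1 e2 e3.
  apply: (@use_fixed rho 11) => //=; apply: (@use_fixed _ 28) => //=.
    by apply: w_LT; rewrite /nxt /=; lia.
  apply: (@use_fixed _ 29) => //=; first by apply: w_LT; rewrite /nxt /=; lia.
  apply: (@use_fixed _ 30) => //=; last by apply: w_GD; rewrite /nxt /=; lia.
  by apply: w_LT; rewrite /nxt /= ea -ht -e3.
move: hc; rewrite /conf frunS -/(conf l ents d).
case hc: (cnf d) => [[[q0 h0] tp0]|] //=.
case elk: (lookup_delta _ _ _) => [[[q1 b] dd]|] // [e1 e2 e3].
have [i [hi hkey hval hfirst]] := lookup_someP elk.
set e := genv n l ne 0 0 (nth dent ents i) i; pose t := stgt_of pick_item.
have hw : awin sp nP1 (nxt e t rho) -> awin sp nRUN rho.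
  apply: (@awin_opt sp nRUN rho (evx e (1, [:: vidx])) (ev_tgt e t)).
  by apply/in_gspec; constructor 4; exists i; split=> //; left.
apply: hw.
have hE : [/\ e vq0 = q0, e va0 = tp0 h0, e vq1 = q1, e vb = b & e vidx = i] /\
   [/\ e vdl = isL dd, e vdr = isR dd & e vds = isS dd].
  move: hkey hval; rewrite /e /key /val_of; case: (nth _ _ _) => [[[[x1 x2] x3] x4] x5] /=.
  by case=> <- <- [<- <- <-].
set rho1 := nxt e t rho.
have [f0 f1 f2 f3 f4] : [/\ g rho1 0 = g rho 2, g rho1 1 = g rho 3, g rho1 2 = g rho 2,
   g rho1 3 = (g rho 3).+1 & g rho1 4 = g rho 4 + isL dd].
  by case: hE => _ [h1 h2 h3]; rewrite /rho1 /nxt /t /=; split; lia.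
have [f5 f6 f7 f8] : [/\ g rho1 5 = g rho 5 + isR dd, g rho1 6 = g rho 6 + isS dd,
   g rho1 7 = q & g rho1 8 = a].
  by case: hE => _ [h1 h2 h3]; rewrite /rho1 /nxt /t /=; split; lia.
have [[f9 f10 f11] f12 f13] : [/\ [/\ g rho1 9 = q0, g rho1 10 = tp0 h0 & g rho1 11 = q1],
   g rho1 12 = b & g rho1 13 = i].
  by case: hE => [[h1 h2 h3 h4 h5]] _; rewrite /rho1 /nxt /t /=; split; [split| |]; lia.
have hLRS : g rho1 4 + g rho1 5 + g rho1 6 = g rho1 3.
  by rewrite f3 f4 f5 f6 -eS; case: (dd) => /=; lia.
clearbody rho1; clear hE.
apply: (@use_fixed _ 12) => //=; first by apply: w_EQ; rewrite /nxt /=; lia.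
apply: (@use_fixed _ 13) => //=.
  apply: w_SH; rewrite /nxt /= !addn0 f13 f9 f10 => j hj hji; exact: hfirst.
apply: (@use_fixed _ 14) => //=; first by apply: w_LT; rewrite /nxt /=; lia.
apply: (@use_fixed _ 15) => //=; first by apply: w_LT; rewrite /nxt /=; lia.
(* Equality means that the observed cell is the one this step has written; then its old content is
   irrelevant and only the symbol read has to be justified. *)
case: (g rho1 4 =P g rho1 5) => hLR.
  have eab : a = b.
    rewrite -ht -e3 /zupd; case: Z.eqb_spec => // hz; case: hz.
    by move: hLR; rewrite f4 f5 -e2; case: (dd) => /=; lia.
  apply: (@use_fixed _ 16) => //=; apply: (@use_fixed _ 18) => //=.
    by apply: w_LT; rewrite /nxt /=; lia.
  apply: (@use_fixed _ 19) => //=; first by apply: w_LT; rewrite /nxt /=; lia.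
  apply: (@use_fixed _ 20) => //=.
    by apply: (@w_ZC (g rho1 2 - g rho1 3) (g rho1 4)); rewrite /nxt /=; lia.
  apply: (IH _ q0 h0 tp0 (tp0 h0)) => //; rewrite /nxt /=; try lia.
  by congr tp0; lia.
apply: (@use_fixed _ 17) => //=; apply: (@use_fixed _ 21) => //=.
  by apply: w_EQ; rewrite /nxt /=; lia.
apply: (@use_fixed _ 22) => //=.
  apply: (IH _ q0 h0 tp0 a) => //; rewrite /nxt /=; try lia.
  rewrite -ht -e3 /zupd; case: Z.eqb_spec => [hz|_].
    by case: hLR; move: hz; rewrite f4 f5 -e2; case: (dd) => /=; lia.
  by congr tp0; rewrite !addn0 f4 f5 -e2; case: (dd) => /=; lia.
apply: (IH _ q0 h0 tp0 (tp0 h0)) => //; rewrite /nxt /=; try lia.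
by congr tp0; lia.
Qed.

Lemma w_HC d rho q h tp : g rho rX = TT -> TT = g rho rT + d -> cnf d = Some (q, h, tp) ->
  g rho rq = q -> g rho ra = tp h -> lookup_delta ents q (tp h) = None -> awin sp nHC rho.
Proof.
move=> eX eT hc eq ea hlk; apply: (@use_fixed rho 10) => //=.
  apply: w_SH; rewrite /nxt /= !addn0 eq ea => i hi _; exact: (lookup_none ents q (tp h)).1 hlk i hi.
apply: (w_RUN (q := q) (h := h) (tp := tp) (a := tp h) (d := d)) => //; rewrite /nxt /=; try lia.
by congr tp; lia.
Qed.

(** The machine may halt well before [TT]; the [m] idle ticks make up the difference. *)
Lemma w_I m d rho q h tp : g rho rX = TT -> TT = g rho rT + m + d -> cnf d = Some (q, h, tp) ->
  lookup_delta ents q (tp h) = None -> awin sp nI rho.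
Proof.
elim: m rho => [|m IH] rho eX eT hc hlk; last first.
  apply: (@use_fixed rho 8) => //=; apply: (@use_fixed _ 9) => //=.
    by apply: w_EQ; rewrite /nxt /=; lia.
  by apply: IH hc hlk; rewrite /nxt /=; lia.
have [hq htp] := conf_bnd hc.
set e := genv n l ne 0 q dent 0; pose t := stgt_of (nth pick_item val_items 1).
have hw : awin sp nJ (nxt e t rho) -> awin sp nI rho.
  apply: (@awin_opt sp nI rho (1 + q) (ev_tgt e t)).
  apply/in_gspec; constructor 3; exists q, (nth pick_item val_items 1); split=> //=; tauto.
apply: hw; set e' := genv n l ne 0 (tp h) dent 0; pose t' := stgt_of (nth pick_item val_items 2).
have hw : awin sp nHC (nxt e' t' (nxt e t rho)) -> awin sp nJ (nxt e t rho).
  apply: (@awin_opt sp nJ _ (0 + tp h) (ev_tgt e' t')).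
  apply/in_gspec; constructor 3; exists (tp h), (nth pick_item val_items 2); split=> //=; tauto.
by apply: hw; apply: (w_HC (d := d)) hc _ _ hlk; rewrite /nxt /e /e' /t /t' /=; lia.
Qed.

Lemma fwd_vec rho j (e := genv n l ne j 0 dent 0)
  (t := STgt nCC (fx [:: (rE0, SV (17, [:: vj; vj]) (0, [::])); (rE1, SV (16, [:: vj; vj]) (0, [::]));
                         (rv0, zer)]) VFwd ulast) i : j < n -> i <= n ->
  uu (nxt e t rho) i = (if i < j then 0 else if i == j then (g rho rX).+1 else uu rho i) /\
  vv (nxt e t rho) i = (if i <= j then 0 else if i == j.+1 then (vv rho i).+1 else vv rho i).
Proof.
move=> hj hi; have hsl i (h : i < n) := @nxt_slot e t rho erefl i h; split.
  move: hi; rewrite leq_eqVlt => /orP[/eqP ->|h].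
    by rewrite -[in LHS](erefl : e vn = n) nxt_last //= !addn0 ltnNge (ltnW hj) /= gtn_eqF.
  by have [-> _] := hsl i h; rewrite /=; case: (ltngtP i j) => //= _; rewrite ?addn0 ?addn1.
case: i hi => [|i] h; first by rewrite /vv /nxt /=.
have [_ ->] := hsl i h; rewrite /= /vv (_ : 14 + (i.+1 + i.+1) = 16 + (i + i)); last lia.
by rewrite eqSS; case: (ltngtP i j) => //= _; rewrite ?addn0 ?addn1.
Qed.

Definition fwdst rho (a : nat -> nat) x :=
  (forall i, i <= n -> uu rho i = vv rho i + a i) /\ g rho rX = x.

Lemma fwdst_eq rho b b' y : (forall i, i <= n -> b i = b' i) -> fwdst rho b y -> fwdst rho b' y.
Proof. by move=> e [h1 h2]; split=> // i hi; rewrite -e // h1. Qed.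

Lemma w_Cj j rho a x : j < n -> fwdst rho a x -> 0 < a j.+1 ->
  (forall rho', fwdst rho' (fun i => if i < j then 0 else if i == j then x.+1 else
      if i == j.+1 then (a i).-1 else a i) x -> awin sp nC rho') -> awin sp nC rho.
Proof.
move=> hj [hu eX] ha h.
set e := genv n l ne j 0 dent 0; pose t := stgt_of (nth pick_item vec_items 0).
have hw : awin sp nCC (nxt e t rho) -> awin sp nC rho.
  apply: (@awin_opt sp nC rho (2 + j) (ev_tgt e t)).
  apply/in_gspec; constructor 2; exists j, (nth pick_item vec_items 0); split=> //=; tauto.
have huj := hu j.+1 hj.
apply: hw; apply: (@use_fixed _ 7) => //=.
  apply: w_EQ; move: huj; rewrite /nxt /e /t /= /uu /vv.
  rewrite (_ : 15 + (j.+1 + j.+1) = 17 + (j + j)); last lia.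
  by rewrite (_ : 14 + (j.+1 + j.+1) = 16 + (j + j)); lia.
apply: h; split; last by rewrite /nxt /=; lia.
move=> i hi; have hk : same_uv (nxt E0 (keep nC [::]) (nxt e t rho)) (nxt e t rho).
  by apply: same_keep; rewrite [LHS]addn0.
have [-> ->] := hk i hi; have [-> ->] := fwd_vec rho hj hi.
rewrite eX; case: (ltngtP i j) => hij //; case: eqP => [e1|_]; last exact: hu.
by rewrite hu // addSnnS prednK // e1.
Qed.

Lemma w_C0 rho a x : fwdst rho a x -> 0 < a 0 ->
  (forall rho', fwdst rho' (fun i => if i == 0 then (a i).-1 else a i) x.+1 ->
     awin sp nC rho') -> awin sp nC rho.
Proof.
move=> [hu eX] ha h; have hu0 := hu 0 isT.
apply: (@use_fixed rho 6) => //=; apply: (@use_fixed _ 7) => //=.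
  by apply: w_EQ; move: hu0; rewrite /nxt /= /uu /vv !addn0; lia.
apply: h; split; last by rewrite /nxt /=; lia.
move=> i hi; have := keep_uv hne hn hl nCC [:: (rE0, reg 15 0); (rE1, reg rv0 0); (rv0, reg rv0 1); (rX, reg rX 1)] rho (erefl : E0 vn = n) hi.
set rho1 := nxt _ _ rho => -[hu1 hv1].
have hk : same_uv (nxt E0 (keep nC [::]) rho1) rho1 by apply: same_keep; rewrite [LHS]addn0.
have [-> ->] := hk i hi; rewrite hu1.
case: i hi hu1 hv1 => [|i] hi hu1 hv1; last by rewrite hv1 // hu.
by rewrite [vv rho1 0](_ : _ = (vv rho 0).+1) ?hu //= 1?addSnnS ?prednK // /vv /rho1 /nxt /= addn1.
Qed.

(** Using up the counters from the lowest level upwards, Attacker attains the potential exactly. *)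
Lemma w_C_level k rho a x : k <= n.+1 -> fwdst rho a x ->
  (forall rho', fwdst rho' (fun i => if i < k then 0 else a i) (potf a k x) -> awin sp nC rho') ->
  awin sp nC rho.
Proof.
elim: k rho a x => [|k IH] rho a x hk hst h; first exact: h.
apply: (IH _ _ _ (ltnW hk) hst) => rho1 hst1.
have inner : forall c rho a1 y, fwdst rho a1 y -> (forall i, i < k -> a1 i = 0) -> a1 k = c ->
   (forall rho', fwdst rho' (fun i => if i == k then 0 else a1 i) (iter c (fgh k) y) -> awin sp nC rho') ->
   awin sp nC rho.
  elim=> [|c IHc] rho2 a2 y hst2 ha2 ec h2.
    by apply: h2; apply: fwdst_eq hst2 => i _; case: eqP => // ->.
  (* An application on level 0 is a plain increment. On a higher level it is exchanged for [y + 1]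
     applications one level below, and the outer induction hypothesis carries these out. *)
  rewrite iterSr in h2; case: k hk IH ha2 ec h2 IHc {hst1 h} => [|k] hk IH ha2 ec h2 IHc.
    apply: (w_C0 hst2); first by rewrite ec.
    move=> rho3 hst3; apply: (IHc _ _ _ hst3) => //; first by rewrite /= ec.
    by move=> rho4 hst4; apply: h2; apply: fwdst_eq hst4 => i _; case: eqP.
  apply: (w_Cj hk hst2); first by rewrite ec.
  move=> rho3 hst3; apply: (IH _ _ _ (ltnW hk) hst3) => rho4.
  set a3 := fun i => if i < k then 0 else if i == k then y.+1 else if i == k.+1 then (a2 i).-1 else a2 i; have -> : potf a3 k.+1 y = fgh k.+1 y.
    have e3 : a3 k = y.+1 by rewrite /a3 ltnn eqxx.
    by rewrite [LHS]/= e3 potf_zero // => i hi; rewrite /a3 hi.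
  move=> hst4; apply: (IHc _ _ _ hst4).
  - by move=> i ->.
  - by rewrite ltnn /a3 ltnNge leqnSn /= gtn_eqF // eqxx ec.
  move=> rho5 hst5; apply: h2; apply: fwdst_eq hst5 => i _.
  case: eqP => // hi; case: ltnP => h3; first by rewrite ha2.
  by rewrite /a3 ltnNge (ltnW h3) /= gtn_eqF //; case: eqP.
apply: (inner (a k) _ _ _ hst1).
- by move=> i ->.
- by rewrite ltnn.
move=> rho2 hst2; apply: h; apply: fwdst_eq hst2 => i _.
by rewrite ltnS; case: (ltngtP i k).
Qed.

(** The number [n] with a single pending application of [fgh n]: the last register is [u_n = 1]. *)
Definition rho0 := [:: 0; 0; n; 0; 0; 0; 0; 0; 0; 0; 0; 0; 0; 0; 0] ++ (nseq (n + n) 0 ++ [:: 1]).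

Lemma uv_rho0 i : i <= n -> uu rho0 i = (i == n) /\ vv rho0 i = 0.
Proof.
move=> hi; split.
  rewrite /uu (@nth_cat_add _ _ 15) // nth_cat size_nseq nth_nseq.
  case: (ltngtP i n) hi => // [hi|->] _; last by rewrite ltnn subnn.
  by rewrite (_ : i + i < n + n) //; lia.
case: i hi => // i hi; rewrite /vv (_ : 14 + _ = 15 + (i + i).+1); last lia.
rewrite (@nth_cat_add _ _ 15) // nth_cat size_nseq nth_nseq.
by rewrite (_ : (i + i).+1 < n + n) //; lia.
Qed.

Theorem game_halt : awin sp nC rho0 <-> HALT n l ents.
Proof.
split.
  move=> /(awin_phi hne hn hl hents) h; apply: h.
    by move=> i hi; have [-> ->] := uv_rho0 hi.
  rewrite [g _ _]/=.
  have -> : potf (fwd rho0) n.+1 n = fgh n n; last by [].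
  have e i : i <= n -> fwd rho0 i = (i == n).
    by move=> hi; have [h1 h2] := uv_rho0 hi; rewrite /fwd h1 h2 subn0.
  rewrite /= e // eqxx /= potf_zero // => i hi.
  by rewrite e ?ltn_eqF // ltnW.
case=> d [[[q h] tp] [hd hc hlk]].
apply: (@w_C_level n.+1 _ (fun i => (i == n) : nat) n) => //.
  split; last by [].
  by move=> i hi; have [-> ->] := uv_rho0 hi.
move=> rho' [_ eX].
have {}eX : g rho' rX = fgh n n.
  by rewrite eX /= eqxx /= potf_zero // => i hi; rewrite ltn_eqF.
apply: (@use_fixed rho' 5) => //=; apply: (@w_I (TT - d) d) hc _.
- by rewrite /nxt /= eX add1n.
- by rewrite /nxt /= add0n subnK.
- by move: hlk => /=; case: (lookup_delta _ _ _) => [[[]]|].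
Qed.

End Sem2.

(** * Starting from the blank tape *)

Definition mentry (l : nat) (e : entry) : entry :=
  let '(q, a, q', b, d) := e in (q + l.+1, a, q' + l.+1, b, d).
Definition ventry (w : seq bool) i : entry := (i.+1, 0, i, sym_of_bit (nth false w i), MoveL).
Definition lentry (l : nat) : entry := (0, 0, l.+1, 0, MoveR).

(* State [l = size w] starts on the blank tape; state [i.+1] writes the [i]-th
   input symbol and moves left; state [0] enters the start state of the machine. *)
Definition ments (D : seq entry) (w : seq bool) : seq entry :=
  map (mentry (size w)) D ++ ([seq ventry w i | i <- iota 0 (size w)] ++ [:: lentry (size w)]).

Section Link.
Variables (M : TM) (w : seq bool).
Let l := size w.
Let E := ments (tm_delta M) w.

Lemma lookup_v q a m b : lookup_delta [seq ventry w i | i <- iota b m] q a =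
  if (b < q <= b + m) && (a == 0) then Some (q.-1, sym_of_bit (nth false w q.-1), MoveL) else None.
Proof.
elim: m b => [|m IH] b /=; first by case: ifP => //; lia.
rewrite IH; case: (b.+1 =P q) => [<-|hq] /=.
  by rewrite ltnSn addnS ltnS leq_addr [0 == a]eq_sym /=; case: eqP => // _; rewrite ltnn.
by congr (if _ then _ else _); lia.
Qed.

Lemma lookup_mlow D q a : q <= l -> lookup_delta (map (mentry l) D) q a = None.
Proof.
move=> hq; elim: D => //= -[[[[q0 a0] q1] b] d] D IH /=.
by case: ifP => // /andP[/eqP h _]; lia.
Qed.

Lemma lookup_mhigh D q a : lookup_delta (map (mentry l) D) (q + l.+1) a =
  if lookup_delta D q a is Some (q', b, d) then Some (q' + l.+1, b, d) else None.
Proof.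
elim: D => //= -[[[[q0 a0] q1] b] d] D IH /=.
by rewrite eqn_add2r; case: ifP.
Qed.

Lemma lookup_E_high q a : lookup_delta E (q + l.+1) a =
  if lookup_delta (tm_delta M) q a is Some (q', b, d) then Some (q' + l.+1, b, d) else None.
Proof.
rewrite /E /ments -/l lookup_cat lookup_mhigh; case: (lookup_delta _ q a) => [[[q' b] d]|] //.
rewrite lookup_cat lookup_v; case: ifP => [|_ /=]; last by case: ifP => //; lia.
by rewrite -/l; lia.
Qed.

Lemma lookup_E_v i : i < l -> lookup_delta E i.+1 0 = Some (i, sym_of_bit (nth false w i), MoveL).
Proof.
move=> hi; rewrite /E /ments -/l lookup_cat lookup_mlow // lookup_cat lookup_v.
by rewrite add0n -/l hi.
Qed.

Lemma lookup_E_0 : lookup_delta E 0 0 = Some (l.+1, 0, MoveR).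
Proof.
by rewrite /E /ments -/l lookup_cat lookup_mlow // lookup_cat lookup_v.
Qed.

Definition rel (c : config) (f : fconf) : Prop :=
  let '(q, L, a, R) := c in let '(q', h, t) := f in
  [/\ q' = q + l.+1, t h = a,
   forall k, t (Z.add h (Z.of_nat k.+1)) = nth 0 R k &
   forall k, t (Z.sub h (Z.of_nat k.+1)) = nth 0 L k].

Lemma rel_step c f : rel c f ->
  match tm_step M c, fstep E f with
  | None, None => True | Some c', Some f' => rel c' f' | _, _ => False end.
Proof.
case: c => [[[q L] a] R]; case: f => [[q' h] t] [-> et hR hL].
rewrite /tm_step /fstep et lookup_E_high; case: (lookup_delta _ q a) => [[[q1 b] d]|] //.
have nb p : p <> h -> zupd t h b p = t p by rewrite /zupd; case: Z.eqb_spec.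
have eb : zupd t h b h = b by rewrite /zupd Z.eqb_refl.
have z1 k : Z.add (Z.add h 1) (Z.of_nat k.+1) = Z.add h (Z.of_nat k.+2) by lia.
have z2 k : Z.sub (Z.sub h 1) (Z.of_nat k.+1) = Z.sub h (Z.of_nat k.+2) by lia.
case: d => /=.
- case: L hL => [|x L] hL; split=> //.
  + by rewrite nb; [apply: etrans (hL 0); congr t; lia|lia].
  + move=> [|k]; first by rewrite -[RHS]eb; congr zupd; lia.
    by rewrite nb; [apply: etrans (hR k); congr t; lia|lia].
  + by move=> k; rewrite nth_nil nb; [apply: (etrans _ (etrans (hL k.+1) (nth_nil _ _))); congr t; lia|lia].
  + by rewrite nb; [apply: etrans (hL 0); congr t; lia|lia].
  + move=> [|k]; first by rewrite -[RHS]eb; congr zupd; lia.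
    by rewrite nb; [apply: etrans (hR k); congr t; lia|lia].
  + by move=> k; rewrite nb; [apply: etrans (hL k.+1); congr t; lia|lia].
- case: R hR => [|x R] hR; split=> //.
  + by rewrite nb; [apply: etrans (hR 0); congr t; lia|lia].
  + by move=> k; rewrite nth_nil nb; [apply: (etrans _ (etrans (hR k.+1) (nth_nil _ _))); congr t; lia|lia].
  + move=> [|k]; first by rewrite -[RHS]eb; congr zupd; lia.
    by rewrite nb; [apply: etrans (hL k); congr t; lia|lia].
  + by rewrite nb; [apply: etrans (hR 0); congr t; lia|lia].
  + by move=> k; rewrite nb; [apply: etrans (hR k.+1); congr t; lia|lia].
  + move=> [|k]; first by rewrite -[RHS]eb; congr zupd; lia.
    by rewrite nb; [apply: etrans (hL k); congr t; lia|lia].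
- split=> //.
  + by rewrite -[RHS]eb; congr zupd; lia.
  + by move=> k; rewrite nb; [apply: etrans (hR k); congr t; lia|lia].
  + by move=> k; rewrite nb; [apply: etrans (hL k); congr t; lia|lia].
Qed.

Lemma rel_run k c f : rel c f ->
  match tm_run M k c, frun E k f with
  | None, None => True | Some c', Some f' => rel c' f' | _, _ => False end.
Proof.
elim: k c f => [|k IH] c f h //=.
by have := rel_step h; case: (tm_step M c) => [c'|]; case: (fstep E f) => [f'|] //; exact: IH.
Qed.

Lemma frun_add a b c : frun E (a + b) c = obind (frun E b) (frun E a c).
Proof. by elim: a c => //= a IH c; case: (fstep E c). Qed.

(** The word is written from right to left, its last letter on cell 0, so that the head ends next to
    its first letter. *)
Lemma conf_pre i : i <= l -> exists t, [/\ conf l E i = Some (l - i, Z.opp (Z.of_nat i), t),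
  forall j, j < i -> t (Z.opp (Z.of_nat j)) = sym_of_bit (nth false w (l - j.+1)) &
  forall p, (Z.le p (Z.opp (Z.of_nat i)) \/ Z.lt 0 p) -> t p = 0].
Proof.
elim: i => [|i IH] hi; first by exists (fun _ => 0); split=> //; rewrite subn0.
have [t [h1 h2 h3]] := IH (ltnW hi).
have e : l - i = (l - i.+1).+1 by lia.
exists (zupd t (Z.opp (Z.of_nat i)) (sym_of_bit (nth false w (l - i.+1)))); split.
- rewrite /conf frunS -/(conf l E i) h1 /= h3; last by left; lia.
  rewrite e lookup_E_v; last lia.
  by congr (Some (_, _, _)) => /=; lia.
- move=> j hj; rewrite /zupd; case: Z.eqb_spec => hji; last by apply: h2; lia.
  by congr (sym_of_bit (nth _ _ _)); lia.
- move=> p hp; rewrite /zupd; case: Z.eqb_spec => hji; first lia.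
  by apply: h3; lia.
Qed.

(** [l] steps write the word and one more steps onto its first letter, or onto a blank if the word
    is empty; the time bound [TT] allows for them. *)
Lemma conf_start : exists f, conf l E l.+1 = Some f /\ rel (init_config w) f.
Proof.
have [t [h1 h2 h3]] := conf_pre (leqnn l).
rewrite /conf frunS -/(conf l E l) h1 subnn /= h3; last by left; lia.
rewrite lookup_E_0; eexists; split; first by [].
have z0 p : zupd t (Z.opp (Z.of_nat l)) 0 p = t p.
  by rewrite /zupd; case: Z.eqb_spec => // ->; rewrite h3 //; left; lia.
have hw i : i < l -> t (Z.add (Z.add (Z.opp (Z.of_nat l)) 1) (Z.of_nat i)) = sym_of_bit (nth false w i).
  move=> hi; have -> : Z.add (Z.add (Z.opp (Z.of_nat l)) 1) (Z.of_nat i) = Z.opp (Z.of_nat (l - i.+1)) by lia.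
  by rewrite h2; [congr (sym_of_bit (nth _ _ _)); lia|lia].
rewrite /init_config; case ew: w => [|b w'] /=; split=> //.
- by rewrite z0 h3 //; rewrite /l ew /=; lia.
- by move=> k; rewrite z0 h3 ?nth_nil //; rewrite /l ew /=; lia.
- by move=> k; rewrite z0 nth_nil h3 //; left; lia.
- rewrite z0; have := hw 0; rewrite {1}/l ew /= => <- //; congr t; lia.
- move=> k; rewrite z0; case: (ltnP k (size w')) => hk.
    rewrite (nth_map false) // -[nth false w' k]/(nth false (b :: w') k.+1) -ew -hw; last by rewrite /l ew.
    by congr t; lia.
  have hl : l = (size w').+1 by rewrite /l ew.
  by rewrite nth_default ?size_map // h3 //; right; move: hl hk; clear; move: l (size w') => x y; lia.
- by move=> k; rewrite z0 nth_nil h3 //; left; lia.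
Qed.

Theorem halt_link n : HALT n l E <-> HP_Ack_holds M w n.
Proof.
have [f0 [hf0 hr0]] := conf_start.
have hadd t : conf l E (l.+1 + t) = frun E t f0 by rewrite /conf frun_add -/(conf l E l.+1) hf0.
split.
- case=> k [c [hk hc hs]].
  (* No halt can occur during the preparation: each of its states has an entry for the blank that it
     scans. *)
  have hkl : l < k.
    rewrite ltnNge; apply/negP => hkl; have [t [h1 h2 h3]] := conf_pre hkl.
    move: hc hs; rewrite h1 => -[<-] /=; rewrite h3; last by left; lia.
    case e: (l - k) => [|m]; first by rewrite lookup_E_0.
    by rewrite lookup_E_v //; lia.
  exists (k - l.+1); split; first by rewrite /fA; lia.
  have := rel_run (k - l.+1) hr0; rewrite -hadd subnKC // hc.
  case hrun: (tm_run M _ _) => [c'|] // hr; exists c'; split=> //.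
  by have := rel_step hr; rewrite hs; case: (tm_step M c').
- case=> k [hk [c' [h1 h2]]]; have := rel_run k hr0; rewrite h1 -hadd.
  case hc: (conf _ _ _) => [f|] // hr; exists (l.+1 + k), f; split=> //; first by rewrite /fA in hk; lia.
  by have := rel_step hr; rewrite h2; case: (fstep E f).
Qed.

End Link.

(** * Injectivity of the encoding *)

Lemma unary_inj a b (r r' : seq bool) : unary_nat a ++ r = unary_nat b ++ r' -> a = b /\ r = r'.
Proof.
elim: a b => [|a IH] [|b] //=; first by case.
by case=> h; have [-> ->] := IH b h.
Qed.

Lemma bits_inj s s' : bits_of_nats s = bits_of_nats s' -> s = s'.
Proof.
elim: s s' => [|a s IH] [|b s'] //=; rewrite /bits_of_nats /=.
- by case: b.
- by case: a.
- by move=> h; have [-> /IH ->] := unary_inj h.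
Qed.

(** The generated induction principle has no hypothesis for the terms in an argument list. *)
Lemma term_rect_list (P : term -> Prop) : (forall i, P (Var i)) ->
  (forall A Us, (forall U, In_list U Us -> P U) -> P (App A Us)) -> forall T, P T.
Proof.
move=> hV hA; fix IH 1; case=> [i|A Us]; first exact: hV.
apply: hA; elim: Us => [V []|U Us IHs V [<-|]]; first exact: IH.
exact: IHs.
Qed.

Lemma flatten_inj (T : Type) (enc : T -> seq nat) (s s' : seq T) r r' :
  (forall x y r r', In_list x s -> enc x ++ r = enc y ++ r' -> x = y /\ r = r') ->
  size s = size s' -> flatten (map enc s) ++ r = flatten (map enc s') ++ r' -> s = s' /\ r = r'.
Proof.
elim: s s' => [|x s IH] [|y s'] //= h [hs]; rewrite -!catA => e.
have [-> e2] := h _ _ _ _ (or_introl erefl) e.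
by have [|-> ->] := IH s' _ hs e2; first by move=> x' y' q q' hx; apply: h; right.
Qed.

Lemma enc_term_inj T T' r r' : enc_term T ++ r = enc_term T' ++ r' -> T = T' /\ r = r'.
Proof.
elim/term_rect_list: T T' r r' => [i|A Us IH] [j|B Us'] r r' //=; first by case=> -> ->.
by case=> -> hs h; have [|-> ->] := flatten_inj _ hs h; first by move=> x y q q' hx; apply: IH.
Qed.

(** [L_Bisim] quantifies over all instances with the given code; unique decoding identifies them
    with the printed one. *)
Lemma enc_Bisim_inj G T U G' T' U' :
  enc_Bisim G T U = enc_Bisim G' T' U' -> [/\ G = G', T = T' & U = U'].
Proof.
case: G => ar ru; case: G' => ar' ru'.
move/bits_inj; rewrite /enc_grammar /= => -[hs].
rewrite -!catA => /eqP; rewrite eqseq_cat // => /andP[/eqP -> /eqP] /= [hr].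
move=> h; have [|-> h2] := flatten_inj _ hr h.
  move=> [[A a] V] [[A' a'] V'] q q' _ /= [-> ->] e.
  by have [-> ->] := enc_term_inj e.
have [-> h3] := enc_term_inj h2.
rewrite -[enc_term U]cats0 -[enc_term U']cats0 in h3.
by have [-> _] := enc_term_inj h3.
Qed.

(** * Emitting the grammar *)

Definition vm := 13. Definition vp := 14. Definition vbad := 15. Definition vt := 16.
Definition vs := 17. Definition ve := 18. Definition vc := 19.

Definition sq := foldr Seq Skip.
Definition lit bs := sq (map Emit bs).
Definition rep v c := For vt (IfLt vt v c Skip).

Lemma upd_same e v : upd e v (e v) = e.
Proof. by apply: functional_extensionality => u; rewrite /upd; case: eqP => // ->. Qed.
Lemma upd_upd e v a b : upd (upd e v a) v b = upd e v b.
Proof. by apply: functional_extensionality => u; rewrite /upd; case: eqP. Qed.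
Lemma upd_eq e v a : upd e v a v = a.
Proof. by rewrite /upd eqxx. Qed.
Lemma upd_ne e v a u : u != v -> upd e v a u = e u.
Proof. by rewrite /upd => /negbTE ->. Qed.

Lemma bits_cat s s' : bits_of_nats (s ++ s') = bits_of_nats s ++ bits_of_nats s'.
Proof. by rewrite /bits_of_nats map_cat flatten_cat. Qed.
Lemma bits_flatten ss : bits_of_nats (flatten ss) = flatten (map bits_of_nats ss).
Proof. by elim: ss => //= s ss IH; rewrite bits_cat IH. Qed.

Section Emits.
Variable x : seq bool.
Let N := size x.

(** Printing commands restore all variables; since a loop ends by resetting its variable, that
    variable has to be 0 beforehand. *)
Definition emits c e w := forall o, exec x c (e, o) = (e, o ++ w).

Lemma emits_skip e : emits Skip e [::].
Proof. by move=> o; rewrite /= cats0. Qed.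

Lemma emits_seq c1 c2 e w1 w2 : emits c1 e w1 -> emits c2 e w2 ->
  emits (Seq c1 c2) e (w1 ++ w2).
Proof. by move=> h1 h2 o; rewrite /= h1 h2 catA. Qed.

Lemma emits_sq (T : Type) (f : T -> cmd) (w : T -> seq bool) e s :
  (forall y, In_list y s -> emits (f y) e (w y)) ->
  emits (sq (map f s)) e (flatten (map w s)).
Proof.
elim: s => [|y s IH] h; first exact: emits_skip.
by apply: emits_seq; [apply: h; left|apply: IH => y' hy; apply: h; right].
Qed.

Lemma emits_lit bs e : emits (lit bs) e bs.
Proof.
rewrite -[X in emits _ _ X](_ : flatten [seq [:: b] | b <- bs] = bs).
  by apply: emits_sq => y _ o; rewrite /= cats1.
by elim: bs => //= b bs ->.
Qed.

Lemma emits_for v c e (f : nat -> seq bool) : e v = 0 ->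
  (forall j, j < N -> emits c (upd e v j) (f j)) ->
  emits (For v c) e (flatten [seq f j | j <- iota 0 N]).
Proof.
move=> e0 h o.
have H r : forall b a o, b + r <= N ->
  foldl (fun s j => exec x c (upd s.1 v j, s.2)) (upd e v a, o) (iota b r) =
  (upd e v (if r is r'.+1 then b + r' else a), o ++ flatten [seq f j | j <- iota b r]).
  elim: r => [|r IH] b a o' hb; first by rewrite /= cats0.
  rewrite /= upd_upd h; last lia.
  by rewrite IH -?catA; [case: (r) => [|r']; rewrite ?addn0 ?addSnnS|lia].
rewrite [exec _ _ _]/= -/N -[e in foldl _ (e, _) _](upd_same e v) H // /= upd_upd -e0.
by rewrite upd_same.
Qed.

Lemma emits_iflt v u c1 c2 e w1 w2 : (e v < e u -> emits c1 e w1) -> (e u <= e v -> emits c2 e w2) ->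
  emits (IfLt v u c1 c2) e (if e v < e u then w1 else w2).
Proof. by move=> h1 h2 o /=; case: ltnP => h; [exact: h1|exact: h2]. Qed.

Lemma emits_lt_true v u c1 c2 e w : e v < e u -> emits c1 e w -> emits (IfLt v u c1 c2) e w.
Proof. by move=> h h1 o; rewrite -h1 /= h. Qed.

Lemma emits_lt_false v u c1 c2 e w : e u <= e v -> emits c2 e w -> emits (IfLt v u c1 c2) e w.
Proof. by move=> h h1 o; rewrite -h1 /= ltnNge h. Qed.

Lemma emits_forlt v u c e (f : nat -> seq bool) : e v = 0 -> u != v -> e u <= N ->
  (forall j, j < e u -> emits c (upd e v j) (f j)) ->
  emits (For v (IfLt v u c Skip)) e (flatten [seq f j | j <- iota 0 (e u)]).
Proof.
move=> e0 huv hu h.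
have -> : flatten [seq f j | j <- iota 0 (e u)] =
   flatten [seq if j < e u then f j else [::] | j <- iota 0 N].
  rewrite -(subnKC hu) iotaD map_cat flatten_cat add0n.
  rewrite [X in _ ++ X](_ : _ = [::]) ?cats0.
    by congr flatten; apply/eq_in_map => j; rewrite mem_iota add0n => /andP[_ ->].
  have H r : forall b, e u <= b -> flatten [seq if j < e u then f j else [::] | j <- iota b r] = [::].
    by elim: r => //= r IH b hb; rewrite ltnNge hb /= IH // ltnW.
  exact: H.
apply: emits_for => // j hj.
have := @emits_iflt v u c Skip (upd e v j) (f j) [::].
rewrite upd_eq upd_ne //; apply=> hj2; [exact: h|exact: emits_skip].
Qed.

Lemma emits_eq c e w w' : w = w' -> emits c e w -> emits c e w'.
Proof. by move=> ->. Qed.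

Definition envok e := [/\ e vt = 0 & forall v, e v <= N].

Lemma envok_upd e v j : envok e -> v != vt -> j <= N -> envok (upd e v j).
Proof.
case=> h1 h2 hv hj; split; first by rewrite upd_ne // eq_sym.
by move=> u; rewrite /upd; case: eqP.
Qed.

Lemma emits_rep v bs e : envok e -> v != vt -> emits (rep v (lit bs)) e (flatten (nseq (e v) bs)).
Proof.
case=> h1 h2 hv; have := @emits_forlt vt v (lit bs) e (fun _ => bs) h1 hv (h2 v) (fun j _ => emits_lit bs _).
apply: emits_eq; congr flatten.
suff H b m : [seq bs | _ <- iota b m] = nseq m bs by exact: H.
by elim: m b => //= m IH b; rewrite IH.
Qed.

Definition crep (y : expr) bs :=
  Seq (lit (flatten (nseq y.1 bs)))
      (match y.2 with
       | [::] => Skip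
       | [:: v] => rep v (lit bs)
       | v :: u :: _ => Seq (rep v (lit bs)) (rep u (lit bs))
       end).
Definition okx (y : expr) := vt \notin y.2.

Lemma nseq_flat a b (bs : seq bool) :
  flatten (nseq (a + b) bs) = flatten (nseq a bs) ++ flatten (nseq b bs).
Proof. by rewrite nseqD flatten_cat. Qed.

Lemma emits_crep y bs e : envok e -> okx y -> emits (crep y bs) e (flatten (nseq (evx e y) bs)).
Proof.
move=> he; case: y => c [|v [|u s]] hy; rewrite /okx in hy.
- have := emits_seq (@emits_lit (flatten (nseq c bs)) e) (emits_skip e).
  by rewrite cats0.
- rewrite inE eq_sym in hy.
  by rewrite nseq_flat; apply: emits_seq (emits_lit _ _) (emits_rep _ he hy).
- rewrite !inE !negb_or !(eq_sym vt) in hy; case/and3P: hy => hv hu _.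
  rewrite !nseq_flat; apply: emits_seq (emits_lit _ _) (emits_seq _ _); exact: emits_rep.
Qed.

Definition cnum (y : expr) := Seq (crep y [:: true]) (Emit false).

Lemma emits_cnum y e : envok e -> okx y -> emits (cnum y) e (bits_of_nats [:: evx e y]).
Proof.
move=> he hy; rewrite /bits_of_nats /= cats0 /unary_nat; apply: emits_seq; last first.
  by move=> o; rewrite /= cats1.
apply: emits_eq (emits_crep [:: true] he hy).
by elim: (evx e y) => //= m ->.
Qed.

Lemma flat_nseq_bits m s : flatten (nseq m (bits_of_nats s)) = bits_of_nats (flatten (nseq m s)).
Proof. by elim: m => //= m ->; rewrite bits_cat. Qed.

Lemma enc_iter c t : enc_term (iter c succt t) = flatten (nseq c [:: 1; 0; 1]) ++ enc_term t.
Proof. by elim: c => //= c ->; rewrite cats0. Qed.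

(** In prefix notation a chain is a repetition of [[:: 1; 0; 1]], the code of the symbol of [succt]
    with its single argument to follow; [[:: 1; 1; 0]] is the code of [App 1 [::]]. *)
Definition carg (a : sarg) :=
  match a with
  | SV i c => Seq (crep c (bits_of_nats [:: 1; 0; 1])) (Seq (lit (bits_of_nats [:: 0])) (cnum i))
  | SC c => Seq (crep c (bits_of_nats [:: 1; 0; 1])) (lit (bits_of_nats [:: 1; 1; 0]))
  end.
Definition oka (a : sarg) := match a with SV i c => okx i && okx c | SC c => okx c end.

Lemma emits_carg a e : envok e -> oka a ->
  emits (carg a) e (bits_of_nats (enc_term (argt (ev_sarg e a)))).
Proof.
move=> he; case: a => [i c /andP[h1 h2]|c h1] /=.
  rewrite enc_iter bits_cat -flat_nseq_bits -[enc_term _]/([:: 0] ++ [:: evx e i]) bits_cat.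
  apply: emits_seq; first exact: emits_crep.
  by apply: emits_seq; [exact: emits_lit|exact: emits_cnum].
rewrite /chain enc_iter bits_cat -flat_nseq_bits.
by apply: emits_seq; [exact: emits_crep|exact: emits_lit].
Qed.

Definition ckeep := Seq (carg (SV (15, [:: vs; vs]) (0, [::]))) (carg (SV (16, [:: vs; vs]) (0, [::]))).
Definition czero := Seq (carg zer) (carg zer).
Definition cslot (m : vmode) :=
  match m with
  | VKeep => ckeep
  | VZero => czero
  | VFwd => IfLt vs vj czero (IfLt vj vs ckeep
      (Seq (carg (SV (rX, [::]) (1, [::]))) (carg (SV (16, [:: vs; vs]) (1, [::])))))
  | VRev => IfLt vs vj czero (IfLt vj vs ckeep
      (Seq (carg zer) (carg (SV (16, [:: vs; vs]) (1, [::])))))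
  end.

Lemma emits_cslot m e : envok e ->
  emits (cslot m) e (bits_of_nats (enc_term (argt (slot m (e vj) (e vs)).1) ++
                                   enc_term (argt (slot m (e vj) (e vs)).2))).
Proof.
move=> he; rewrite bits_cat; have hk : emits ckeep e (bits_of_nats (enc_term (argt (slot VKeep (e vj) (e vs)).1)) ++ bits_of_nats (enc_term (argt (slot VKeep (e vj) (e vs)).2))).
  by apply: emits_seq; apply: emits_carg.
have hz : emits czero e (bits_of_nats (enc_term (argt (slot VZero (e vj) (e vs)).1)) ++ bits_of_nats (enc_term (argt (slot VZero (e vj) (e vs)).2))).
  by apply: emits_seq; apply: emits_carg.
case: m => //; rewrite /slot [cslot _]/cslot.
- case: ltnP => h1; first exact: emits_lt_true.
  apply: emits_lt_false => //; case: ltnP => h2; first exact: emits_lt_true.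
  apply: emits_lt_false => //.
  by apply: emits_seq; exact: (@emits_carg (SV _ _)).
- case: ltnP => h1; first exact: emits_lt_true.
  apply: emits_lt_false => //; case: ltnP => h2; first exact: emits_lt_true.
  apply: emits_lt_false => //.
  by apply: emits_seq; [exact: (@emits_carg (SC _))|exact: (@emits_carg (SV _ _))].
Qed.

Definition ctgt k (t : starget) :=
  Seq (lit (bits_of_nats [:: 1; nt (s_node t) k]))
  (Seq (cnum (16, [:: vn; vn]))
  (Seq (sq (map carg (s_fix t)))
  (Seq (For vs (IfLt vs vn (cslot (s_mode t)) Skip)) (carg (s_last t))))).
Definition okt (t : starget) := [&& size (s_fix t) == 15, all oka (s_fix t) & oka (s_last t)].

Lemma In_all (T : Type) (p : pred T) s y : all p s -> In_list y s -> p y.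
Proof. by elim: s => //= y' s IH /andP[h1 h2] [<-|] //; exact: IH. Qed.

Lemma emits_ctgt k t e : envok e -> e vs = 0 -> okt t ->
  emits (ctgt k t) e (bits_of_nats (enc_term (ttgt k (ev_tgt e t)))).
Proof.
move=> he hvs /and3P[/eqP hs h1 h2]; rewrite /ttgt.
have -> : forall A Us, enc_term (App A Us) = [:: 1; A] ++ ([:: size Us] ++ flatten (map enc_term Us)) by [].
rewrite !bits_cat size_map (@size_ev_tgt (e vn) [::]) //.
apply: emits_seq; first exact: emits_lit.
apply: emits_seq; first exact: (emits_cnum (y := (16, [:: vn; vn]))).
rewrite /= !map_cat flatten_cat bits_cat; apply: emits_seq.
  rewrite -!map_comp bits_flatten -map_comp; apply: emits_sq => a ha.
  by apply: emits_carg => //; exact: In_all h1 ha.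
rewrite flatten_cat bits_cat; apply: emits_seq; last first.
  by rewrite /= cats0; exact: emits_carg.
have := @emits_forlt vs vn (cslot (s_mode t)) e (fun j => bits_of_nats
   (enc_term (argt (slot (s_mode t) (e vj) j).1) ++ enc_term (argt (slot (s_mode t) (e vj) j).2)))
   hvs isT (he.2 _).
have e1 : forall f : nat -> arg * arg, flatten (map enc_term (map argt (flatten [seq [:: (f j).1; (f j).2] | j <- iota 0 (e vn)]))) =
   flatten [seq enc_term (argt (f j).1) ++ enc_term (argt (f j).2) | j <- iota 0 (e vn)].
  by move=> f; elim: (iota _ _) => //= j r ->; rewrite catA.
rewrite (e1 (slot (s_mode t) (e vj))) bits_flatten -map_comp; apply=> j hj.
have hj2 : j <= N by apply: ltnW (leq_trans hj (he.2 _)).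
have := emits_cslot (s_mode t) (envok_upd he (v := vs) isT hj2).
by rewrite upd_eq upd_ne.
Qed.

End Emits.

Inductive sterm := STg of nat & starget | STr of seq sarg | STz.
Definition srule := (nat * expr * sterm)%type.

Definition ev_sterm e (V : sterm) : term :=
  match V with
  | STg kk t => ttgt kk (ev_tgt e t)
  | STr s => App 2 (map argt (map (ev_sarg e) s))
  | STz => App 1 [::]
  end.
Definition ev_srule e (ru : srule) : nat * nat * term :=
  (ru.1.1, evx e ru.1.2, ev_sterm e ru.2).

Definition srules_of (p : nat * sitem) : seq srule :=
  let A := p.1 in
  let I := keep A [::] in
  let c0 : expr := (0, [::]) in
  let c1 : expr := (1, [::]) in
  match p.2 with
  | SOpt a t => [:: (nt A 0, a, STg 0 t); (nt A 1, a, STg 1 t)]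
  | SDef t1 t2 =>
      [:: (nt A 0, c0, STg 2 I); (nt A 0, c0, STg 3 I); (nt A 0, c0, STg 4 I);
          (nt A 1, c0, STg 3 I); (nt A 1, c0, STg 4 I);
          (nt A 2, c0, STg 0 t1); (nt A 2, c1, STg 0 t2);
          (nt A 3, c0, STg 1 t1); (nt A 3, c1, STg 0 t2);
          (nt A 4, c0, STg 0 t1); (nt A 4, c1, STg 1 t2)]
  | SMemS s => [:: (nt A 0, c0, STr s)]
  | SMemT s => [:: (nt A 0, c0, STr s); (nt A 1, c0, STr s)]
  | SWin => [:: (nt A 0, c0, STz)]
  end.

(** Lets the inner moves of the gadget, which pass all registers on, be printed by the same routine
    as every other target. *)
Lemma ev_keep_id e A : (ev_tgt e (keep A [::])).2 = idargs (gD (e vn)).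
Proof.
rewrite /gD /idargs (_ : 16 + (e vn + e vn) = 15 + (e vn + e vn + 1)); last lia.
rewrite (iotaD 0 15) (iotaD _ (e vn + e vn) 1) !map_cat [LHS]/=.
congr (_ :: _); do 14!congr (_ :: _); congr (_ ++ _).
suff H m b : flatten [seq [:: AV (15 + (j + j)) 0; AV (16 + (j + j)) 0] | j <- iota b m] =
   [seq AV i 0 | i <- iota (15 + (b + b)) (m + m)] by exact: (H (e vn) 0).
elim: m b => // m IH b; rewrite (_ : m.+1 + m.+1 = (m + m).+2); last lia.
rewrite [iota b _]/= [map _ (b :: _)]/= [flatten (_ :: _)]/= IH.
by rewrite (_ : 15 + (b.+1 + b.+1) = (15 + (b + b)).+2) //; lia.
Qed.

Lemma srules_ofE e p : map (ev_srule e) (srules_of p) = rules_of (gD (e vn)) (ev_item e p).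
Proof.
case: p => A [a t|t1 t2|s|s|] //.
have e1 : ev_tgt e (keep A [::]) = (A, idargs (gD (e vn))) by rewrite -(ev_keep_id e A).
by rewrite /rules_of /= -e1.
Qed.

Definition enc_rule (ru : nat * nat * term) := let '(A, a, V) := ru in [:: A; a] ++ enc_term V.

Definition csterm (V : sterm) : cmd :=
  match V with
  | STg kk t => ctgt kk t
  | STr s => Seq (lit (bits_of_nats [:: 1; 2; size s])) (sq (map carg s))
  | STz => lit (bits_of_nats [:: 1; 1; 0])
  end.
Definition oksterm (V : sterm) :=
  match V with STg kk t => okt t | STr s => all oka s | STz => true end.
Definition crule (ru : srule) : cmd :=
  Seq (lit (bits_of_nats [:: ru.1.1])) (Seq (cnum ru.1.2) (csterm ru.2)).
Definition okrule (ru : srule) := okx ru.1.2 && oksterm ru.2.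
Definition citems (its : seq (nat * sitem)) := sq (map crule (flatten (map srules_of its))).
Definition okitems its := all okrule (flatten (map srules_of its)).

Definition rule_bits D its := bits_of_nats (flatten (map enc_rule (flatten (map (rules_of D) its)))).

Lemma rule_bits_cat D s s' : rule_bits D (s ++ s') = rule_bits D s ++ rule_bits D s'.
Proof. by rewrite /rule_bits !(map_cat, flatten_cat) bits_cat. Qed.

Lemma rule_bits_flatten D ss : rule_bits D (flatten ss) = flatten (map (rule_bits D) ss).
Proof. by elim: ss => //= s ss IH; rewrite rule_bits_cat IH. Qed.

Section Emit2.
Variable x : seq bool.
Let N := size x.
Notation emits := (emits x).
Notation envok := (envok x).

Lemma emits_csterm V e : envok e -> e vs = 0 -> oksterm V ->
  emits (csterm V) e (bits_of_nats (enc_term (ev_sterm e V))).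
Proof.
move=> he hvs; case: V => [kk t|s|] h; [exact: emits_ctgt| |exact: emits_lit].
rewrite [ev_sterm _ _]/= -map_comp.
rewrite (_ : enc_term _ = [:: 1; 2; size s] ++ flatten [seq enc_term (argt (ev_sarg e a)) | a <- s]); last first.
  by rewrite /= size_map -map_comp.
rewrite bits_cat; apply: emits_seq; first exact: emits_lit.
rewrite bits_flatten -map_comp; apply: emits_sq => a ha.
by apply: emits_carg => //; exact: In_all h ha.
Qed.

Lemma emits_crule ru e : envok e -> e vs = 0 -> okrule ru ->
  emits (crule ru) e (bits_of_nats (enc_rule (ev_srule e ru))).
Proof.
move=> he hvs /andP[h1 h2]; case: ru h1 h2 => [[A a] V] h1 h2.
rewrite -[enc_rule _]/([:: A] ++ ([:: evx e a] ++ enc_term (ev_sterm e V))) !bits_cat.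
apply: emits_seq; first exact: emits_lit.
by apply: emits_seq; [exact: emits_cnum|exact: emits_csterm].
Qed.

Lemma emits_citems its e : envok e -> e vs = 0 -> okitems its ->
  emits (citems its) e (rule_bits (gD (e vn)) (map (ev_item e) its)).
Proof.
move=> he hvs hok; rewrite /rule_bits.
have -> : flatten (map (rules_of (gD (e vn))) (map (ev_item e) its)) =
   map (ev_srule e) (flatten (map srules_of its)).
  by elim: its {hok} => //= p its ->; rewrite map_cat srules_ofE.
rewrite bits_flatten -!map_comp; apply: emits_sq => ru hru.
by apply: emits_crule => //; exact: In_all hok hru.
Qed.

End Emit2.

(** A printing state is only required to agree with [genv] on the variables on which an item
    depends. *)
Definition arg_vars (a : sarg) := match a with SV i c => i.2 ++ c.2 | SC c => c.2 end.
Definition tgt_vars (t : starget) :=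
  [:: vn; vj] ++ flatten (map arg_vars (s_fix t)) ++ arg_vars (s_last t).
Definition item_vars (p : nat * sitem) :=
  match p.2 with
  | SOpt a t => a.2 ++ tgt_vars t
  | SDef t1 t2 => tgt_vars t1 ++ tgt_vars t2
  | SMemS s | SMemT s => flatten (map arg_vars s)
  | SWin => [::]
  end.

Lemma evx_ext e e' y : {in y.2, e =1 e'} -> evx e y = evx e' y.
Proof.
case: y => c [|v [|u s]] //= h; first by rewrite h ?inE.
by rewrite !h // !inE eqxx ?orbT.
Qed.

Lemma ev_sarg_ext e e' a : {in arg_vars a, e =1 e'} -> ev_sarg e a = ev_sarg e' a.
Proof.
case: a => [i c|c] h /=; last by rewrite (evx_ext h).
by congr AV; apply: evx_ext => v hv; apply: h; rewrite /= mem_cat hv ?orbT.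
Qed.

Lemma ev_sargs_ext e e' s : {in flatten (map arg_vars s), e =1 e'} ->
  map (ev_sarg e) s = map (ev_sarg e') s.
Proof.
elim: s => //= a s IH h; rewrite IH ?(@ev_sarg_ext e e') // => v hv; apply: h;
 by rewrite mem_cat hv ?orbT.
Qed.

Lemma ev_tgt_ext e e' t : {in tgt_vars t, e =1 e'} -> ev_tgt e t = ev_tgt e' t.
Proof.
move=> h; rewrite /ev_tgt (@ev_sargs_ext e e').
  rewrite (@ev_sarg_ext e e') => [|v hv]; last by apply: h; rewrite !mem_cat hv !orbT.
  by rewrite !h // !inE eqxx ?orbT.
by move=> v hv; apply: h; rewrite !mem_cat hv !orbT.
Qed.

Lemma ev_item_ext e e' p : {in item_vars p, e =1 e'} -> ev_item e p = ev_item e' p.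
Proof.
case: p => A [a t|t1 t2|s|s|] // h; congr pair.
- have {}h : {in a.2 ++ tgt_vars t, e =1 e'} := h.
  by congr IOpt; [apply: evx_ext|apply: ev_tgt_ext] => v hv; apply: h; rewrite mem_cat hv ?orbT.
- have {}h : {in tgt_vars t1 ++ tgt_vars t2, e =1 e'} := h.
  by congr IDef; apply: ev_tgt_ext => v hv; apply: h; rewrite mem_cat hv ?orbT.
- by congr IMemS; apply: ev_sargs_ext.
- by congr IMemT; apply: ev_sargs_ext.
Qed.

Lemma ev_items_ext (vv : seq nat) e e' its : {in vv, e =1 e'} ->
  all (fun p => all (mem vv) (item_vars p)) its -> map (ev_item e) its = map (ev_item e') its.
Proof.
move=> h; elim: its => //= p its IH /andP[/allP h1 h2]; rewrite IH // (@ev_item_ext e e') //.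
by move=> v hv; apply: h; exact: h1.
Qed.

(** Symbolic form of the initial position [rho0]. *)
Definition t0 := STgt nC [:: zer; zer; SC (0, [:: vn]); zer; zer; zer; zer; zer; zer; zer; zer; zer; zer; zer; zer] VZero (cst 1).

Definition rcount (p : nat * sitem) := size (srules_of p).
(** The 35 nodes own 175 nonterminals of arity [gD n]; with the three basic ones, of arities 1, 0
    and 3, this makes 178. *)
Definition cheader :=
  Seq (lit (bits_of_nats [:: 178; 1; 0; 3])) (sq (map cnum (nseq 175 (16, [:: vn; vn])))).
(** The number of rules precedes the rules and may exceed what a counter holds, so it is printed in
    unary by loops of the same shape as those that print the rules: 4 for each [j], 6 for each [k],
    and for each table entry 2 plus another 2 for each [k]. *)
Definition ccount :=
  sq [:: lit (nseq (4 + sumn (map rcount fixed_items)) true);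
         For vj (IfLt vj vn (lit (nseq 4 true)) Skip);
         For vk (lit (nseq 6 true));
         For ve (IfLt ve vne (Seq (lit (nseq 2 true)) (For vk (lit (nseq 2 true)))) Skip);
         Emit false].
Definition cfam :=
  sq [:: lit (bits_of_nats (flatten (map enc_rule base_rules)));
         citems fixed_items;
         For vj (IfLt vj vn (citems vec_items) Skip);
         For vk (citems val_items)].
Definition cent := Seq (citems [:: pick_item]) (For vk (citems [:: sh_item])).
Definition cterms := Seq (ctgt 0 t0) (ctgt 1 t0).

Lemma flatten_nseq_const (T : Type) m (s : seq T) b : flatten [seq s | _ <- iota b m] = flatten (nseq m s).
Proof. by elim: m b => //= m IH b; rewrite IH. Qed.

Lemma flatten_nseq_true a b : flatten (nseq a (nseq b true)) = nseq (a * b) true.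
Proof. by elim: a => //= a ->; rewrite mulSn nseqD. Qed.

Lemma bits1 a : bits_of_nats [:: a] = nseq a true ++ [:: false].
Proof. by rewrite /bits_of_nats /= cats0. Qed.

Section Out.
Variables (x : seq bool) (n l : nat) (ents : seq entry).
Let N := size x.
Let ne := size ents.
Let sp := gspec n l N ents.
Let G := game_grammar (gD n) NN sp.
Notation emits := (emits x).

Definition genok e := [/\ envok x e, e vn = n, e vl = l, e vne = ne &
  [/\ e vj = 0, e vk = 0, e vs = 0 & e ve = 0]].

Lemma rcountE D e its : size (flatten (map (rules_of D) (map (ev_item e) its))) = sumn (map rcount its).
Proof. by elim: its => //= -[A [a t|t1 t2|s|s|]] its IH; rewrite /= IH. Qed.

Lemma emits_header e : genok e ->
  emits cheader e (bits_of_nats (size (g_arity G) :: g_arity G)).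
Proof.
case=> he en _ _ _.
have -> : size (g_arity G) :: g_arity G = [:: 178; 1; 0; 3] ++ nseq 175 (gD n).
  by [].
rewrite bits_cat; apply: emits_seq; first exact: emits_lit.
have -> : bits_of_nats (nseq 175 (gD n)) = flatten (map (fun y => bits_of_nats [:: evx e y]) (nseq 175 (16, [:: vn; vn]))).
  move: 175 => m; elim: m => //= m <-.
  by rewrite -[_ :: nseq _ _]/([:: gD n] ++ nseq m (gD n)) bits_cat en.
apply: emits_sq => y hy; apply: emits_cnum => //.
by move: hy; move: 175; elim=> //= m IH [<-|].
Qed.

Lemma emits_count e : genok e -> emits ccount e (bits_of_nats [:: size (g_rules G)]).
Proof.
case=> he en el ene [ej ek es ee].
have hb v : e v <= N by case: he.
have -> : size (g_rules G) = 4 + sumn (map rcount fixed_items) + n * 4 + N * 6 + ne * (2 + N * 2).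
  have -> : size (g_rules G) = 4 + size (flatten (map (rules_of (gD n)) sp)) by [].
  rewrite /sp /gspec map_cat flatten_cat size_cat rcountE.
  rewrite map_cat flatten_cat size_cat map_cat flatten_cat size_cat.
  have fam D its m (f : nat -> nat -> nat) b : size (flatten (map (rules_of D) (flatten [seq map (ev_item (f j)) its | j <- iota b m]))) = m * sumn (map rcount its).
    by elim: m b => //= m IH b; rewrite map_cat flatten_cat size_cat IH rcountE mulSn.
  rewrite (fam _ _ n (fun j => genv n l ne j 0 dent 0)) (fam _ _ N (fun j => genv n l ne 0 j dent 0)).
  have ent D m b : size (flatten (map (rules_of D) (flatten [seq ent_spec n l N ents i | i <- iota b m]))) = m * (2 + N * 2).
    elim: m b => // m IH b; rewrite [iota _ _]/= [map _ (_ :: _)]/= [flatten (_ :: _)]/= -cat_cons map_cat flatten_cat size_cat IH mulSn; congr (_ + _).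
    rewrite /= ; congr _.+2.
    suff H c r i : size (flatten [seq rules_of D i0 | i0 <- [seq ev_item (genv n l (size ents) 0 kk (nth dent ents i) i) sh_item | kk <- iota c r]]) = r * 2 by exact: H.
    by elim: r c => //= r IHr c; rewrite IHr.
  by rewrite (ent _ ne 0) -[sumn (map rcount vec_items)]/4 -[sumn (map rcount val_items)]/6 !addnA.
rewrite bits1; have cat4 a b c d : nseq (a + b + c + d) true ++ [:: false] =
    nseq a true ++ (nseq b true ++ (nseq c true ++ (nseq d true ++ [:: false]))).
  by rewrite !nseqD -!catA.
rewrite cat4 /ccount.
apply: emits_seq; first exact: emits_lit.
have tl a b : flatten [seq nseq a true | _ <- iota 0 b] = nseq (b * a) true.
  by rewrite flatten_nseq_const flatten_nseq_true.
apply: emits_seq.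
  have := @emits_forlt x vj vn (lit (nseq 4 true)) e (fun=> nseq 4 true) ej isT (hb _) (fun j _ => emits_lit x _ _).
  by rewrite en tl.
apply: emits_seq.
  have := @emits_for x vk (lit (nseq 6 true)) e (fun=> nseq 6 true) ek (fun j _ => emits_lit x _ _).
  by rewrite tl.
apply: emits_seq; last by rewrite -[X in emits _ _ X]cats0; apply: emits_seq; [move=> o; rewrite /= cats1|exact: emits_skip].
have := @emits_forlt x ve vne (Seq (lit (nseq 2 true)) (For vk (lit (nseq 2 true)))) e (fun=> nseq (2 + N * 2) true) ee isT (hb _).
rewrite ene tl; apply=> j hj; rewrite nseqD; apply: emits_seq; first exact: emits_lit.
have := @emits_for x vk (lit (nseq 2 true)) (upd e ve j) (fun=> nseq 2 true) _ (fun j _ => emits_lit x _ _).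
by rewrite tl; apply; rewrite upd_ne.
Qed.

Lemma ext_genv e e' its (vv : seq nat) : {in vv, e =1 e'} ->
  all (fun p => all (mem vv) (item_vars p)) its ->
  rule_bits (gD n) (map (ev_item e) its) = rule_bits (gD n) (map (ev_item e') its).
Proof. by move=> h1 h2; rewrite (ev_items_ext h1 h2). Qed.

Definition fam_spec : spec := map (ev_item (genv n l ne 0 0 dent 0)) fixed_items ++
  (flatten [seq map (ev_item (genv n l ne j 0 dent 0)) vec_items | j <- iota 0 n] ++
  flatten [seq map (ev_item (genv n l ne 0 kk dent 0)) val_items | kk <- iota 0 N]).

Lemma emits_fam e : genok e -> emits cfam e
  (bits_of_nats (flatten (map enc_rule base_rules)) ++ rule_bits (gD n) fam_spec).
Proof.
move=> hg; case: (hg) => he en el ene [ej ek es ee].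
have hb v : e v <= N by case: he.
apply: emits_seq; first exact: emits_lit.
rewrite /fam_spec !rule_bits_cat; apply: emits_seq.
  rewrite (@ext_genv _ e _ [:: vn; vl; vne; vj]) //.
    by rewrite -en; apply: emits_citems.
  by move=> v; rewrite !inE => /or4P[] /eqP -> /=; rewrite ?en ?el ?ene ?ej.
apply: emits_seq.
  rewrite rule_bits_flatten -map_comp.
  have := @emits_forlt x vj vn (citems vec_items) e (fun j => rule_bits (gD n)
    (map (ev_item (genv n l ne j 0 dent 0)) vec_items)) ej isT (hb _).
  rewrite en; apply=> j hj; have hj2 : j <= N by apply: ltnW (leq_trans hj _); rewrite -en.
  rewrite (@ext_genv _ (upd e vj j) _ [:: vn; vl; vne; vj]) //.
    rewrite -{1}en -[e vn](@upd_ne e vj j) //; apply: emits_citems => //; exact: envok_upd.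
  by move=> v; rewrite !inE => /or4P[] /eqP ->; rewrite ?upd_eq ?upd_ne //= ?en ?el ?ene.
rewrite -[X in emits _ _ X]cats0; apply: emits_seq; last exact: emits_skip.
rewrite rule_bits_flatten -map_comp; apply: emits_for => // j hj.
rewrite (@ext_genv _ (upd e vk j) _ [:: vn; vl; vne; vj; vk]) //.
  rewrite -{1}en -[e vn](@upd_ne e vk j) //; apply: emits_citems => //.
  by apply: envok_upd => //; exact: ltnW.
by move=> v; rewrite !inE => /orP[|/or4P[]] /eqP ->; rewrite ?upd_eq ?upd_ne //= ?en ?el ?ene ?ej.
Qed.

Lemma emits_ent e i : envok x e -> e vs = 0 -> e vk = 0 -> e vj = 0 -> e vn = n -> e vl = l -> e vne = ne ->
  (let '(q0, a0, q1, b, d) := nth dent ents i in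
    [/\ e vq0 = q0, e va0 = a0, e vq1 = q1, e vb = b &
     [/\ e vdl = isL d, e vdr = isR d, e vds = isS d & e vidx = i]]) ->
  emits cent e (rule_bits (gD n) (ent_spec n l N ents i)).
Proof.
move=> he es ek ej en el ene hi.
have hge kk v : v \in [:: vn; vl; vne; vj; vq0; va0; vq1; vb; vdl; vdr; vds; vidx] ->
   genv n l ne 0 kk (nth dent ents i) i v = e v.
  move: hi; rewrite /genv; case: (nth _ _ _) => [[[[q0 a0] q1] b] d] [h1 h2 h3 h4 [h5 h6 h7 h8]].
  by rewrite !inE => /orP[/eqP ->|/orP[/eqP ->|/orP[/eqP ->|/orP[/eqP ->|/orP[/eqP ->|/orP[/eqP ->|/orP[/eqP ->|
    /orP[/eqP ->|/orP[/eqP ->|/orP[/eqP ->|/orP[/eqP ->|/eqP ->]]]]]]]]]]].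
rewrite /ent_spec -[_ :: _]/([:: ev_item (genv n l ne 0 0 (nth dent ents i) i) pick_item] ++ _) rule_bits_cat.
apply: emits_seq.
  rewrite -[[:: ev_item _ _]]/(map (ev_item (genv n l ne 0 0 (nth dent ents i) i)) [:: pick_item]).
  rewrite (@ext_genv _ e _ [:: vn; vl; vne; vj; vq0; va0; vq1; vb; vdl; vdr; vds; vidx]) //.
    by rewrite -en; apply: emits_citems.
  by move=> v; exact: hge.
rewrite (_ : [seq ev_item _ sh_item | kk <- iota 0 N] =
   flatten [seq map (ev_item (genv n l ne 0 kk (nth dent ents i) i)) [:: sh_item] | kk <- iota 0 N]); last first.
  by elim: (iota 0 N) => //= kk r ->.
rewrite rule_bits_flatten -map_comp; apply: emits_for => // j hj.
rewrite (@ext_genv _ (upd e vk j) _ [:: vn; vl; vne; vj; vq0; va0; vq1; vb; vdl; vdr; vds; vidx; vk]) //.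
  rewrite -{1}en -[e vn](@upd_ne e vk j) //; apply: emits_citems => //.
  by apply: envok_upd => //; exact: ltnW.
move=> v; rewrite -[[:: vn, _ & _]]/([:: vn; vl; vne; vj; vq0; va0; vq1; vb; vdl; vdr; vds; vidx] ++ [:: vk]) mem_cat.
case/orP => hv; last first.
  move: hv; rewrite inE => /eqP ->; rewrite upd_eq /genv.
  by case: (nth _ _ _) => [[[[q0 a0] q1] b] d].
rewrite upd_ne ?hge //; move: hv; apply: contraTneq => ->; by [].
Qed.

Lemma emits_terms e : envok x e -> e vs = 0 -> e vj = 0 -> e vn = n ->
  emits cterms e (bits_of_nats (enc_term (pos 0 nC (rho0 n)) ++ enc_term (pos 1 nC (rho0 n)))).
Proof.
move=> he es ej en; rewrite bits_cat.
have h kk : pos kk nC (rho0 n) = ttgt kk (ev_tgt e t0).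
  rewrite /pos /ttgt; congr App; rewrite /rho0 /ev_tgt /snd !map_cat.
  rewrite (_ : map chain [:: 1] = map argt [:: ev_sarg e (s_last t0)]) //.
  congr (_ ++ (_ ++ _)); first by rewrite /= en.
  suff H m b : [seq chain i | i <- nseq (m + m) 0] =
     [seq argt i | i <- flatten [seq [:: (slot VZero (e vj) j).1; (slot VZero (e vj) j).2] | j <- iota b m]].
    by rewrite (H n 0) en.
  by elim: m b => //= m IH b; rewrite -IH addnS.
by rewrite !h; apply: emits_seq; apply: emits_ctgt.
Qed.

End Out.

(** * Reading the instance *)

Definition vpw := 20. Definition vz := 21. Definition vgo := 22.

(** The pointer stops at the first 0 bit and the remaining rounds are idle; then this bit is
    skipped. Reading beyond the end gives 0 and raises [vbad]. *)
Definition rdf v :=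
  sq [:: Zero v; For vt (IfBit vp (Seq (Inc vp) (Inc v)) Skip Skip);
         IfBit vp Skip (Inc vp) (Inc vbad)].
Definition add v u := For vt (IfLt vt u (Inc v) Skip).

Lemma upd_nth s v a : upd (nth 0 s) v a = nth 0 (set_nth 0 s v a).
Proof. by apply: functional_extensionality => u; rewrite /upd nth_set_nth. Qed.

Lemma updC e (v u : nat) a b : v != u -> upd (upd e v a) u b = upd (upd e u b) v a.
Proof.
move=> h; apply: functional_extensionality => w; rewrite /upd.
by case: (w =P u) => // ->; rewrite eq_sym (negbTE h).
Qed.

Lemma flatten_nil_const (T : Type) (r : seq nat) : flatten [seq [::] | _ <- r] = [::] :> seq T.
Proof. by elim: r. Qed.

Section Runs.
Variable x : seq bool.
Let N := size x.

Definition runs c e e' w := forall o, exec x c (e, o) = (e', o ++ w).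

Lemma runs_skip e : runs Skip e e [::].
Proof. exact: emits_skip. Qed.

Lemma runs_seq c1 c2 e1 e2 e3 w1 w2 : runs c1 e1 e2 w1 -> runs c2 e2 e3 w2 ->
  runs (Seq c1 c2) e1 e3 (w1 ++ w2).
Proof. by move=> h1 h2 o; rewrite /= h1 h2 catA. Qed.

Lemma runs_seq0 c1 c2 e1 e2 e3 w : runs c1 e1 e2 [::] -> runs c2 e2 e3 w ->
  runs (Seq c1 c2) e1 e3 w.
Proof. exact: runs_seq. Qed.

Lemma runs_zero v e : runs (Zero v) e (upd e v 0) [::].
Proof. by move=> o; rewrite /= cats0. Qed.

Lemma runs_inc v e : e v < N -> runs (Inc v) e (upd e v (e v).+1) [::].
Proof. by move=> h o; rewrite /= cats0 (minn_idPl _). Qed.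

Lemma runs_incs v e : runs (Inc v) e (upd e v (minn (e v).+1 N)) [::].
Proof. by move=> o; rewrite /= cats0. Qed.

(** [E j] is the environment between rounds, with the loop variable taken as 0; round [j] runs in it
    with that variable set to [j]. *)
Lemma runs_for v c (E : nat -> nat -> nat) (f : nat -> seq bool) :
  (forall j, E j v = 0) ->
  (forall j, j < N -> runs c (upd (E j) v j) (upd (E j.+1) v j) (f j)) ->
  runs (For v c) (E 0) (E N) (flatten [seq f j | j <- iota 0 N]).
Proof.
move=> e0 h o.
have H r : forall b a o, b + r <= N ->
  foldl (fun s j => exec x c (upd s.1 v j, s.2)) (upd (E b) v a, o) (iota b r) =
  (upd (E (b + r)) v (if r is r'.+1 then b + r' else a), o ++ flatten [seq f j | j <- iota b r]).
  elim: r => [|r IH] b a o' hb; first by rewrite /= cats0 addn0.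
  rewrite /= upd_upd h; last lia.
  rewrite IH -?catA; last lia.
  by rewrite addSnnS; case: (r) => [|r'] //; rewrite ?addn0 ?addSnnS.
have := H N 0 (E 0 v) o (leqnn _); rewrite upd_same [exec _ _ _]/= -/N => ->.
by rewrite /= upd_upd -{2}(e0 N) upd_same.
Qed.

Lemma runs_forlt (v u : nat) c (E : nat -> nat -> nat) (f : nat -> seq bool) m : v != u -> m <= N ->
  (forall j, E j v = 0) -> (forall j, j <= m -> E j u = m) ->
  (forall j, j < m -> runs c (upd (E j) v j) (upd (E j.+1) v j) (f j)) ->
  runs (For v (IfLt v u c Skip)) (E 0) (E m) (flatten [seq f j | j <- iota 0 m]).
Proof.
move=> hvu hm e0 eu h.
have := @runs_for v (IfLt v u c Skip) (fun j => E (minn j m)) (fun j => if j < m then f j else [::]).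
rewrite min0n (minn_idPr hm) => H.
have -> : flatten [seq f j | j <- iota 0 m] = flatten [seq if j < m then f j else [::] | j <- iota 0 N].
  rewrite -(subnKC hm) iotaD map_cat flatten_cat add0n.
  rewrite [X in _ ++ X](_ : _ = [::]) ?cats0.
    by congr flatten; apply/eq_in_map => j; rewrite mem_iota add0n => /andP[_ ->].
  have K r : forall b, m <= b -> flatten [seq if j < m then f j else [::] | j <- iota b r] = [::].
    by elim: r => //= r IH b hb; rewrite ltnNge hb /= IH // ltnW.
  exact: K.
apply: H => [//|j hj o].
rewrite [exec _ _ _]/= upd_eq upd_ne 1?eq_sym // eu ?geq_minr //; case: ltnP => hjm.
  by rewrite h // (minn_idPl (hjm : j.+1 <= m)).
by rewrite cats0 (minn_idPr (leqW hjm)).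
Qed.

Lemma runs_add (v u : nat) e : v != vt -> u != vt -> v != u -> e vt = 0 -> e v + e u <= N ->
  runs (add v u) e (upd e v (e v + e u)) [::].
Proof.
move=> h1 h2 h3 h4 hN.
have := @runs_forlt vt u (Inc v) (fun j => upd e v (e v + j)) (fun=> [::]) (e u).
rewrite addn0 upd_same flatten_nil_const.
apply; rewrite 1?eq_sym //; first lia.
- by move=> j; rewrite upd_ne // eq_sym.
- by move=> j _; rewrite upd_ne // eq_sym.
- move=> j hj; have := @runs_inc v (upd (upd e v (e v + j)) vt j).
  rewrite upd_ne // upd_eq => H; rewrite addnS.
  have -> : upd (upd e v (e v + j).+1) vt j = upd (upd (upd e v (e v + j)) vt j) v (e v + j).+1.
    by rewrite [RHS]updC 1?eq_sym // upd_upd.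
  by apply: H; lia.
Qed.

End Runs.

Lemma size_bits r : size (bits_of_nats r) = sumn r + size r.
Proof. by elim: r => //= a r IH; rewrite /bits_of_nats /= size_cat -/(bits_of_nats r) IH size_cat size_nseq /=; lia. Qed.

Section Read.
Variable s : seq nat.
Let x := bits_of_nats s.
Let N := size x.
Notation runs := (runs x).
Definition off i := size (bits_of_nats (take i s)).

Lemma off_end i : size s <= i -> off i = N.
Proof. by move=> h; rewrite /off take_oversize. Qed.

Lemma off_in i : i < size s ->
  [/\ off i.+1 = off i + (nth 0 s i).+1, off i.+1 <= N,
      forall j, j < nth 0 s i -> nth false x (off i + j) & nth false x (off i + nth 0 s i) = false].
Proof.
move=> hi; have e1 : x = bits_of_nats (take i s) ++ unary_nat (nth 0 s i) ++ bits_of_nats (drop i.+1 s).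
  by rewrite -[x]/(bits_of_nats s) -{1}(cat_take_drop i s) (drop_nth 0) // bits_cat.
have e2 : off i.+1 = off i + (nth 0 s i).+1.
  by rewrite /off (take_nth 0) // -cats1 bits_cat size_cat (size_bits [:: _]) /=; lia.
have hx : nth false x =1 nth false (bits_of_nats (take i s) ++ unary_nat (nth 0 s i) ++ bits_of_nats (drop i.+1 s)).
  by move=> j; rewrite -e1.
split=> //.
- rewrite e2 /N e1 !size_cat -/(off i) size_nseq /=; lia.
- move=> j hj; rewrite hx nth_cat -/(off i) ltnNge leq_addr /= addKn /unary_nat nth_cat size_cat size_nseq /=.
  by rewrite nth_cat size_nseq ltn_addr ?hj ?nth_nseq ?hj //.
- rewrite hx nth_cat -/(off i) ltnNge leq_addr /= addKn /unary_nat nth_cat size_cat size_nseq /= addn1 leqnn.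
  by rewrite nth_cat size_nseq ltnn subnn.
Qed.

(* Ill-formed items of the input are counted, up to saturation. *)
Definition badf i bad := if i < size s then bad else minn bad.+1 N.

Lemma runs_rdf (v : nat) i e : v \notin [:: vp; vt; vbad] -> e vt = 0 -> e vp = off i -> 
  runs (rdf v) e (upd (upd (upd e vp (off i.+1)) v (nth 0 s i)) vbad (badf i (e vbad))) [::].
Proof.
rewrite !inE !negb_or => /and3P[h1 h2 h3] e1 e2.
have k1 : vp != v by rewrite eq_sym.
have k3 : vbad != v by rewrite eq_sym.
set a := nth 0 s i.
(* After [j] rounds, [minn j a] ones have been read; [size x] rounds suffice because the number is
   contained in the input. *)
have hloop : runs (For vt (IfBit vp (Seq (Inc vp) (Inc v)) Skip Skip)) (upd e v 0)
    (upd (upd e vp (off i + a)) v a) [::].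
  have := @runs_for x vt (IfBit vp (Seq (Inc vp) (Inc v)) Skip Skip)
    (fun j => upd (upd e vp (off i + minn j a)) v (minn j a)) (fun=> [::]).
  rewrite min0n addn0 -e2 upd_same flatten_nil_const.
  have -> : minn (size x) a = a.
    apply/minn_idPr; rewrite /a; case: (ltnP i (size s)) => hi; last by rewrite nth_default.
    by have [q1 q2 _ _] := off_in hi; rewrite -/N; lia.
  apply=> [j|j hj o]; first by rewrite !upd_ne // eq_sym.
  rewrite e2; set e3 := upd _ vt j.
  have p1 : e3 vp = off i + minn j a by rewrite /e3 upd_ne // upd_ne // upd_eq.
  have p2 : e3 v = minn j a by rewrite /e3 upd_ne // upd_eq.
  have p3 : (upd e3 vp (minn (e3 vp).+1 (size x))) v = minn j a by rewrite upd_ne ?p2.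
  rewrite [exec _ _ _]/= p3 p1 cats0; case: (ltnP i (size s)) => hi; last first.
    have a0 : a = 0 by rewrite /a nth_default.
    by rewrite /e3 off_end // a0 !minn0 addn0 ltnn.
  have [q1 q2 q3 q4] := off_in hi.
  have hN : off i + minn j a < size x by rewrite -/N; lia.
  rewrite hN; clear p1 p2 p3; rewrite /e3 {e3}; case: (ltnP j a) => hja.
    rewrite q3 // (minn_idPl (hja : j.+1 <= a)).
    congr pair; rewrite !(minn_idPl _) -/N; try by lia.
    rewrite addnS; apply: functional_extensionality => u; rewrite /upd.
    by case: (u =P v) => [->|_]; [rewrite (negbTE h2)|case: (u =P vp) => // ->].
  by rewrite q4 (minn_idPr (leqW hja)).
apply: runs_seq0; first exact: runs_zero.
apply: runs_seq0; first exact: hloop.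
apply: (@runs_seq0 _ _ _ _ (upd (upd (upd e vp (off i.+1)) v a) vbad (badf i (e vbad)))); last exact: runs_skip.
set e4 := upd _ v a.
have p1 : e4 vp = off i + a by rewrite /e4 upd_ne // upd_eq.
have p2 : e4 vbad = e vbad by rewrite /e4 !upd_ne.
move=> o; rewrite [exec _ _ _]/= p1 p2 cats0 /badf; case: (ltnP i (size s)) => hi.
  have [q1 q2 q3 q4] := off_in hi.
  have hN : off i + a < size x by rewrite -/N /a; lia.
  have -> : (minn (off i + a).+1 (size x)) = off i.+1 by rewrite q1 -/a addnS (minn_idPl hN).
  rewrite hN q4; congr pair; apply: functional_extensionality => u; rewrite /e4 /upd.
  case: (u =P vbad) => [->|_]; first by rewrite (negbTE k3).
  by case: (u =P vp) => [->|//]; rewrite (negbTE k1).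
have a0 : a = 0 by rewrite /a nth_default.
rewrite /e4 a0 addn0 off_end // off_end ?ltnn //; exact: leqW.
Qed.

Lemma runs_rdf_in (v : nat) i e : v \notin [:: vp; vt; vbad] -> e vt = 0 -> e vp = off i -> i < size s ->
  runs (rdf v) e (upd (upd e vp (off i.+1)) v (nth 0 s i)) [::].
Proof.
move=> h1 h2 h3 h4; have := runs_rdf h1 h2 h3; rewrite /badf h4.
have -> : e vbad = upd (upd e vp (off i.+1)) v (nth 0 s i) vbad; last by rewrite upd_same.
by rewrite !upd_ne //; move: h1; rewrite !inE !negb_or => /and3P[_ _]; rewrite eq_sym.
Qed.

End Read.

Definition ctest b :=
  sq (nseq b (Inc vdr) ++ [:: IfLt vdl vdr Skip (Inc vbad); Zero vdr; Zero vdl]).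
Definition cmove := sq [:: rdf vdl; rdf vdl; rdf vdl; rdf vdl; rdf vdl; ctest 3].
Definition cbit := sq [:: rdf vdl; ctest 2].
(** [vbad] records every violation: a missing number, a move code above 2, a bit above 1, or input
    left over. [vpw] keeps the place where the input word starts, for the generating pass. *)
Definition ccheck :=
  sq [:: rdf vm; For ve (IfLt ve vm cmove Skip); rdf vn; rdf vl; add vpw vp;
         For ve (IfLt ve vl cbit Skip); IfBit vp (Inc vbad) (Inc vbad) Skip].

Section Check.
Variable s : seq nat.
Let x := bits_of_nats s.
Let N := size x.
Notation runs := (runs x).
Notation offs := (off s).
Notation badfs := (badf s).

Definition stc n l m p bad ve pw :=
  nth 0 [:: n; l; 0; 0; 0; 0; 0; 0; 0; 0; 0; 0; 0; m; p; bad; 0; 0; ve; 0; pw].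

(** Counting up to [b] saturates at [N], hence the minimum. A valid code has at least three numbers,
    so [N >= 3] and the minimum is [b] for the bounds 2 and 3 in use. *)
Definition tst b a bad := if a < minn b N then bad else minn bad.+1 N.

Lemma runs_incn v b e : e v <= N -> forall c e' w,
  runs (sq c) (upd e v (minn (e v + b) N)) e' w -> runs (sq (nseq b (Inc v) ++ c)) e e' w.
Proof.
move=> he c e' w h; elim: b e he h => [|b IH] e he h.
  by rewrite addn0 (minn_idPl he) upd_same in h.
apply: runs_seq0; first exact: runs_incs.
apply: IH; rewrite !upd_eq; first exact: geq_minr.
by rewrite upd_upd (_ : minn (minn _ N + b) N = minn (e v + b.+1) N) //; lia.
Qed.

Lemma runs_ctest b e : e vdr = 0 ->
  runs (ctest b) e (upd (upd e vbad (tst b (e vdl) (e vbad))) vdl 0) [::].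
Proof.
move=> e0; apply: runs_incn; first by rewrite e0.
rewrite e0 add0n.
apply: (@runs_seq0 _ _ _ _ (upd (upd e vdr (minn b N)) vbad (tst b (e vdl) (e vbad)))).
  move=> o; rewrite /= cats0 upd_eq upd_ne // /tst.
  case: ifP => _ /=; rewrite ?upd_ne //.
  have -> : e vbad = upd e vdr (minn b N) vbad by rewrite upd_ne.
  by rewrite upd_same.
apply: runs_seq0; first exact: runs_zero.
apply: runs_seq0; first exact: runs_zero.
rewrite (@updC e vdr vbad) // (@upd_upd _ vdr).
have -> : upd (upd e vbad (tst b (e vdl) (e vbad))) vdr 0 = upd e vbad (tst b (e vdl) (e vbad)).
  by rewrite -[in LHS](e0 : e vdr = 0) -[X in upd _ _ X](@upd_ne e vbad (tst b (e vdl) (e vbad)) vdr) // upd_same.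
exact: runs_skip.
Qed.

Definition mvbad i bad :=
  tst 3 (nth 0 s i.+4) (badfs i.+4 (badfs i.+3 (badfs i.+2 (badfs i.+1 (badfs i bad))))).
Fixpoint Bm bad j := if j is j'.+1 then mvbad (5 * j').+1 (Bm bad j') else bad.
Fixpoint Bw i bad j :=
  if j is j'.+1 then tst 2 (nth 0 s (i + j')) (badfs (i + j') (Bw i bad j')) else bad.

Lemma runs_cmove i e : e vdl = 0 -> e vdr = 0 -> e vt = 0 -> e vp = offs i ->
  runs cmove e (upd (upd e vp (offs i.+4.+1)) vbad (mvbad i (e vbad))) [::].
Proof.
move=> e1 e2 e3 e4.
apply: runs_seq0; first exact: (@runs_rdf _ _ i).
apply: runs_seq0; first exact: (@runs_rdf _ _ i.+1).
apply: runs_seq0; first exact: (@runs_rdf _ _ i.+2).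
apply: runs_seq0; first exact: (@runs_rdf _ _ i.+3).
apply: runs_seq0; first exact: (@runs_rdf _ _ i.+4).
apply: runs_seq0; first exact: runs_ctest.
move=> o; rewrite [exec _ _ _]/= cats0; congr pair; apply: functional_extensionality => u.
rewrite /mvbad /upd /=.
case: (u =P vdl) => [->|_] //; case: (u =P vbad) => // _; by case: (u =P vp).
Qed.

Lemma runs_cbit i e : e vdl = 0 -> e vdr = 0 -> e vt = 0 -> e vp = offs i ->
  runs cbit e (upd (upd e vp (offs i.+1)) vbad (tst 2 (nth 0 s i) (badfs i (e vbad)))) [::].
Proof.
move=> e1 e2 e3 e4.
apply: runs_seq0; first exact: (@runs_rdf _ _ i).
apply: runs_seq0; first exact: runs_ctest.
move=> o; rewrite [exec _ _ _]/= cats0; congr pair; apply: functional_extensionality => u.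
rewrite /upd /=.
case: (u =P vdl) => [->|_] //; case: (u =P vbad) => // _; by case: (u =P vp).
Qed.

Let m := nth 0 s 0.
Let i1 := (5 * m).+1.
Let n := nth 0 s i1.
Let l := nth 0 s i1.+1.

Lemma nth_le i : nth 0 s i <= N.
Proof.
case: (ltnP i (size s)) => hi; last by rewrite nth_default.
by have [h1 h2 _ _] := off_in hi; move: h1 h2; rewrite -/N; lia.
Qed.

Lemma off_le i : offs i <= N.
Proof.
case: (ltnP i (size s)) => hi; last by rewrite off_end.
by have [h1 h2 _ _] := off_in hi; move: h1 h2; rewrite -/N; lia.
Qed.

Definition bad0 := Bw i1.+2 (badfs i1.+1 (badfs i1 (Bm (badfs 0 0) m))) l.
Definition bad1 := if offs (i1.+2 + l) < N then minn bad0.+1 N else bad0.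

Lemma runs_ccheck :
  runs ccheck (fun=> 0) (stc n l m (offs (i1.+2 + l)) bad1 0 (offs i1.+2)) [::].
Proof.
have e0 : (fun=> 0) = stc 0 0 0 0 0 0 0.
  by apply: functional_extensionality => u; do 21?case: u => [|u] //; rewrite /stc nth_default.
rewrite e0.
apply: runs_seq0; first by apply: (@runs_rdf _ _ 0) => //; rewrite /off take0.
apply: (@runs_seq0 _ _ _ _ (stc 0 0 m (offs i1) (Bm (badfs 0 0) m) 0 0)).
  have := @runs_forlt x ve vm cmove (fun j => stc 0 0 m (offs (5 * j).+1) (Bm (badfs 0 0) j) 0 0) (fun=> [::]) m.
  rewrite flatten_nil_const /stc !upd_nth; apply=> //; first exact: nth_le.
  move=> j hj; have := @runs_cmove (5 * j).+1 (upd (stc 0 0 m (offs (5 * j).+1) (Bm (badfs 0 0) j) 0 0) ve j).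
  rewrite /stc !upd_nth (_ : 5 * j.+1 = (5 * j).+4.+1); last lia.
  by apply.
apply: runs_seq0; first exact: (@runs_rdf _ _ i1).
apply: runs_seq0; first exact: (@runs_rdf _ _ i1.+1).
apply: runs_seq0; first by apply: runs_add => //; exact: off_le.
apply: (@runs_seq0 _ _ _ _ (stc n l m (offs (i1.+2 + l)) bad0 0 (offs i1.+2))).
  have := @runs_forlt x ve vl cbit (fun j => stc n l m (offs (i1.+2 + j)) (Bw i1.+2 (badfs i1.+1 (badfs i1 (Bm (badfs 0 0) m))) j) 0 (offs i1.+2)) (fun=> [::]) l.
  rewrite flatten_nil_const /stc !upd_nth addn0; apply=> //; first exact: nth_le.
  move=> j hj; have := @runs_cbit (i1.+2 + j) (upd (stc n l m (offs (i1.+2 + j)) (Bw i1.+2 (badfs i1.+1 (badfs i1 (Bm (badfs 0 0) m))) j) 0 (offs i1.+2)) ve j).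
  rewrite /stc !upd_nth addnS.
  by apply.
apply: runs_seq0; last exact: runs_skip.
move=> o; rewrite [exec _ _ _]/= /bad1 cats0 -/N.
by case: ifP => // _; case: ifP => _; rewrite /stc upd_nth.
Qed.

Definition vcond := [/\ size s = i1.+2 + l, forall j, j < m -> nth 0 s (5 * j).+4.+1 < 3 &
  forall j, j < l -> nth 0 s (i1.+2 + j) < 2].

Lemma badf0 i b : 0 < N -> (badfs i b == 0) = (i < size s) && (b == 0).
Proof. by move=> h; rewrite /badf -/x -/N; case: ifP => //=; lia. Qed.
Lemma tst0 k a b : 0 < N -> (tst k a b == 0) = (a < minn k N) && (b == 0).
Proof. by move=> h; rewrite /tst; case: ifP => //=; lia. Qed.

(** The check never lowers [vbad], and for [N > 0] saturation does not bring it back to 0; so it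
    ends at 0 iff every single test has passed. *)
Lemma bad1P : 0 < N -> (bad1 == 0) <-> vcond.
Proof.
move=> hN.
have szN : size s <= N by rewrite /N /x size_bits leq_addl.
have off_lt i : i < size s -> offs i < N.
  by move=> hi; have [h1 h2 _ _] := off_in hi; move: h1 h2; rewrite -/N; lia.
have hBw j i b : Bw i b j == 0 <-> b == 0 /\ forall j', j' < j -> i + j' < size s /\ nth 0 s (i + j') < minn 2 N.
  elim: j => [|j IH] /=; first by split=> // -[].
  rewrite tst0 // badf0 //; split.
    case/and3P=> h1 h2 /IH [h3 h4]; split=> // j'; rewrite ltnS leq_eqVlt => /orP[/eqP ->|] //; exact: h4.
  case=> h1 h2; have [h3 h4] := h2 j (ltnSn j); rewrite h3 h4 /=; apply/IH; split=> // j' hj; apply: h2; exact: ltnW.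
have hBm j b : Bm b j == 0 <-> b == 0 /\ forall j', j' < j -> (5 * j').+4.+1 < size s /\ nth 0 s (5 * j').+4.+1 < minn 3 N.
  elim: j => [|j IH] /=; first by split=> // -[].
  rewrite /mvbad tst0 // !badf0 //; split.
    case/and5P=> h1 h2 _ _ /and3P[_ _ /IH [h3 h4]]; split=> // j'; rewrite ltnS leq_eqVlt => /orP[/eqP ->|] //; exact: h4.
  case=> h1 h2; have [h3 h4] := h2 j (ltnSn j); rewrite h3 h4 !(ltn_trans _ h3) //=; try by lia.
  by apply/IH; split=> // j' hj; apply: h2; exact: ltnW.
have H : bad1 == 0 <-> size s <= i1.+2 + l /\ bad0 == 0.
  rewrite /bad1; case: (ltnP (i1.+2 + l) (size s)) => hs.
    by rewrite off_lt //; split; [lia|case; lia].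
  by rewrite off_end // ltnn; split=> // -[].
apply: iff_trans H _; split.
  case=> h0 /hBw [h1 h2]; move: h1; rewrite !badf0 // => /and3P[h3 h4 /hBm [_ h5]].
  split.
  - have [el|[l' el]] : l = 0 \/ exists l', l = l'.+1 by case: l => [|l']; [left|right; exists l'].
      by move: h0; rewrite el addn0; lia.
    by have [] := h2 l'; move: h0; rewrite el; lia.
  - by move=> j /h5 [_ h]; exact: leq_trans h (geq_minl _ _).
  - by move=> j /h2 [_ h]; exact: leq_trans h (geq_minl _ _).
case=> h1 h2 h3; split; first by rewrite h1.
have N3 : 3 <= N by lia.
apply/hBw; split.
  rewrite !badf0 // h1; apply/and3P; split; try lia.
  apply/hBm; rewrite badf0 // h1; split; first by lia.
  by move=> j hj; have := h2 j hj; split; rewrite ?h1 /i1; lia.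
by move=> j hj; have := h3 j hj; split; rewrite ?h1; lia.
Qed.

End Check.

Definition blk (e : entry) := let '(q, a, q', b, d) := e in [:: q; a; q'; b; enc_move d].
Definition hp_nats M w n := enc_TM M ++ [:: n; size w] ++ map nat_of_bool w.

Lemma hp_natsE M w n : hp_nats M w n = size (tm_delta M) ::
  (flatten (map blk (tm_delta M)) ++ [:: n, size w & map nat_of_bool w]).
Proof. by []. Qed.

Lemma size_tab D : size (flatten (map blk D)) = 5 * size D.
Proof. by elim: D => //= -[[[[q a] q'] b] d] D IH; rewrite /= IH; lia. Qed.

Lemma nth_tab D r j i : j < size D -> i < 5 ->
  nth 0 (flatten (map blk D) ++ r) (5 * j + i) = nth 0 (blk (nth dent D j)) i.
Proof.
move=> + hi; elim: D j => // e D IH [|j] hj /=.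
  case: e {IH hj} => [[[[q a] q'] b] d]; rewrite muln0 add0n.
  by do 5!(case: i hi => [//|i hi]).
rewrite (_ : 5 * j.+1 + i = 5 + (5 * j + i)); last lia.
by rewrite -(IH j hj); case: (e) => [[[[q a] q'] b] d].
Qed.

Lemma nth_tab_end D r i : nth 0 (flatten (map blk D) ++ r) (5 * size D + i) = nth 0 r i.
Proof. by rewrite nth_cat size_tab ltnNge leq_addr addKn. Qed.

Lemma dec_tab m r : 5 * m <= size r -> (forall j, j < m -> nth 0 r (5 * j + 4) < 3) ->
  exists D r', size D = m /\ r = flatten (map blk D) ++ r'.
Proof.
elim: m r => [|m IH] r; first by exists [::], r.
case: r => [|q [|a [|q' [|b [|d r]]]]] /= hs h; try lia.
have [||D [r' [h1 h2]]] := IH r; first lia.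
  by move=> j hj; have := h j.+1 hj; rewrite (_ : 5 * j.+1 + 4 = 5 + (5 * j + 4)) //; lia.
have [d' hd] : exists d', d = enc_move d'.
  by have := h 0 isT; rewrite /=; case: d {h hs} => [|[|[|]]] // _; [exists MoveL|exists MoveR|exists Stay].
by exists ((q, a, q', b, d') :: D), r'; rewrite /= h1 h2 hd.
Qed.

Lemma dec_bits r : (forall j, j < size r -> nth 0 r j < 2) -> exists w, r = map nat_of_bool w.
Proof.
elim: r => [|a r IH] h; first by exists [::].
have [w ->] := IH (fun j => h j.+1).
by have := h 0 isT; case: a {h} => [|[|]] //= _; [exists (false :: w)|exists (true :: w)].
Qed.

Lemma vcondP s : vcond s <-> exists M w n, s = hp_nats M w n.
Proof.
rewrite /vcond; split.
- case: s => [|m s] [hs h1 h2]; first by rewrite /= in hs.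
  rewrite [nth 0 (m :: s) 0]/= in hs h1 h2.
  have [||D [r [eD er]]] := @dec_tab m s.
  + by move: hs; rewrite /=; lia.
  + by move=> j /h1; rewrite addn4.
  move: h2 hs; rewrite er -eD [size (_ :: _)]/= size_cat size_tab.
  rewrite -[nth 0 (_ :: _) (_ * _).+2]/(nth 0 (flatten (map blk D) ++ r) (5 * size D).+1).
  rewrite -addn1 nth_tab_end => h2 hs.
  case: r er h2 hs => [|n [|l r]] er /= h2 hs; try lia.
  have hr : size r = l by lia.
  have [|w ew] := @dec_bits r.
    move=> j hj; have := h2 j; rewrite hr in hj => /(_ hj).
    by rewrite (_ : _ + j = 5 * size D + j.+2) ?nth_tab_end //; lia.
  exists (MkTM D), w, n; rewrite hp_natsE /= -ew.
  by rewrite -hr ew size_map.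
- case=> M [w [n ->]]; rewrite hp_natsE; set D := tm_delta M; set r := [:: n, _ & _].
  have hl : nth 0 (size D :: (flatten (map blk D) ++ r)) (5 * size D).+2 = size w.
    rewrite -[LHS]/(nth 0 (flatten (map blk D) ++ r) (5 * size D).+1) -addn1.
    by rewrite nth_tab_end.
  rewrite [nth 0 _ 0]/= hl; split.
  + by rewrite /= size_cat size_tab /r /= size_map !addnS !addSn.
  + move=> j hj; rewrite -[nth 0 _ _.+1]/(nth 0 (flatten (map blk D) ++ r) (5 * j).+4) -addn4 nth_tab //.
    by case: (nth dent D j) => [[[[q a] q'] b] []].
  + move=> j hj; rewrite -[nth 0 (_ :: _) _]/(nth 0 (flatten (map blk D) ++ r) ((5 * size D).+2 + j)).
    rewrite -addn2 -addnA nth_tab_end /r /= (nth_map false) //; by case: (nth _ _ _).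
Qed.

(** * Generating the grammar *)

(** Turns the move code in [vc] into one of three indicators; [vdl] serves in passing as the
    constants 0 and 1 to compare with. *)
Definition cdir :=
  IfLt vdl vc (sq [:: Inc vdl; IfLt vdl vc (Inc vds) (Inc vdr); Zero vdl]) (Inc vdl).
Definition cclean := sq (Inc vidx :: map Zero [:: vq0; va0; vq1; vb; vdl; vdr; vds]).
Definition cent_tab :=
  sq [:: rdf vq0; add vq0 vl; Inc vq0; rdf va0; rdf vq1; add vq1 vl; Inc vq1; rdf vb; rdf vc;
         cdir; Zero vc; cent; cclean].
(** [Inc vb] turns the bit into its tape symbol; the states [ve + 1] and [ve] are those of the
    writing phase. *)
Definition cent_bit :=
  sq [:: rdf vb; Inc vb; add vq0 ve; Inc vq0; add vq1 ve; Inc vdl; cent; cclean].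
Definition cent_last := sq [:: add vq1 vl; Inc vq1; Inc vdr; cent; cclean].
(** The input is read a second time; [vidx] runs through the entries of the extended table across
    its three parts. *)
Definition cgen :=
  sq [:: add vne vm; add vne vl; Inc vne; cheader; ccount; cfam; Zero vp; rdf vdl; Zero vdl;
         For ve (IfLt ve vm cent_tab Skip); Zero vp; add vp vpw;
         For ve (IfLt ve vl cent_bit Skip); cent_last; cterms].

Lemma leq_sumn2 r i j : i < j < size r -> nth 0 r i + nth 0 r j <= sumn r.
Proof.
elim: r i j => [|a r IH] [|i] [|j] //=; last by move=> h; have := IH i j h; lia.
move=> h; rewrite leq_add2l; elim: r j h {IH} => [|b r IH] [|j] //= h; first exact: leq_addr.
by have := IH j h; lia.
Qed.

Lemma enc_BisimE G T U : enc_Bisim G T U =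
  bits_of_nats (size (g_arity G) :: g_arity G) ++ (bits_of_nats [:: size (g_rules G)] ++
  (bits_of_nats (flatten (map enc_rule (g_rules G))) ++ bits_of_nats (enc_term T ++ enc_term U))).
Proof.
by rewrite /enc_Bisim /enc_grammar -cat_cons -(cat1s (size (g_rules G))) !bits_cat -!catA.
Qed.

Lemma enc_rules_cat r D sp : bits_of_nats (flatten (map enc_rule (r ++ flatten (map (rules_of D) sp)))) =
  bits_of_nats (flatten (map enc_rule r)) ++ rule_bits D sp.
Proof. by rewrite map_cat flatten_cat bits_cat. Qed.

Section Gen.
Variables (M : TM) (w : seq bool) (n : nat).
Let s := hp_nats M w n.
Let x := bits_of_nats s.
Let N := size x.
Let D := tm_delta M.
Let m := size D.
Let l := size w.
Let ents := ments D w.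
Let i1 := (5 * m).+1.
Notation runs := (runs x).
Notation offs := (off s).
Let pw := offs i1.+2.
Let ne := m + l + 1.

Lemma size_ents : size ents = ne.
Proof. by rewrite /ents /ments !size_cat !size_map size_iota /ne addnA. Qed.

Lemma size_hp : size s = i1.+2 + l.
Proof. by rewrite /s hp_natsE /= size_cat size_tab /= size_map !addnS !addSn. Qed.

Lemma nth_hp_tab j i : j < m -> i < 5 -> nth 0 s (5 * j + i).+1 = nth 0 (blk (nth dent D j)) i.
Proof. by move=> hj hi; exact: (@nth_tab D [:: n, l & map nat_of_bool w]). Qed.

Lemma nth_hp_end i : nth 0 s (5 * m + i).+1 = nth 0 [:: n, l & map nat_of_bool w] i.
Proof. exact: (@nth_tab_end D). Qed.

Lemma hp_n : nth 0 s i1 = n.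
Proof. by rewrite /i1 -[5 * m]addn0 nth_hp_end. Qed.
Lemma hp_l : nth 0 s i1.+1 = l.
Proof. by rewrite /i1 -addn1 nth_hp_end. Qed.
Lemma hp_bit j : j < l -> nth 0 s (i1.+2 + j) = nth false w j.
Proof.
move=> hj; rewrite (_ : i1.+2 + j = (5 * m + j.+2).+1); last by rewrite /i1; lia.
by rewrite nth_hp_end /= (nth_map false).
Qed.

(** A unary code is as long as the sum of its numbers plus their count. Hence even a shifted state
    [q + l + 1] stays below [N], and no counter saturates while the grammar is generated. *)
Lemma hp_le2 i j : i < j < size s -> nth 0 s i + nth 0 s j + size s <= N.
Proof. by move=> h; rewrite /N /x size_bits leq_add2r; exact: leq_sumn2. Qed.

Lemma hp_le1 i : i < size s -> nth 0 s i + size s <= N.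
Proof.
move=> h; case: (ltnP i i1) => hi.
  by have := @hp_le2 i i1; rewrite hi size_hp; lia.
by have := @hp_le2 0 i; rewrite h (leq_trans _ hi) //; lia.
Qed.

Lemma hp_nl : n + l + size s <= N.
Proof. by have := @hp_le2 i1 i1.+1; rewrite hp_n hp_l size_hp; apply; lia. Qed.

Lemma hp_entry j q a q1 b d : j < m -> nth dent D j = (q, a, q1, b, d) ->
  let i := (5 * j).+1 in
  [/\ nth 0 s i = q, nth 0 s i.+1 = a, nth 0 s i.+2 = q1, nth 0 s i.+3 = b &
   [/\ nth 0 s i.+4 = enc_move d, q + l.+1 < N, a < N, q1 + l.+1 < N & b < N]].
Proof.
move=> hj ed i; have hs : i.+4 < i1 by rewrite /i /i1; lia.
have hz := size_hp.
have f0 : nth 0 s i = q by have := nth_hp_tab (i := 0) hj isT; rewrite ed addn0.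
have f1 : nth 0 s i.+1 = a by have := nth_hp_tab (i := 1) hj isT; rewrite ed addn1.
have f2 : nth 0 s i.+2 = q1 by have := nth_hp_tab (i := 2) hj isT; rewrite ed addn2.
have f3 : nth 0 s i.+3 = b by have := nth_hp_tab (i := 3) hj isT; rewrite ed addn3.
have f4 : nth 0 s i.+4 = enc_move d by have := nth_hp_tab (i := 4) hj isT; rewrite ed addn4.
have b0 : q + l + size s <= N by have := @hp_le2 i i1.+1; rewrite f0 hp_l; apply; lia.
have b1 : a + size s <= N by rewrite -f1; apply: hp_le1; lia.
have b2 : q1 + l + size s <= N by have := @hp_le2 i.+2 i1.+1; rewrite f2 hp_l; apply; lia.
have b3 : b + size s <= N by rewrite -f3; apply: hp_le1; lia.
by split=> //; split=> //; lia.
Qed.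

Lemma ents_tab j q a q1 b d : j < m -> nth dent D j = (q, a, q1, b, d) ->
  nth dent ents j = (q + l.+1, a, q1 + l.+1, b, d).
Proof. by move=> hj ed; rewrite /ents /ments nth_cat size_map hj (nth_map dent) // ed. Qed.

Lemma ents_bit j : j < l ->
  nth dent ents (m + j) = (j.+1, 0, j, sym_of_bit (nth false w j), MoveL).
Proof.
move=> hj; rewrite /ents /ments nth_cat size_map ltnNge leq_addr /= addKn nth_cat size_map size_iota hj.
by rewrite (nth_map 0) ?size_iota // nth_iota.
Qed.

Lemma ents_last : nth dent ents (m + l) = (0, 0, l.+1, 0, MoveR).
Proof.
rewrite /ents /ments nth_cat size_map ltnNge leq_addr /= addKn nth_cat size_map size_iota ltnn.
by rewrite subnn.
Qed.

Lemma ents_bound i : i < size ents ->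
  let '(q0, a0, q1, b, d) := nth dent ents i in [&& q0 < N, a0 < N, q1 < N & b < N].
Proof.
rewrite size_ents /ne => hi; have := hp_nl; have := size_hp => hz hnl.
case: (ltnP i m) => h1.
  case ed: (nth dent D i) => [[[[q a] q1] b] d].
  have [_ _ _ _ [_ c1 c2 c3 c4]] := hp_entry h1 ed.
  by rewrite (ents_tab h1 ed) c1 c2 c3 c4.
rewrite -(subnKC h1); case: (ltnP (i - m) l) => h2.
  rewrite ents_bit //; have : sym_of_bit (nth false w (i - m)) <= 2 by case: (nth _ _ _).
  by move=> h3; apply/and4P; split; lia.
rewrite (_ : i - m = l) ?ents_last; last lia.
by apply/and4P; split; lia.
Qed.

Definition stg idx p ve q0 a0 q1 b dl dr ds :=
  nth 0 [:: n; l; ne; 0; 0; q0; a0; q1; b; dl; dr; ds; idx; m; p; 0; 0; 0; ve; 0; pw].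
Definition stg0 idx p ve := stg idx p ve 0 0 0 0 0 0 0.

Lemma envok_stg idx p ve q0 a0 q1 b dl dr ds :
  [&& idx <= N, p <= N, ve <= N & [&& q0 <= N, a0 <= N, q1 <= N, b <= N & [&& dl <= N, dr <= N & ds <= N]]] ->
  envok x (stg idx p ve q0 a0 q1 b dl dr ds).
Proof.
move=> h; split=> //; rewrite /stg.
have : all (fun a => a <= N) [:: n; l; ne; 0; 0; q0; a0; q1; b; dl; dr; ds; idx; m; p; 0; 0; 0; ve; 0; pw].
  have := hp_nl; have := size_hp; have := off_le s i1.+2; rewrite -/x -/N -/pw /= /ne /i1; lia.
move: [:: n, _ & _] => r hr v; case: (ltnP v (size r)) => hv; last by rewrite nth_default.
by move/all_nthP: hr; apply.
Qed.

Lemma runs_eq c e e' e2 wd wd2 : runs c e e' wd -> e' = e2 -> wd = wd2 -> runs c e e2 wd2.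
Proof. by move=> h <- <-. Qed.

Lemma runs_cent idx p ve q0 a0 q1 b d : idx < N -> p <= N -> ve <= N ->
  nth dent ents idx = (q0, a0, q1, b, d) -> q0 <= N -> a0 <= N -> q1 <= N -> b <= N -> 0 < N ->
  runs (sq [:: cent; cclean]) (stg idx p ve q0 a0 q1 b (isL d) (isR d) (isS d)) (stg0 idx.+1 p ve)
    (rule_bits (gD n) (ent_spec n l N ents idx)).
Proof.
move=> h1 h2 h3 hi h4 h5 h6 h7 hN; rewrite -[X in runs _ _ _ X]cats0.
apply: runs_seq.
  apply: emits_ent => //; last by rewrite hi.
  - apply: envok_stg; rewrite h2 h3 h4 h5 h6 h7 (ltnW h1) /=.
    by move: hN; case: d {hi} => /= ->.
  - exact: esym size_ents.
apply: (@runs_seq0 _ _ _ _ (stg0 idx.+1 p ve)); last exact: runs_skip.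
apply: runs_seq0; first exact: runs_inc.
do 7!(apply: runs_seq0; first exact: runs_zero).
rewrite /stg !upd_nth; exact: runs_skip.
Qed.

Lemma runs_cdir e d : e vc = enc_move d -> e vdl = 0 -> e vdr = 0 -> e vds = 0 -> 0 < N ->
  runs cdir e (upd (upd (upd e vdl (isL d)) vdr (isR d)) vds (isS d)) [::].
Proof.
move=> h1 h2 h3 h4 hN o; rewrite cats0.
have e1 v : minn (e v).+1 (size x) = if e v is a.+1 then minn a.+2 (size x) else 1.
  by case: (e v) => //; rewrite (minn_idPl _).
have hx : minn 1 (size x) = 1 by rewrite (minn_idPl _).
case: d h1 => h1; rewrite /= h1 h2 /= ?hx ?upd_eq ?(@upd_ne _ vdl _ vc) // ?h1 /= ?upd_ne // ?h3 ?h4 ?hx;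
  congr pair; apply: functional_extensionality => u; rewrite /upd;
  case: (u =P vdl) => e2; case: (u =P vdr) => e3; case: (u =P vds) => e4; subst; rewrite ?h2 ?h3 ?h4 //.
Qed.

Lemma runs_cent_tab j : j < m ->
  runs cent_tab (upd (stg0 j (offs (5 * j).+1) 0) ve j) (upd (stg0 j.+1 (offs (5 * j.+1).+1) 0) ve j)
   (rule_bits (gD n) (ent_spec n l N ents j)).
Proof.
move=> hj; set i := (5 * j).+1.
have hs : i.+4 < i1 by rewrite /i /i1; lia.
have hz := size_hp.
case ed: (nth dent D j) => [[[[q a] q1] b] d].
have he := ents_tab hj ed.
have [f0 f1 f2 f3 [f4 b0 b1 b2 b3]] := hp_entry hj ed; rewrite -/i in f0 f1 f2 f3 f4.
have c0 : q + l < N by lia.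
have c2 : q1 + l < N by lia.
have c3 : j < N by have := hp_nl; lia.
apply: runs_seq0; first by apply: (@runs_rdf_in s _ i) => //; lia.
rewrite f0; apply: runs_seq0; first by apply: runs_add => //; exact: ltnW c0.
apply: runs_seq0; first by apply: runs_inc; exact: c0.
apply: runs_seq0; first by apply: (@runs_rdf_in s _ i.+1) => //; lia.
rewrite f1; apply: runs_seq0; first by apply: (@runs_rdf_in s _ i.+2) => //; lia.
rewrite f2; apply: runs_seq0; first by apply: runs_add => //; exact: ltnW c2.
apply: runs_seq0; first by apply: runs_inc; exact: c2.
apply: runs_seq0; first by apply: (@runs_rdf_in s _ i.+3) => //; lia.
rewrite f3; apply: runs_seq0; first by apply: (@runs_rdf_in s _ i.+4) => //; lia.
rewrite f4; apply: runs_seq0; first by apply: (@runs_cdir _ d) => //; lia.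
apply: runs_seq0; first exact: runs_zero.
have -> : upd (stg0 j.+1 (offs (5 * j.+1).+1) 0) ve j = stg0 j.+1 (offs i.+4.+1) j.
  by rewrite /stg0 /stg upd_nth (_ : 5 * j.+1 = i.+4) // /i; lia.
have := @runs_cent j (offs i.+4.+1) j (q + l.+1) a (q1 + l.+1) b d.
rewrite /stg0 /stg !upd_nth !(addnS _ l) => H; apply: H; rewrite -?addnS //; try lia; try exact: off_le.
Qed.

Lemma runs_cent_bit j p : j < l -> p = offs (i1.+2 + j) ->
  runs cent_bit (upd (stg0 (m + j) p 0) ve j) (upd (stg0 (m + j.+1) (offs (i1.+2 + j.+1)) 0) ve j)
   (rule_bits (gD n) (ent_spec n l N ents (m + j))).
Proof.
move=> hj ->; have hz := size_hp.
have he := ents_bit hj.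
have c0 : j.+1 < N by have := hp_nl; lia.
have c1 : i1.+2 + j < size s by lia.
have c2 : (nth false w j).+1 <= N by case: (nth _ _ _); move: c0; lia.
have c3 : 1 < N by lia.
apply: runs_seq0; first exact: (@runs_rdf_in s _ (i1.+2 + j)).
rewrite hp_bit //; apply: runs_seq0; first exact: runs_inc.
apply: runs_seq0; first by apply: runs_add => //; rewrite -/N; exact: ltnW (ltnW c0).
apply: runs_seq0; first by apply: runs_inc; exact: ltnW.
apply: runs_seq0; first by apply: runs_add => //; rewrite -/N; exact: ltnW (ltnW c0).
apply: runs_seq0; first by apply: runs_inc; exact: ltnW.
have -> : upd (stg0 (m + j.+1) (offs (i1.+2 + j.+1)) 0) ve j = stg0 (m + j).+1 (offs (i1.+2 + j).+1) j.
  by rewrite /stg0 /stg upd_nth !addnS.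
have := @runs_cent (m + j) (offs (i1.+2 + j).+1) j j.+1 0 j (sym_of_bit (nth false w j)) MoveL.
have -> : sym_of_bit (nth false w j) = (nth false w j).+1 by case: (nth _ _ _).
rewrite /stg0 /stg !upd_nth => H; apply: H => //; try lia; try exact: off_le.
- by have := hp_nl; lia.
- by rewrite he; congr (_, _, _, _, _); case: (nth _ _ _).
Qed.

Lemma runs_cent_last p : p <= N ->
  runs cent_last (stg0 (m + l) p 0) (stg0 ne p 0)
   (rule_bits (gD n) (ent_spec n l N ents (m + l))).
Proof.
move=> hp; have hz := size_hp; have := hp_nl => hnl.
have he := ents_last.
have d0 : l < N by lia.
have d1 : 0 < N by lia.
apply: runs_seq0; first by apply: runs_add => //; exact: ltnW d0.
apply: runs_seq0; first by apply: runs_inc; exact: d0.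
apply: runs_seq0; first by apply: runs_inc; exact: d1.
have := @runs_cent (m + l) p 0 0 0 l.+1 0 MoveR.
rewrite /stg0 /stg !upd_nth /ne addn1 => H; apply: H => //; try lia.
Qed.

Let G := game_grammar (gD n) NN (gspec n l N ents).

Lemma runs_cgen : exists e', runs cgen (stc n l m (offs (i1.+2 + l)) 0 0 pw) e'
  (enc_Bisim G (pos 0 nC (rho0 n)) (pos 1 nC (rho0 n))).
Proof.
have hz := size_hp; have hnl := hp_nl.
have hm : m + l < N by lia.
have hp i : offs i <= N by exact: off_le.
have hmN : m <= N by lia.
have hlN : l <= N by lia.
have hgk p : p <= N -> genok x n l ents (stg0 0 p 0).
  move=> h; split=> //; last exact: esym size_ents.
  by apply: envok_stg; rewrite h.
(* The printed word is left open and collected from the program piece by piece; its agreement with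
   the code of the grammar is then only a matter of regrouping. *)
eexists; apply: runs_eq; last first.
- shelve.
- reflexivity.
rewrite /cgen.
apply: runs_seq0; first by apply: runs_add => //; exact: leq_trans (leq_addr l m) (ltnW hm).
apply: runs_seq0; first by apply: runs_add => //; exact: ltnW hm.
apply: runs_seq0; first by apply: runs_inc; exact: hm.
have -> : upd (upd (upd (stc n l m (offs (i1.+2 + l)) 0 0 pw) vne (0 + m)) vne (m + l)) vne (m + l).+1
   = stg0 0 (offs (i1.+2 + l)) 0 by rewrite /stc !upd_nth /stg0 /stg /ne addn1.
apply: runs_seq; first by apply: emits_header; exact: hgk.
apply: runs_seq; first by apply: emits_count; exact: hgk.
apply: runs_seq; first by apply: emits_fam; exact: hgk.
apply: runs_seq0; first exact: runs_zero.
apply: runs_seq0; first by apply: (@runs_rdf_in s _ 0) => //; rewrite ?hz // /off take0.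
apply: runs_seq0; first exact: runs_zero.
have -> : upd (upd (upd (upd (stg0 0 (offs (i1.+2 + l)) 0) vp 0) vp (offs 1)) vdl (nth 0 s 0)) vdl 0 = stg0 0 (offs 1) 0.
  by rewrite /stg0 /stg !upd_nth.
apply: runs_seq.
  apply: (@runs_forlt x ve vm cent_tab (fun j => stg0 j (offs (5 * j).+1) 0)
    (fun j => rule_bits (gD n) (ent_spec n l N ents j)) m) => //.
  by move=> j hj; exact: runs_cent_tab.
apply: runs_seq0; first exact: runs_zero.
apply: runs_seq0; first by apply: runs_add => //; exact: hp.
have -> : upd (upd (stg0 m (offs (5 * m).+1) 0) vp 0) vp (0 + pw) = stg0 (m + 0) (offs (i1.+2 + 0)) 0.
  by rewrite /stg0 /stg !upd_nth !addn0.
apply: runs_seq.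
  apply: (@runs_forlt x ve vl cent_bit (fun j => stg0 (m + j) (offs (i1.+2 + j)) 0)
    (fun j => rule_bits (gD n) (ent_spec n l N ents (m + j))) l) => //.
  by move=> j hj; exact: runs_cent_bit.
apply: runs_seq; first by apply: runs_cent_last; exact: hp.
apply: runs_seq; last exact: runs_skip.
apply: emits_terms => //; apply: envok_stg; rewrite (hp _) /ne; lia.
Unshelve.
rewrite -[stg0 _ _ _ vn]/n -/G cats0.
have eents : flatten [seq rule_bits (gD n) (ent_spec n l N ents j) | j <- iota 0 m] ++
    (flatten [seq rule_bits (gD n) (ent_spec n l N ents (m + j)) | j <- iota 0 l] ++
    rule_bits (gD n) (ent_spec n l N ents (m + l))) =
    rule_bits (gD n) (flatten [seq ent_spec n l N ents i | i <- iota 0 (size ents)]).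
  rewrite size_ents rule_bits_flatten -map_comp /ne !iotaD !map_cat !flatten_cat add0n.
  have one (f : nat -> seq bool) b : flatten [seq f i | i <- iota b 1] = f b by rewrite /= cats0.
  rewrite -[in iota m l](addn0 m) iotaDl -map_comp one -catA /comp; reflexivity.
have esp : rule_bits (gD n) (fam_spec x n l ents) ++
    rule_bits (gD n) (flatten [seq ent_spec n l N ents i | i <- iota 0 (size ents)]) =
    rule_bits (gD n) (gspec n l N ents).
  by rewrite -rule_bits_cat /fam_spec /gspec -!catA.
rewrite enc_BisimE; congr (_ ++ (_ ++ _)).
rewrite -[g_rules G]/(base_rules ++ flatten (map (rules_of (gD n)) (gspec n l N ents))).
rewrite enc_rules_cat -esp -eents.
have catA6 (a b c d f g : seq bool) : (a ++ b) ++ (c ++ (d ++ (f ++ g))) = (a ++ (b ++ (c ++ (d ++ f)))) ++ g.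
  by rewrite -!catA.
exact: catA6.
Qed.

End Gen.

(** * The reduction *)

Definition ctriv := lit (nseq 6 false).
(** A nonempty word is a sequence of unary numbers iff its last bit is 0; [vgo] is set iff this is
    so, and only then does [rdf] behave as analysed. *)
Definition clast := For vt (IfBit vt (Zero vgo) (Seq (Zero vgo) (Inc vgo)) Skip).
Definition program :=
  Seq clast (IfLt vz vgo (Seq (Zero vgo) (Seq ccheck (IfLt vz vbad ctriv cgen))) ctriv).
Definition output x := (exec x program st0).2.

Lemma wf_program : wfc 23 program.
Proof. by vm_compute. Qed.

Lemma runs_clast x :
  runs x clast (fun=> 0) (upd (fun=> 0) vgo ((0 < size x) && ~~ last true x)) [::].
Proof.
have := @runs_for x vt (IfBit vt (Zero vgo) (Seq (Zero vgo) (Inc vgo)) Skip)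
  (fun j => upd (fun=> 0) vgo ((0 < j) && ~~ nth true x j.-1)) (fun=> [::]).
rewrite flatten_nil_const /= nth_last => H.
have e0 : upd (fun=> 0) vgo false = (fun=> 0) by exact: (upd_same (fun=> 0) vgo).
rewrite e0 in H; apply: H => // j hj o; rewrite [exec _ _ _]/= cats0 upd_eq hj (set_nth_default true false) //.
case: (nth true x j); congr pair; apply: functional_extensionality => u; rewrite /upd /=.
  by case: (u =P vgo) => [->|].
by case: (u =P vgo) => [->|] //=; rewrite (minn_idPl _) //; apply: leq_ltn_trans hj.
Qed.

Lemma bits_rcons y : exists s, rcons y false = bits_of_nats s.
Proof.
elim: y => [|b y [s hs]]; first by exists [:: 0].
case: b; last by exists (0 :: s); rewrite /= hs.
case: s hs => [|a s] hs; first by case: y hs.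
by exists (a.+1 :: s); rewrite /= hs.
Qed.

Lemma last_bits a s : last true (bits_of_nats (a :: s)) = false.
Proof.
elim/last_ind: s => [|s b _].
  by rewrite /bits_of_nats /= cats0 last_cat.
by rewrite -rcons_cons -cats1 bits_cat last_cat (bits1 b) last_cat.
Qed.

(** Six zeros encode the empty grammar with the terms [Var 0] and [Var 0]: a bisimilar pair, used as
    the answer to malformed inputs. *)
Definition triv_bits := nseq 6 false.

Lemma exec_seqE x c1 c2 s : exec x (Seq c1 c2) s = exec x c2 (exec x c1 s).
Proof. by []. Qed.

Lemma exec_ltE x v u c1 c2 e o :
  exec x (IfLt v u c1 c2) (e, o) = if e v < e u then exec x c1 (e, o) else exec x c2 (e, o).
Proof. by []. Qed.

Lemma exec_triv x e : (exec x ctriv (e, [::])).2 = triv_bits.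
Proof. by rewrite (emits_lit x triv_bits e [::]). Qed.

Lemma gateE x c : exec x (Seq clast (IfLt vz vgo (Seq (Zero vgo) c) ctriv)) st0 =
  if (0 < size x) && ~~ last true x then exec x c st0
  else exec x ctriv (upd (fun=> 0) vgo 0, [::]).
Proof.
rewrite exec_seqE (runs_clast x [::]) exec_ltE upd_eq upd_ne //; case: (_ && _) => //.
rewrite -[(_ < _)]/true exec_seqE -[exec x (Zero vgo) _]/(upd _ vgo 0, [::]).
by rewrite upd_upd (upd_same (fun=> 0) vgo : upd _ vgo 0 = _).
Qed.

Lemma output_eq x : output x =
  if (0 < size x) && ~~ last true x then
    (exec x (Seq ccheck (IfLt vz vbad ctriv cgen)) st0).2
  else triv_bits.
Proof. by rewrite /output /program gateE; case: ifP => // _; rewrite exec_triv. Qed.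

Lemma output_bits s : s != [::] -> output (bits_of_nats s) =
  let m := nth 0 s 0 in let l := nth 0 s (5 * m).+2 in
  if bad1 s == 0 then
    (exec (bits_of_nats s) cgen (stc (nth 0 s (5 * m).+1) l m (off s ((5 * m).+3 + l)) 0 0 (off s (5 * m).+3), [::])).2
  else triv_bits.
Proof.
move=> hs; rewrite output_eq.
have -> : (0 < size (bits_of_nats s)) && ~~ last true (bits_of_nats s).
  by case: s hs => // a s _; rewrite last_bits size_bits /= addnS.
rewrite exec_seqE (runs_ccheck s [::]) exec_ltE -[X in X < _]/0 -[X in _ < X]/(bad1 s).
by case: (bad1 s) => [|b] //; rewrite exec_triv.
Qed.

Definition gr N M w n := game_grammar (gD n) NN (gspec n (size w) N (ments (tm_delta M) w)).

Lemma output_valid M w n : output (enc_HP M w n) =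
  enc_Bisim (gr (size (enc_HP M w n)) M w n) (pos 0 nC (rho0 n)) (pos 1 nC (rho0 n)).
Proof.
have hN : 0 < size (bits_of_nats (hp_nats M w n)) by rewrite size_bits /= addnS.
have h0 : bad1 (hp_nats M w n) == 0 by apply/(bad1P hN)/vcondP; exists M, w, n.
rewrite -[enc_HP M w n]/(bits_of_nats (hp_nats M w n)) output_bits // h0.
have [e' h] := runs_cgen M w n.
cbv zeta; rewrite -[nth 0 (hp_nats M w n) 0]/(size (tm_delta M)).
rewrite (hp_n M w n) (hp_l M w n).
by rewrite (h [::]).
Qed.

Lemma output_invalid x : ~ (exists M w n, x = enc_HP M w n) -> output x = triv_bits.
Proof.
move=> hx; case: (boolP ((0 < size x) && ~~ last true x)) => h; last by rewrite output_eq (negbTE h).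
have [s es] : exists s, x = bits_of_nats s.
  case/andP: h; case/lastP: x {hx} => // y b _; rewrite last_rcons => /negbTE ->; exact: bits_rcons.
subst x; have hs : s != [::] by apply: contraTneq h => ->.
rewrite output_bits //; cbv zeta; case: (bad1 s =P 0) => [/eqP h0|//].
case: hx; case/andP: h => hN _.
have /vcondP [M [w [n e]]] := (bad1P hN).1 h0.
by exists M, w, n; rewrite e.
Qed.

(** * Well-formedness of the printed grammar, and the final equivalence *)

Section Wf.
Variables (D : nat) (sp : spec).
Hypothesis hsp : forall A it, In_list (A, it) sp -> A < NN /\ wf_item D NN it.
Let ar := [:: 1; 0; 3] ++ nseq (5 * NN) D.

Lemma nt_arity A k : A < NN -> k < 5 -> (nt A k < size ar) && (nth 0 ar (nt A k) == D).
Proof.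
move=> hA hk; have h : 5 * A + k < 5 * NN by lia.
rewrite /nt /ar size_cat size_nseq; apply/andP; split; first by rewrite -[size [:: _; _; _]]/3; lia.
by rewrite -addnA -[nth 0 _ _]/(nth 0 (nseq (5 * NN) D) (5 * A + k)) nth_nseq h.
Qed.

Lemma wf_succt (vb : nat -> bool) c t : wf_term ar vb t -> wf_term ar vb (iter c succt t).
Proof. by move=> h; elim: c => //= c IH; rewrite IH. Qed.

Lemma wf_argt (vb : nat -> bool) a : wf_arg D a -> (forall i, i < D -> vb i) -> wf_term ar vb (argt a).
Proof. by case: a => [i c|c] h hv; apply: wf_succt => //=; exact: hv. Qed.

Lemma wf_args (vb : nat -> bool) s : all (wf_arg D) s -> (forall i, i < D -> vb i) ->
  all (wf_term ar vb) (map argt s).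
Proof. by move=> h hv; elim: s h => //= a s IH /andP[h1 h2]; rewrite wf_argt // IH. Qed.

Lemma wf_AppE vb A Us : wf_term ar vb (App A Us) =
  [&& A < size ar, size Us == nth 0 ar A & all (wf_term ar vb) Us].
Proof. by []. Qed.

Lemma wf_ttgt (vb : nat -> bool) k t : wf_tgt D NN t -> k < 5 -> (forall i, i < D -> vb i) ->
  wf_term ar vb (ttgt k t).
Proof.
case/and3P=> h1 h2 h3 hk hv; have /andP[h4 h5] := nt_arity h1 hk.
by rewrite /ttgt wf_AppE h4 size_map (eqP h2) (eqP h5) eqxx wf_args.
Qed.

Lemma wf_pos (vb : nat -> bool) k A rho : A < NN -> k < 5 -> size rho = D -> wf_term ar vb (pos k A rho).
Proof.
move=> hA hk hr; have /andP[h4 h5] := nt_arity hA hk.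
rewrite /pos wf_AppE h4 size_map hr (eqP h5) eqxx /=; elim: rho {hr} => //= c s ->.
by rewrite andbT; exact: wf_succt.
Qed.

Lemma wf_game : wf_grammar (game_grammar D NN sp).
Proof.
rewrite /wf_grammar /game_grammar /= -/ar.
suff h A it : In_list (A, it) sp -> all (fun r => let '(A, a, V) := r in
    (A < size ar) && wf_term ar (fun i => i < nth 0 ar A) V) (rules_of D (A, it)).
  by elim: (sp) h => //= -[A it] s IH h; rewrite all_cat h ?IH //=; [move=> A' it' h'; apply: h; right|left].
move=> /hsp [hA hit].
have hid : wf_tgt D NN (A, idargs D).
  rewrite /wf_tgt /= hA /idargs size_map size_iota eqxx all_map /=.
  by apply/allP => i; rewrite mem_iota.
have ht k t j : k < 5 -> j < 5 -> wf_tgt D NN t ->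
    (nt A k < size ar) && wf_term ar (fun i => i < nth 0 ar (nt A k)) (ttgt j t).
  move=> hk hj h; have /andP[h4 h5] := nt_arity hA hk; rewrite h4.
  by apply: wf_ttgt => // i hi; rewrite (eqP h5).
have hm k s : k < 5 -> (size s == 3) && all (wf_arg D) s ->
    (nt A k < size ar) && wf_term ar (fun i => i < nth 0 ar (nt A k)) (App 2 (map argt s)).
  move=> hk /andP[h1 h2]; have /andP[h4 h5] := nt_arity hA hk; rewrite h4 wf_AppE size_map -[_ && (_ && _)]/((size s == 3) && _) h1 -[true && _]/(all _ _).
  by apply: wf_args => // i hi; rewrite (eqP h5).
have ac (T : Type) (p : pred T) y r : p y -> all p r -> all p (y :: r) by move=> /= -> ->.
case: it hit => [a t|t1 t2|s|s|] h; rewrite /rules_of.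
- by do 2!(apply: (ac); first exact: ht).
- by case/andP: h => h1 h2; do 11!(apply: (ac); first exact: ht).
- by apply: (ac); first exact: hm.
- by do 2!(apply: (ac); first exact: hm).
- by apply: (ac) => //; have /andP[-> _] := @nt_arity A 0 hA isT.
Qed.

End Wf.

Lemma L_Bisim_triv : L_Bisim triv_bits.
Proof.
exists (MkGrammar [::] [::]), (Var 0), (Var 0); split=> //; split=> //; split=> //; split=> //.
exists eq; split=> //; split=> [T U -> //|T U -> a T' h].
by exists T'.
Qed.

Lemma size_rho0 n : size (rho0 n) = gD n.
Proof. by rewrite /rho0 !size_cat size_nseq /= /gD; lia. Qed.

(** By unique decoding the output lies in [L_Bisim] iff the printed pair is bisimilar, that is, iff
    Attacker does not win the game. *)
Lemma L_Bisim_valid M w n : L_Bisim (output (enc_HP M w n)) <-> ~ HP_Ack_holds M w n.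
Proof.
set N := size (enc_HP M w n); set sp := gspec n (size w) N (ments (tm_delta M) w).
have hz := size_hp M w n; have hnl := hp_nl M w n; rewrite -/(enc_HP M w n) -/N hz in hnl.
have hw : awin sp nC (rho0 n) <-> HP_Ack_holds M w n.
  apply: iff_trans (halt_link M w n); apply: game_halt; try (by rewrite ?size_ents; lia) => i.
  exact: ents_bound.
have gs := gspec_good n (size w) N (ments (tm_delta M) w).
rewrite output_valid; split.
- case=> G [T [U [/enc_Bisim_inj [<- <- <-] [_ [_ [_ hbis]]]]]] /hw /(awin_sound gs) h.
  by apply: h hbis; rewrite size_rho0.
- move=> h; exists (gr N M w n), (pos 0 nC (rho0 n)), (pos 1 nC (rho0 n)).
  split=> //; split; first by apply: wf_game; exact: gs_wf gs.
  split; first by apply: wf_pos => //; exact: size_rho0.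
  split; first by apply: wf_pos => //; exact: size_rho0.
  by apply: (awin_complete gs); [move/hw|exact: size_rho0].
Qed.

Theorem theorem1 :
  poly_reduces L_HP_Ack L_Bisim \/ poly_reduces L_HP_Ack (fun x => ~ L_Bisim x).
Proof.
right; have [a [d h]] := lang_poly wf_program.
exists output, (tmof (9 * 2 ^ 23).+1 (prog 23 program)), a, d; split=> // x; split.
- by case=> M [w [n [-> hh]]] /L_Bisim_valid.
(* A malformed input cannot occur here: its output is the trivial bisimilar pair. *)
- move=> hx; case: (classic (exists M w n, x = enc_HP M w n)) => [[M [w [n e]]]|].
    exists M, w, n; split=> //; apply: NNPP => hn; apply: hx; rewrite e.
    exact/L_Bisim_valid.
  by move=> /output_invalid e; case: hx; rewrite e; exact: L_Bisim_triv.
Qed.
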